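(* Let $\mathcal{T}$ and $\widetilde{\mathcal{T}}$ be compact nonnegative self-adjoint operators in Hilbert spaces $\mathcal{H}$ and $\widetilde{\mathcal{H}}$ having the spectral asymptotics $$\mathcal{N}(t,\mathcal{T})\sim\frac{\varphi(1/t)\,s(\ln(1/t))}{t^{1/p}},\qquad \mathcal{N}(t,\widetilde{\mathcal{T}})\sim\frac{\widetilde\varphi(1/t)\,\widetilde s(\ln(1/t))}{t^{1/p}},\qquad t\to+0,$$ where $p>0$, $\varphi,\widetilde\varphi$ are slowly varying functions, and $s,\widetilde s$ are continuous periodic functions with periods $T$ and $\widetilde T$, respectively. Suppose that $$\int_1^\infty\varphi(\tau)\frac{d\tau}{\tau}=\int_1^\infty\widetilde\varphi(\tau)\frac{d\tau}{\tau}=\infty,$$ and that $s$ and $\widetilde s$ have no common period, i.e. the periods $T$ and $\widetilde T$ are incommensurable. Then $$\mathcal{N}(t,\mathcal{T}\otimes\widetilde{\mathcal{T}})\sim\frac{\psi(1/t)\,\phi(1/t)}{t^{1/p}},\qquad t\to+0,$$ where $\phi=\varphi\ast\widetilde\varphi$ and $\psi$ is a certain slowly varying function that is bounded and separated from zero.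
   Context: For a compact nonnegative self-adjoint operator $\mathcal{T}$ in a Hilbert space, $\lambda_n=\lambda_n(\mathcal{T})$ denote its positive eigenvalues arranged in nonincreasing order and repeated according to multiplicity, and $\mathcal{N}(t,\mathcal{T})=\#\{n:\lambda_n(\mathcal{T})>t\}$ for $t>0$. The operator $\mathcal{T}\otimes\widetilde{\mathcal{T}}$ acts in the Hilbert space $\mathcal{H}\otimes\widetilde{\mathcal{H}}$. The relation $f\sim g$ means $f=g\,(1+o(1))$. A positive (measurable) function $\varphi(\tau)$, $\tau>0$, is called slowly varying if $\varphi(c\tau)/\varphi(\tau)\to1$ as $\tau\to+\infty$ for every constant $c>0$. The Mellin convolution is $(\varphi\ast\psi)(\tau)=\int_1^\tau\varphi(\sigma)\psi(\tau/\sigma)\frac{d\sigma}{\sigma}$. Incommensurable means $T/\widetilde T$ is irrational. Standing assumptions: slowly varying functions in the spectral asymptotics are $C^2$-smooth with $\tau(\ln\varphi)'(\tau)\to0$ and $\tau^2(\ln\varphi)''(\tau)\to0$ as $\tau\to\infty$; the periodic functions $s,\widetilde s$ are continuous, positive (bounded and separated from zero), and $s(\tau)=e^{-\tau/p}\varrho(\tau)$, $\widetilde s(\tau)=e^{-\tau/p}\widetilde\varrho(\tau)$ with $\varrho,\widetilde\varrho$ monotone. *)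

(* Defs.v *)
From HB Require Import structures.
From mathcomp Require Import all_boot all_order all_algebra.
From mathcomp Require Import finmap complex.
From mathcomp Require Import all_classical all_reals all_analysis.
Import Order.TTheory GRing.Theory Num.Theory.
Import numFieldNormedType.Exports.

Set Implicit Arguments.
Unset Strict Implicit.
Unset Printing Implicit Defensive.

Local Open Scope classical_set_scope.
Local Open Scope card_scope.
Local Open Scope ring_scope.

(** The axioms force [K] to be [R] (with [conj = id]) or [R[i]]: an element [y]
    fixed by [conj] satisfies [y ^+ 2 = `|y| ^+ 2], hence lies in the image of
    [ofreal], and [K] has degree at most 2 over the elements fixed by [conj].
    The two models are [real_scalars] and [complex_scalars]. *)
Record realOrComplex (R : realType) (K : numFieldType) := RealOrComplex {
  conj : {rmorphism K -> K} ;
  ofreal : {rmorphism R -> K} ;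
  mul_conj : forall x : K, x * conj x = `|x| ^+ 2 ;
  ofreal_le : forall a b : R, (ofreal a <= ofreal b) = (a <= b) ;
  ofreal_surj : forall x : K, x \is Num.real -> exists a : R, ofreal a = x
}.

Definition real_scalars (R : realType) : realOrComplex R R.
Proof.
exists (idfun : {rmorphism R -> R}) (idfun : {rmorphism R -> R}) => //=.
- by move=> x; rewrite real_normK ?num_real// expr2.
- by move=> x _; exists x.
Defined.

Definition complex_scalars (R : realType) : realOrComplex R R[i].
Proof.
exists (Num.conj : {rmorphism R[i] -> R[i]}) (real_complex R) => /=.
- by move=> x; rewrite normCK.
- by move=> a b; rewrite lecR.
- by move=> [a b]; rewrite complex_real => /eqP ->; exists a.
Defined.

Record hilbertSpace (R : realType) (K : numFieldType) (k : realOrComplex R K) :=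
  HilbertSpace {
    hilbert_sort :> completeNormedModType K ;
    inner : {dot hilbert_sort for conj k} ;
    normr_inner : forall x : hilbert_sort, `|x| ^+ 2 = inner x x
  }.

Section Operators.
Variables (R : realType) (K : numFieldType) (k : realOrComplex R K).
Implicit Types H : hilbertSpace k.

Definition compact_operator H (A : H -> H) :=
  precompact (A @` [set x | `|x| <= 1]).

Definition self_adjoint H (A : H -> H) :=
  forall x y, inner H (A x) y = inner H x (A y).

Definition nonnegative_operator H (A : H -> H) :=
  forall x, 0 <= inner H (A x) x.

Definition is_basis H (E : set H) (n : nat) (v : 'I_n -> H) :=
  (forall c : 'I_n -> K, \sum_i c i *: v i = 0 -> forall i, c i = 0) /\
  E = range (fun c : 'I_n -> K => \sum_i c i *: v i).

Definition eigen_space H (A : H -> H) (mu : R) : set H :=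
  [set x | A x = ofreal k mu *: x].

Definition has_multiplicity H (A : H -> H) (mu : R) (n : nat) :=
  exists v : 'I_n -> H, is_basis (eigen_space A mu) v.

(** If there are finitely many positive eigenvalues, the sequence is completed
    by zeros.  A sequence satisfying this predicate is unique. *)
Definition eigenvalue_sequence H (A : H -> H) (lam : nat -> R) :=
  [/\ {homo lam : m n / (m <= n)%N >-> n <= m},
      (forall n, 0 <= lam n) &
      forall mu, 0 < mu -> exists n,
        has_multiplicity A mu n /\ [set j | lam j = mu] #= `I_n].

Definition eigenvalues H (A : H -> H) : nat -> R :=
  xget (fun=> 0) [set lam | eigenvalue_sequence A lam].

(** For a compact nonnegative self-adjoint [A] and [t > 0] the set below is
    finite; [fset_set] is empty on infinite sets. *)
Definition eigen_count H (A : H -> H) (t : R) : nat :=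
  #|` fset_set [set n | t < eigenvalues A n]|.

(** The Hilbert tensor product, determined up to a unitary isomorphism
    compatible with [tens]. *)
Record hilbertTensor H1 H2 := HilbertTensor {
  tensor_sort :> hilbertSpace k ;
  tens : {bilinear H1 -> H2 -> tensor_sort} ;
  inner_tens : forall x1 x2 y1 y2,
    inner tensor_sort (tens x1 x2) (tens y1 y2) = inner H1 x1 y1 * inner H2 x2 y2 ;
  dense_tens : dense [set z : tensor_sort |
    exists n (x : 'I_n -> H1) (y : 'I_n -> H2), z = \sum_i tens (x i) (y i)]
}.

(** By density these conditions determine [C] from [A] and [B]. *)
Definition is_tensor_operator H1 H2 (HH : hilbertTensor H1 H2)
    (A : H1 -> H1) (B : H2 -> H2) (C : HH -> HH) :=
  continuous C /\ forall x y, C (tens HH x y) = tens HH (A x) (B y).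

End Operators.

Section Functions.
Variable R : realType.
Implicit Types f g s : R -> R.

Definition slowly_varying f :=
  [/\ (forall x : R, 0 < x -> 0 < f x),
      measurable_fun (`]0, +oo[ : set R) f &
      forall c : R, 0 < c -> f (c * x) / f x @[x --> +oo] --> (1 : R)].

Definition C2_slow f :=
  [/\ (forall x : R, 0 < x -> derivable f x 1),
      (forall x : R, 0 < x -> derivable (derive1 f) x 1),
      (forall x : R, 0 < x -> {for x, continuous (derive1n 2 f)}),
      x * derive1 (@ln R \o f) x @[x --> +oo] --> (0 : R) &
      x ^+ 2 * derive1n 2 (@ln R \o f) x @[x --> +oo] --> (0 : R)].

Definition bounded_separated (D : set R) f :=
  exists m M, 0 < m /\ forall x, D x -> m <= f x <= M.

Definition exp_monotone (p : R) s :=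
  exists rho : R -> R,
    ({homo rho : x y / x <= y} \/ {homo rho : x y /~ x <= y}) /\
    forall x, s x = expR (- x / p) * rho x.

Definition mellin_conv f g (x : R) : R :=
  \int[lebesgue_measure]_(y in `[1, x]) (f y * g (x / y) / y).

Definition periodic_factor (p T : R) s :=
  [/\ 0 < T, continuous s, periodic s T,
      bounded_separated setT s & exp_monotone p s].

End Functions.

(* Main.v *)
(** In the variable [x = ln (1 / t)] the counting function of the tensor product is the Stieltjes
    convolution of the counting functions [N2] and [N1] of the factors, because the tensor products
    of eigenvectors diagonalize the tensor product of the operators.  On the grid of mesh [T1 / n]
    monotonicity encloses it between two consecutive discrete convolutions of [N2] with the
    increments of [N1].  The ends of such a convolution are negligible since the integrals of
    [phi1 / x] and [phi2 / x] diverge, so [N1] and [N2] can be replaced by their asymptotics; away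
    from the ends the factors [phi1] and [phi2] are nearly constant on long windows, so the periodic
    factors can be replaced by their means over windows.  On the grid [s1] is [n]-periodic, and as
    [T1 / T2] is irrational the means of [s2] over translations by multiples of [T1] converge
    uniformly to a constant.  Letting [n] go to infinity shows that [psi] can be taken constant. *)

Require Import Defs.
From HB Require Import structures.
From mathcomp Require Import all_boot all_order all_algebra.
From mathcomp Require Import all_classical all_reals all_analysis.
From mathcomp Require Import finmap zify ring lra.
Import Order.TTheory GRing.Theory Num.Theory.
Import numFieldNormedType.Exports.

Set Implicit Arguments.
Unset Strict Implicit.
Unset Printing Implicit Defensive.

Local Open Scope classical_set_scope.
Local Open Scope ring_scope.

(** The mesh divides [T1] so that only one periodic factor has to be averaged along an irrational
    translation: on a residue class modulo [n] the factor [s1] is constant, while the argument of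
    [s2] moves by multiples of [T1]. Window means do no harm because a window keeps its length while
    [m] grows, so that a shift of the summation index multiplies the weights by a factor near 1.
    Since periodic factors need not converge, their asymptotics are passed on as differences tending
    to 0 and not as quotients. For fixed [n] the quotient to be studied is enclosed in a band whose
    position depends on [n]; the bands are never computed or compared for different [n], and the
    limit comes from the completeness of [R]. On the operator side, the difficulty is that products
    of eigenvectors must be complete for [A12]; functionals are tested in one variable at a time, so
    that neither closed spans nor a spectral theorem for [A12] itself is needed. *)

Lemma near_eq_cvg_to (T : Type) (U : topologicalType) (F : set_system T)
    {FF : Filter F} (f g : T -> U) (l l' : U) :
  f x @[x --> F] --> l -> l = l' -> (\forall x \near F, f x = g x) ->
  g x @[x --> F] --> l'.
Proof. by move=> + <- fg; apply: cvg_trans; exact: near_eq_cvg. Qed.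

Lemma cvg_ord_sum (R : realType) (T : Type) (F : set_system T) {FF : Filter F}
    n (f : 'I_n -> T -> R) (l : 'I_n -> R) :
  (forall i, f i x @[x --> F] --> l i) ->
  \sum_(i < n) f i x @[x --> F] --> \sum_(i < n) l i.
Proof.
elim: n f l => [|n IH] f l fl.
  under eq_cvg do rewrite big_ord0; rewrite big_ord0; exact: cvg_cst.
under eq_cvg do rewrite big_ord_recl; rewrite big_ord_recl.
by apply: cvgD; [exact: fl|apply: IH => i; exact: fl].
Qed.

(** The approximating constant may change with [e], so a limit is obtained without a candidate for
    it: the image filter is Cauchy. *)
Lemma cvg_near_eps (R : realType) (T : Type) (F : set_system T)
    {FF : ProperFilter F} (f : T -> R) :
  (forall e : R, 0 < e -> exists c : R, \forall x \near F, `|f x - c| <= e) ->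
  exists l : R, f x @[x --> F] --> l.
Proof.
move=> fc; apply/cvg_ex/cauchy_cvgP/cauchy_exP => e e0.
have [c fce] := fc _ (divr_gt0 e0 (ltr0n R 2)).
exists c; apply: filterS fce => x /= fx.
rewrite -ball_normE /= distrC; apply: le_lt_trans fx _.
by rewrite ltr_pdivrMr// ltr_pMr// ltr1n.
Qed.

Lemma cvgn_norm_le (R : realType) (w : nat -> R) (l : R) :
  w i @[i --> \oo] --> l -> exists D : R, forall i, `|w i| <= D.
Proof.
move=> wl; have /cvg_seq_bounded[D [_ /(_ (D + 1))]] : cvgn w by apply/cvg_ex; exists l.
by rewrite ltrDl ltr01 => /(_ isT) HD; exists (D + 1) => i; exact: (HD i).
Qed.

(** * Convolutions of slowly varying sequences *)

Section WeightedSums.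
Variable R : realType.
Implicit Types P Q : nat -> R.

(** The trace of a slowly varying function on a geometric grid, [P i = phi (E ^+ i)]. The last
    clause is the discrete form of the divergence of the integral of [phi x / x]. *)
Definition slow_seq P :=
  [/\ forall i, 0 < P i, P i.+1 / P i @[i --> \oo] --> (1 : R) &
      forall B : R, exists m, B <= \sum_(i < m) P i].

Definition dconv P Q (m : nat) : R := \sum_(i < m.+1) P (m - i)%N * Q i.

Lemma dconvC P Q m : dconv P Q m = dconv Q P m.
Proof.
rewrite /dconv (reindex_inj rev_ord_inj)/=; apply: eq_bigr => i _.
by rewrite subSS subKn; [rewrite mulrC|rewrite -ltnS].
Qed.

Lemma dconv_gt0 P Q m : slow_seq P -> slow_seq Q -> 0 < dconv P Q m.
Proof.
move=> [P0 _ _] [Q0 _ _]; rewrite /dconv big_ord_recl ltr_pwDl ?mulr_gt0//.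
by apply: sumr_ge0 => i _; rewrite mulr_ge0// ltW.
Qed.

Lemma slow_seq_shift P h : slow_seq P -> P (i + h)%N / P i @[i --> \oo] --> (1 : R).
Proof.
move=> [P0 P1 _]; elim: h => [|h IH].
  by under eq_cvg do rewrite addn0 divff ?gt_eqF//; exact: cvg_cst.
have P1h : P (i + h).+1 / P (i + h)%N @[i --> \oo] --> (1 : R).
  by rewrite (cvg_shiftn h (fun i => P i.+1 / P i)).
apply: (near_eq_cvg_to (cvgM P1h IH)); first by rewrite mulr1.
near=> i; rewrite addnS /= mulrA divfK ?gt_eqF//.
Unshelve. all: by end_near. Qed.

Lemma slow_seq_shiftB P h : slow_seq P -> P (i - h)%N / P i @[i --> \oo] --> (1 : R).
Proof.
move=> Ps; have P0 : forall i, 0 < P i by case: Ps.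
rewrite -(cvg_shiftn h).
apply: (near_eq_cvg_to (cvgV (@oner_neq0 R) (slow_seq_shift h Ps))).
  by rewrite invr1.
by near=> i; rewrite addnK /= invfM invrK mulrC.
Unshelve. all: by end_near. Qed.

(* The only use of the divergence of the partial sums: the end terms of the
   convolution are negligible. *)
Lemma slow_seq_div_dconv P Q : slow_seq P -> slow_seq Q ->
  P m / dconv P Q m @[m --> \oo] --> (0 : R).
Proof.
move=> Ps Qs; have P0 : forall i, 0 < P i by case: Ps.
have [Q0 _ Qoo] := Qs.
apply/cvgr0Pnorm_le => e e0.
(* Eventually [P (m - i)] is at least [P m / 2] for all [i < K], so the first [K] terms alone
   contribute at least [P m / 2 * (2 / e) = P m / e]. *)
have [K KQ] := Qoo (2 / e).
have hK : \forall m \near \oo, forall i : 'I_K, P m <= 2 * P (m - i)%N.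
  apply: filter_forall => i.
  have half_lt1 : (2^-1 : R) < 1 by lra.
  have := slow_seq_shiftB i Ps => /cvgr_gt /(_ _ half_lt1); apply: filterS => m.
  by rewrite ltr_pdivlMr// => /ltW; lra.
near=> m.
rewrite ger0_norm; last by rewrite divr_ge0// ltW// dconv_gt0.
rewrite ler_pdivrMr ?dconv_gt0//.
have -> : P m = e * (P m / 2 * (2 / e)) by field; rewrite gt_eqF.
rewrite ler_pM2l//.
have : P m / 2 * \sum_(i < K) Q i <= dconv P Q m.
  rewrite mulr_sumr /dconv.
  have Km : (K <= m.+1)%N by near: m; exists K => //= i /= Ki; lia.
  rewrite -!(big_mkord xpredT (fun i => P m / 2 * Q i)).
  rewrite -!(big_mkord xpredT (fun i => P (m - i)%N * Q i)).
  rewrite [leRHS](big_cat_nat (leq0n K) Km)//=.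
  rewrite -[leLHS]addr0; apply: lerD; last first.
    by apply: sumr_ge0 => i _; rewrite mulr_ge0// ltW.
  rewrite !big_nat; apply: ler_sum => i /andP[_ iK].
  rewrite ler_pM2r// ler_pdivrMr// mulrC.
  have Hm : forall i : 'I_K, P m <= 2 * P (m - i)%N by near: m.
  exact: (Hm (Ordinal iK)).
apply: le_trans; rewrite ler_pM2l// divr_gt0//.
Unshelve. all: by end_near. Qed.

(** Each of the finitely many head terms is comparable with [P m], which is negligible against the
    whole sum. *)
Lemma head_dconv P Q K (e : R) : slow_seq P -> slow_seq Q -> 0 < e ->
  \forall m \near \oo,
    \sum_(i < m.+1 | (i < K)%N) P (m - i)%N * Q i <= e * dconv P Q m.
Proof.
move=> Ps Qs e0; have P0 : forall i, 0 < P i by case: Ps.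
have H : (\sum_(i < K) P (m - i)%N * Q i / dconv P Q m) @[m --> \oo] --> (0 : R).
  rewrite [X in _ --> X](_ : _ = \sum_(i < K) Q i * (1 * 0)); last first.
    by rewrite big1// => i _; rewrite !mulr0.
  apply: (@cvg_ord_sum _ _ _ _ K (fun i m => P (m - i)%N * Q i / dconv P Q m)) => i.
  apply: (near_eq_cvg_to (cvgMl_tmp (a:=Q i)
    (cvgM (slow_seq_shiftB i Ps) (slow_seq_div_dconv Ps Qs)))) => //; near=> m => /=.
  by field; rewrite !gt_eqF// dconv_gt0.
near=> m.
have Km : (K <= m.+1)%N by near: m; exists K => //= i /= Ki; lia.
rewrite -ler_pdivrMr ?dconv_gt0// mulr_suml.
rewrite -(big_ord_widen _ (fun i => P (m - i)%N * Q i / dconv P Q m) Km).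
apply: ltW; near: m; exact: (cvgr_lt _ H).
Unshelve. all: by end_near. Qed.

Lemma tail_dconv P Q K (e : R) : slow_seq P -> slow_seq Q -> 0 < e ->
  \forall m \near \oo,
    \sum_(i < m.+1 | (m < i + K)%N) P (m - i)%N * Q i <= e * dconv P Q m.
Proof.
move=> Ps Qs e0; have := head_dconv K Qs Ps e0; apply: filterS => m.
rewrite dconvC; apply: le_trans; rewrite (reindex_inj rev_ord_inj)/= le_eqVlt.
apply/orP; left; apply/eqP; apply: eq_big => [i|i _]; have := ltn_ord i.
  by rewrite subSS ltnS; lia.
by rewrite subSS ltnS => im; rewrite subKn// mulrC.
Qed.

(** A crude bound is enough at the two ends, which carry a negligible share of the weight; smallness
    is needed only at distance [K] from both. Head, tail and middle each receive a third of [e]. *)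
Lemma weighted_small P Q (b : nat -> nat -> R) (C : R) :
  slow_seq P -> slow_seq Q ->
  (forall m i, (i <= m)%N -> b m i <= C * (P (m - i)%N * Q i)) ->
  (forall e : R, 0 < e -> exists K, forall m i, (K <= i)%N -> (i + K <= m)%N ->
     b m i <= e * (P (m - i)%N * Q i)) ->
  forall e : R, 0 < e ->
    \forall m \near \oo, \sum_(i < m.+1) b m i <= e * dconv P Q m.
Proof.
move=> Ps Qs bC bsmall e e0.
have P0 : forall i, 0 < P i by case: Ps.
have Q0 : forall i, 0 < Q i by case: Qs.
have PQ0 m i : 0 < P (m - i)%N * Q i by exact: mulr_gt0.
have e3 : 0 < e / 3 by rewrite divr_gt0.
have C0 : 0 < `|C| + 1 by rewrite ltr_wpDl.
have [K bK] := bsmall _ e3.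
have eC : 0 < e / 3 / (`|C| + 1) by rewrite divr_gt0.
have hd := head_dconv K Ps Qs eC; have tl := tail_dconv K Ps Qs eC.
near=> m.
have hdm : \sum_(i < m.+1 | (i < K)%N) P (m - i)%N * Q i <=
  e / 3 / (`|C| + 1) * dconv P Q m by near: m.
have tlm : \sum_(i < m.+1 | (m < i + K)%N) P (m - i)%N * Q i <=
  e / 3 / (`|C| + 1) * dconv P Q m by near: m.
have : \sum_(i < m.+1) b m i <= e / 3 * dconv P Q m + (`|C| + 1) *
    (\sum_(i < m.+1 | (i < K)%N) P (m - i)%N * Q i) + (`|C| + 1) *
    (\sum_(i < m.+1 | (m < i + K)%N) P (m - i)%N * Q i).
  rewrite /dconv !mulr_sumr (big_mkcond (fun i : 'I_m.+1 => i < K)%N)/=.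
  rewrite (big_mkcond (fun i : 'I_m.+1 => m < i + K)%N)/= -!big_split /=.
  apply: ler_sum => i _; have PQ := PQ0 m i.
  have CPQ : C * (P (m - i)%N * Q i) <= (`|C| + 1) * (P (m - i)%N * Q i).
    by rewrite ler_pM2r// ler_wpDr// ler_norm.
  have CPQ0 : 0 <= (`|C| + 1) * (P (m - i)%N * Q i) by rewrite mulr_ge0 ?ltW.
  have ePQ0 : 0 <= e / 3 * (P (m - i)%N * Q i) by rewrite mulr_ge0 ?ltW.
  have bi : b m i <= C * (P (m - i)%N * Q i) by apply: bC; rewrite -ltnS.
  case: ltnP => iK; first by case: ifP => _; lra.
  case: ltnP => im; first by lra.
  by rewrite !addr0; exact: bK.
move/le_trans; apply.
have e1 : (`|C| + 1) * (e / 3 / (`|C| + 1) * dconv P Q m) = e / 3 * dconv P Q m.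
  by field; rewrite gt_eqF.
rewrite -(ler_pM2l C0) e1 in hdm; rewrite -(ler_pM2l C0) e1 in tlm.
by lra.
Unshelve. all: by end_near. Qed.


(** The product filter expresses that [m - i] and [i] are both large, that is, that the term lies in
    the middle of the sum. *)
Lemma weighted_cvg0 P Q (theta : nat * nat -> R) (C : R) :
  slow_seq P -> slow_seq Q -> (forall x, `|theta x| <= C) ->
  theta x @[x --> (\oo, \oo)] --> (0 : R) ->
  (\sum_(i < m.+1) `|theta ((m - i)%N, i : nat)| * (P (m - i)%N * Q i)) / dconv P Q m
    @[m --> \oo] --> (0 : R).
Proof.
move=> Ps Qs thC th0.
have P0 : forall i, 0 < P i by case: Ps.
have Q0 : forall i, 0 < Q i by case: Qs.
apply/cvgr0Pnorm_le => e e0.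
have := @weighted_small P Q
  (fun m i => `|theta ((m - i)%N, i)| * (P (m - i)%N * Q i)) C Ps Qs _ _ e e0.
have PQ0 m i : 0 <= P (m - i)%N * Q i by rewrite ltW// mulr_gt0.
case=> [m i im|a a0|N _ HN]; first by rewrite ler_wpM2r.
- have /cvgr0_norm_le/(_ _ a0)[[A B]/= [[N1 _ N1A] [N2 _ N2B]] AB] := th0.
  exists (maxn N1 N2) => m i Ki im; rewrite ler_wpM2r//.
  by apply: (AB (_, _)); split => /=; [apply: N1A|apply: N2B] => /=; lia.
- exists N => // m /= Nm; rewrite ger0_norm; last first.
    rewrite divr_ge0//; last by rewrite ltW// dconv_gt0.
    apply: sumr_ge0 => i _.
    by rewrite mulr_ge0.
  by rewrite ler_pdivrMr ?dconv_gt0//; exact: HN.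
Qed.

(** The error [u * v - a * b] splits into three products, each with a factor tending to 0 and a
    bounded one. The models [a] and [b] may oscillate, hence the hypotheses on differences. *)
Lemma dconv_subst P Q (u v a b : nat -> R) (C : R) :
  slow_seq P -> slow_seq Q ->
  (forall i, `|a i| <= C) -> (forall i, `|b i| <= C) ->
  u i - a i @[i --> \oo] --> (0 : R) -> v i - b i @[i --> \oo] --> (0 : R) ->
  (\sum_(i < m.+1) (u (m - i)%N * v i - a (m - i)%N * b i) * (P (m - i)%N * Q i))
    / dconv P Q m @[m --> \oo] --> (0 : R).
Proof.
move=> Ps Qs aC bC ua vb.
have [D1 hD1] := cvgn_norm_le ua; have [D2 hD2] := cvgn_norm_le vb.
pose th (x : nat * nat) := u x.1 * v x.2 - a x.1 * b x.2.
have thE x : th x = (u x.1 - a x.1) * (v x.2 - b x.2) + (u x.1 - a x.1) * b x.2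
                    + a x.1 * (v x.2 - b x.2) by rewrite /th; ring.
have C0 : 0 <= C by apply: le_trans (aC 0%N).
have H := @weighted_cvg0 P Q th (D1 * D2 + D1 * C + C * D2) Ps Qs.
apply/cvgr0Pnorm_le => e e0.
have {}H := H _ _; have : (forall x, `|th x| <= D1 * D2 + D1 * C + C * D2).
  move=> x; rewrite thE (le_trans (ler_normD _ _))// lerD//.
    rewrite (le_trans (ler_normD _ _))// lerD// normrM ler_pM//.
  by rewrite normrM ler_pM.
move/H => {}H.
have ua1 : u x.1 - a x.1 @[x --> (\oo, \oo)] --> (0 : R).
  exact: (cvg_comp fst (fun i => u i - a i) cvg_fst ua).
have vb2 : v x.2 - b x.2 @[x --> (\oo, \oo)] --> (0 : R).
  exact: (cvg_comp snd (fun i => v i - b i) cvg_snd vb).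
have /H : th x @[x --> (\oo, \oo)] --> (0 : R).
  rewrite [X in _ --> X](_ : _ = 0 * 0 + 0 + 0); last by rewrite mulr0 !addr0.
  rewrite (_ : th = fun x => (u x.1 - a x.1) * (v x.2 - b x.2)
    + (u x.1 - a x.1) * b x.2 + a x.1 * (v x.2 - b x.2)); last exact/funext.
  apply: cvgD; first apply: cvgD; first exact: cvgM.
  - apply/cvgr0Pnorm_le => d d0.
    have C1 : 0 < C + 1 by lra.
    have dC : 0 < d / (C + 1) by rewrite divr_gt0.
    have /cvgr0_norm_le/(_ _ dC) := ua1; apply: filterS => x.
    rewrite ler_pdivlMr// normrM; apply: le_trans; apply: ler_pM => //.
    by rewrite (le_trans (bC _))// lerDl.
  - apply/cvgr0Pnorm_le => d d0.
    have C1 : 0 < C + 1 by lra.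
    have dC : 0 < d / (C + 1) by rewrite divr_gt0.
    have /cvgr0_norm_le/(_ _ dC) := vb2; apply: filterS => x.
    rewrite ler_pdivlMr// normrM mulrC; apply: le_trans; apply: ler_pM => //.
    by rewrite (le_trans (aC _))// lerDl.
move=> /cvgr0_norm_le/(_ _ e0); apply: filterS => m; apply: le_trans.
have P0 : forall i, 0 < P i by case: Ps.
have Q0 : forall i, 0 < Q i by case: Qs.
rewrite !normrM ler_wpM2r//; apply: le_trans (ler_norm_sum _ _ _) _.
rewrite [leRHS]ger0_norm; last first.
  by apply: sumr_ge0 => i _; rewrite !mulr_ge0// ltW.
by apply: ler_sum => i _; rewrite normrM (gtr0_norm (mulr_gt0 _ _)).
Qed.

(* Shifting the summation index replaces the weight [P (m - i) * Q i] by
   [P (m - i + 1) * Q (i - 1)], and the ratio of the two tends to 1 away from the ends. *)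
Lemma dconv_shift1 P Q (c : nat -> nat -> R) (C : R) :
  slow_seq P -> slow_seq Q -> (forall m i, `|c m i| <= C) ->
  (\sum_(i < m.+1) (c m i.+1 - c m i) * (P (m - i)%N * Q i))
    / dconv P Q m @[m --> \oo] --> (0 : R).
Proof.
move=> Ps Qs cC.
have P0 : forall i, 0 < P i by case: Ps.
have Q0 : forall i, 0 < Q i by case: Qs.
have C0 : 0 <= C by apply: le_trans (cC 0%N 0%N).
have P1 : P i.+1 / P i @[i --> \oo] --> (1 : R) by case: Ps.
pose th (x : nat * nat) := P x.1.+1 / P x.1 * (Q (x.2 - 1)%N / Q x.2) - 1.
have [D1 hD1] := cvgn_norm_le P1; have [D2 hD2] := cvgn_norm_le (slow_seq_shiftB 1 Qs).
have thB x : `|th x| <= D1 * D2 + 1.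
  rewrite (le_trans (ler_normB _ _))// normr1 lerD2r normrM ler_pM//.
have th0 : th x @[x --> (\oo, \oo)] --> (0 : R).
  rewrite [X in _ --> X](_ : _ = 1 * 1 - 1); last by rewrite mulr1 subrr.
  apply: cvgB; last exact: cvg_cst.
  apply: cvgM.
    exact: (cvg_comp fst (fun i => P i.+1 / P i) cvg_fst P1).
  exact: (cvg_comp snd (fun i => Q (i - 1)%N / Q i) cvg_snd (slow_seq_shiftB 1 Qs)).
have H1 := weighted_cvg0 Ps Qs thB th0.
have H2 : Q m / dconv P Q m @[m --> \oo] --> (0 : R).
  under eq_cvg do rewrite dconvC; exact: slow_seq_div_dconv.
have H3 : P m.+1 / dconv P Q m @[m --> \oo] --> (0 : R).
  apply: (near_eq_cvg_to (cvgM P1 (slow_seq_div_dconv Ps Qs))); first by rewrite mul1r.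
  near=> m => /=.
  by field; rewrite !gt_eqF// dconv_gt0.
have H : C * ((\sum_(i < m.+1) `|th ((m - i)%N, i : nat)| * (P (m - i)%N * Q i))
    / dconv P Q m + P 0%N * (Q m / dconv P Q m) + Q 0%N * (P m.+1 / dconv P Q m))
    @[m --> \oo] --> (0 : R).
  rewrite [X in _ --> X](_ : _ = C * (0 + P 0%N * 0 + Q 0%N * 0)); last by ring.
  apply: cvgMl_tmp; apply: cvgD; first apply: cvgD => //.
    exact: cvgMl_tmp.
  exact: cvgMl_tmp.
apply/cvgr0Pnorm_le => e e0.
have := H => /cvgr0_norm_le/(_ _ e0); apply: filterS => m; apply: le_trans.
have S0 := dconv_gt0 m Ps Qs.
set A := \sum_(i < m.+1) `|_| * _.
rewrite (_ : C * _ = C * (A + P 0%N * Q m + Q 0%N * P m.+1) / dconv P Q m); last first.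
  by field; rewrite gt_eqF.
rewrite [leLHS]normrM [leRHS]normrM ler_wpM2r//.
rewrite [leRHS]ger0_norm; last first.
  have A0 : 0 <= A by apply: sumr_ge0 => i _; rewrite !mulr_ge0// ltW.
  by rewrite mulr_ge0// !addr_ge0// mulr_ge0// ltW.
(* Summation by parts. At [i = 0] the truncated [i - 1] equals 0, so the sum with [th] contains an
   extra term [c m 0 * (Q 0 * P m.+1)], while the shift leaves [c m m.+1 * (P 0 * Q m)] unmatched at
   the top. Both are end terms. *)
have -> : \sum_(i < m.+1) (c m i.+1 - c m i) * (P (m - i)%N * Q i) =
    \sum_(i < m.+1) c m i * (th ((m - i)%N, i : nat) * (P (m - i)%N * Q i))
    + c m m.+1 * (P 0%N * Q m) - c m 0%N * (Q 0%N * P m.+1).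
  transitivity (\sum_(i < m.+1) c m i.+1 * (P (m - i)%N * Q i)
      - \sum_(i < m.+1) c m i * (P (m - i)%N * Q i)).
    by rewrite -sumrB; apply: eq_bigr => i _; rewrite mulrBl.
  have -> : \sum_(i < m.+1) c m i * (th ((m - i)%N, i : nat) * (P (m - i)%N * Q i))
     = \sum_(i < m.+1) c m i * (P (m.+1 - i)%N * Q (i - 1)%N)
      - \sum_(i < m.+1) c m i * (P (m - i)%N * Q i).
    rewrite -sumrB; apply: eq_bigr => i _; rewrite /th /= subSn -1?ltnS//.
    by field; rewrite !gt_eqF.
  rewrite big_ord_recr/= [X in _ = X - _ + _ - _]big_ord_recl/= subn0 subnn sub0n.
  under [X in _ = _ + X - _ + _ - _]eq_bigr => i _ do
    rewrite /bump/= add1n subSS subn1 /=.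
  by ring.
have cB m' i x : 0 <= x -> `|c m' i * x| <= C * x.
  by move=> x0; rewrite normrM (ger0_norm x0) ler_wpM2r.
rewrite (le_trans (ler_normB _ _))// mulrDr lerD//; last first.
  by apply: cB; rewrite mulr_ge0// ltW.
rewrite (le_trans (ler_normD _ _))// mulrDr lerD//; last first.
  by apply: cB; rewrite mulr_ge0// ltW.
rewrite (le_trans (ler_norm_sum _ _ _))// mulr_sumr; apply: ler_sum => i _.
by rewrite !normrM (gtr0_norm (P0 _)) (gtr0_norm (Q0 _)) ler_wpM2r // !mulr_ge0 // ltW.
Unshelve. all: by end_near. Qed.

Lemma dconv_shift P Q (c : nat -> nat -> R) (C : R) k :
  slow_seq P -> slow_seq Q -> (forall m i, `|c m i| <= C) ->
  (\sum_(i < m.+1) (c m (i + k)%N - c m i) * (P (m - i)%N * Q i))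
    / dconv P Q m @[m --> \oo] --> (0 : R).
Proof.
move=> Ps Qs cC; elim: k => [|k IH].
  apply: (near_eq_cvg_to (cvg_cst (0 : R))) => //; near=> m => /=.
  by rewrite big1 ?mul0r// => i _; rewrite addn0 subrr mul0r.
apply: (near_eq_cvg_to (cvgD (@dconv_shift1 P Q (fun m i => c m (i + k)%N) C Ps Qs
  (fun m i => cC m _)) IH)); first by rewrite addr0.
near=> m => /=.
rewrite -mulrDl -big_split/=; congr (_ / _); apply: eq_bigr => i _.
by rewrite -mulrDl addnS addrA subrK.
Unshelve. all: by end_near. Qed.

(** Shifting by each [j <= W] changes the normalized sum by a quantity tending to 0, so [c] may be
    replaced by its mean over a window of fixed length, and these means are uniformly close to
    [kappa]. *)
Lemma dconv_mean P Q (c : nat -> nat -> R) (C kappa : R) :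
  slow_seq P -> slow_seq Q -> (forall m i, `|c m i| <= C) ->
  (forall e : R, 0 < e -> exists W, forall m i,
     `|(\sum_(j < W.+1) c m (i + j)%N) / W.+1%:R - kappa| <= e) ->
  (\sum_(i < m.+1) c m i * (P (m - i)%N * Q i)) / dconv P Q m
    @[m --> \oo] --> kappa.
Proof.
move=> Ps Qs cC ck.
have P0 : forall i, 0 < P i by case: Ps.
have Q0 : forall i, 0 < Q i by case: Qs.
apply/cvgrPdist_le => e e0; have e2 : 0 < e / 2 by rewrite divr_gt0.
have [W HW] := ck _ e2.
have H : (\sum_(j < W.+1) (\sum_(i < m.+1) (c m (i + j)%N - c m i) *
    (P (m - i)%N * Q i)) / dconv P Q m) / W.+1%:R @[m --> \oo] --> (0 : R).
  rewrite [X in _ --> X](_ : _ = (\sum_(j < W.+1) 0) / W.+1%:R); last first.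
    by rewrite big1// mul0r.
  apply: cvgMr_tmp; apply: (@cvg_ord_sum _ _ _ _ W.+1 (fun j m =>
      (\sum_(i < m.+1) (c m (i + j)%N - c m i) * (P (m - i)%N * Q i)) / dconv P Q m)).
    by move=> j; exact: dconv_shift cC.
have := H => /cvgr0_norm_le/(_ _ e2); apply: filterS => m Hm.
have S0 := dconv_gt0 m Ps Qs.
set X := (X in `|X| <= _) in Hm.
have XE : X = (\sum_(i < m.+1) ((\sum_(j < W.+1) c m (i + j)%N) / W.+1%:R - kappa) *
    (P (m - i)%N * Q i)) / dconv P Q m +
    (kappa - (\sum_(i < m.+1) c m i * (P (m - i)%N * Q i)) / dconv P Q m).
  rewrite /X -mulr_suml exchange_big/=.
  have kE : kappa = (\sum_(i < m.+1) kappa * (P (m - i)%N * Q i)) / dconv P Q m.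
    by rewrite -mulr_sumr mulfK// gt_eqF.
  rewrite [X in _ = _ + (X - _)]kE.
  rewrite -mulrBl -sumrB -mulrDl -big_split/= mulrAC mulr_suml.
  congr (_ / _); apply: eq_bigr => i _.
  rewrite -mulrBl -mulrDl -mulr_suml sumrB sumr_const card_ord -(mulr_natr (c m i)).
  rewrite !mulrA; field.
  by rewrite ?(addrC 1) natr1 pnatr_eq0.
have Y : `|(\sum_(i < m.+1) ((\sum_(j < W.+1) c m (i + j)%N) / W.+1%:R - kappa) *
    (P (m - i)%N * Q i)) / dconv P Q m| <= e / 2.
  rewrite normrM (gtr0_norm (x := _^-1)) ?invr_gt0// ler_pdivrMr//.
  rewrite (le_trans (ler_norm_sum _ _ _))// mulr_sumr; apply: ler_sum => i _.
  by rewrite normrM (gtr0_norm (mulr_gt0 _ _))// ler_pM2r// mulr_gt0.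
rewrite (_ : _ - _ = X - (X - (kappa - (\sum_(i < m.+1) c m i *
  (P (m - i)%N * Q i)) / dconv P Q m))); last by ring.
rewrite (le_trans (ler_normB _ _))// (splitr e) lerD//.
by rewrite XE addrK.
Qed.

(** Apart from one end term, passing from [m] to [m.+1] multiplies the terms by [P i.+1 / P i],
    which tends to 1. So the convolution is again slowly varying. *)
Lemma dconv_ratio P Q : slow_seq P -> slow_seq Q ->
  dconv P Q m.+1 / dconv P Q m @[m --> \oo] --> (1 : R).
Proof.
move=> Ps Qs.
have P0 : forall i, 0 < P i by case: Ps.
have Q0 : forall i, 0 < Q i by case: Qs.
have P1 : P i.+1 / P i @[i --> \oo] --> (1 : R) by case: Ps.
have Q1 : Q i.+1 / Q i @[i --> \oo] --> (1 : R) by case: Qs.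
have H1 : P i.+1 / P i - 1 @[i --> \oo] --> (0 : R).
  by rewrite -(subrr 1); apply: cvgB P1 _; exact: cvg_cst.
have H2 : 1 - 1 @[i --> \oo] --> (0 : R) by rewrite subrr; exact: cvg_cst.
have B (i : nat) : `|1 : R| <= 1 by rewrite normr1.
have H := @dconv_subst P Q (fun i => P i.+1 / P i) (fun=> 1) (fun=> 1)
  (fun=> 1) 1 Ps Qs B B H1 H2.
have H3 : Q m.+1 / dconv P Q m @[m --> \oo] --> (0 : R).
  apply: (near_eq_cvg_to (cvgM Q1 (slow_seq_div_dconv Qs Ps))); first by rewrite mul1r.
  near=> m => /=; rewrite dconvC.
  by field; rewrite !gt_eqF// dconv_gt0.
apply: (near_eq_cvg_to (cvgD (cvgD H (cvgMl_tmp (a:=P 0%N) H3)) (cvg_cst (1 : R)))).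
  by rewrite mulr0 !add0r.
near=> m => /=.
have S0 := dconv_gt0 m Ps Qs.
apply/(canRL (mulfK (lt0r_neq0 S0))).
rewrite !mulrDl mul1r divfK ?gt_eqF//.
rewrite mulrA divfK ?gt_eqF// /dconv [RHS]big_ord_recr/= subnn.
rewrite mul1r addrAC -big_split/=; congr (_ + _); apply: eq_bigr => i _.
by rewrite subSn; [field; rewrite gt_eqF|rewrite -ltnS].
Unshelve. all: by end_near. Qed.

End WeightedSums.

(** * Convolutions with periodic coefficients *)

Section PeriodicWeights.
Variable R : realType.
Implicit Types P Q : nat -> R.

Lemma sum_ord_mul (V : nmodType) n N (F : nat -> V) :
  \sum_(j < n * N) F j = \sum_(k < N) \sum_(r < n) F (k * n + r)%N.
Proof.
elim: N => [|N IH]; first by rewrite muln0 !big_ord0.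
rewrite mulnSr big_split_ord/= IH big_ord_recr/=; congr (_ + _).
by apply: eq_bigr => r _; rewrite mulnC.
Qed.

Lemma sum_ord_periodic (V : zmodType) n (w : nat -> V) i :
  (forall j, w (j + n)%N = w j) -> \sum_(r < n) w (i + r)%N = \sum_(r < n) w r.
Proof.
move=> wn; elim: i => // i <-; apply/eqP; rewrite -subr_eq0; apply/eqP.
case: n wn => [|n] wn; first by rewrite !big_ord0 subrr.
rewrite big_ord_recr/= [X in _ - X]big_ord_recl/= addn0 addSnnS wn.
under eq_bigr do rewrite addSnnS.
under [X in _ - (_ + X)]eq_bigr do rewrite /bump/= add1n.
by rewrite addrC subrr.
Qed.

(** A window of [n * N.+1] indices is sorted by residues modulo [n]. On a residue class [w] is
    constant and the argument of [s] runs in steps of [n%:R * delta], so the mean of [s] there is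
    close to [mu] whatever the residue; what remains is the mean of [w] over a period. *)
Lemma dconv_periodic_mean P Q (s : R -> R) (w : nat -> R) n (delta mu C : R) :
  slow_seq P -> slow_seq Q -> (0 < n)%N -> (forall j, w (j + n)%N = w j) ->
  (forall x, `|s x| <= C) -> (forall i, `|w i| <= C) ->
  (forall e : R, 0 < e -> exists N, forall u,
     `|(\sum_(k < N.+1) s (u - k%:R * (n%:R * delta))) / N.+1%:R - mu| <= e) ->
  (\sum_(i < m.+1) s ((m - i)%N%:R * delta) * w i * (P (m - i)%N * Q i))
    / dconv P Q m @[m --> \oo] --> mu * ((\sum_(r < n) w r) / n%:R).
Proof.
move=> Ps Qs n0 wn sC wC smu.
have n0R : (0 : R) < n%:R by rewrite ltr0n.
have C0 : 0 <= C by apply: le_trans (sC 0).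
(* The subtraction is made in [R]: windows reach indices beyond [m], where the truncated [m - i]
   would stay at 0. *)
pose c (m i : nat) := s (m%:R * delta - i%:R * delta) * w i.
have cC m i : `|c m i| <= C * C by rewrite normrM ler_pM.
have := @dconv_mean R P Q c (C * C) (mu * ((\sum_(r < n) w r) / n%:R)) Ps Qs cC.
move=> H; apply: (near_eq_cvg_to (H _)) => //; last first.
  near=> m; congr (_ / _); apply: eq_bigr => i _.
  by rewrite /c natrB ?mulrBl// -ltnS.
move=> e e0.
have C1 : 0 < C + 1 by lra.
have [N HN] := smu _ (divr_gt0 e0 C1).
exists (n * N.+1).-1 => m i.
rewrite prednK ?muln_gt0 ?n0//.
rewrite (@sum_ord_mul R n N.+1 (fun j => c m (i + j)%N)) exchange_big/=.
pose A (u : R) := (\sum_(k < N.+1) s (u - k%:R * (n%:R * delta))) / N.+1%:R.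
have -> : (\sum_(r < n) \sum_(k < N.+1) c m (i + (k * n + r))%N) / (n * N.+1)%:R =
    (\sum_(r < n) A (m%:R * delta - (i + r)%:R * delta) * w (i + r)%N) / n%:R.
  rewrite natrM invfM (mulrC n%:R^-1) mulrA; congr (_ / _).
  rewrite mulr_suml; apply: eq_bigr => r _.
  rewrite /A mulrAC; congr (_ / _).
  rewrite mulr_suml; apply: eq_bigr => k _.
  rewrite /c; congr (s _ * _).
    by rewrite !natrD natrM; ring.
  have : forall k, w (i + (k * n + r))%N = w (i + r)%N.
    elim=> [//|k' IH]; rewrite mulSn.
    by rewrite (_ : i + (n + k' * n + r) = i + (k' * n + r) + n)%N ?wn//; lia.
  exact.
rewrite -(sum_ord_periodic i wn) mulrA mulr_sumr -mulrBl -sumrB.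
rewrite normrM (gtr0_norm (x:=_^-1)) ?invr_gt0// ler_pdivrMr//.
rewrite (le_trans (ler_norm_sum _ _ _))//.
apply: (@le_trans _ _ (\sum_(r < n) e)); last first.
  by rewrite sumr_const card_ord mulr_natr.
apply: ler_sum => r _; rewrite -mulrBl normrM.
apply: (@le_trans _ _ (e / (C + 1) * C)).
  by apply: ler_pM => //; exact: HN.
by rewrite mulrAC ler_pdivrMr// ler_pM2l//; lra.
Unshelve. all: by end_near. Qed.

Lemma bounded_mul_cvg0 (a w : nat -> R) (C : R) :
  (forall i, `|a i| <= C) -> w i @[i --> \oo] --> (0 : R) ->
  a i * w i @[i --> \oo] --> (0 : R).
Proof.
move=> aC w0; have C1 : 0 < C + 1 by rewrite ltr_wpDl// (le_trans _ (aC 0%N)).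
apply/cvgr0Pnorm_le => e e0.
have /cvgr0_norm_le/(_ _ (divr_gt0 e0 C1)) := w0; apply: filterS => i.
rewrite ler_pdivlMr// normrM mulrC; apply: le_trans; apply: ler_pM => //.
by rewrite (le_trans (aC _))// lerDl.
Qed.

(** As [G i] behaves like [rho ^+ i * Q i * r i] and [Q i.+1 / Q i] tends to 1, its increment
    behaves like [rho ^+ i * Q i * (rho * r i.+1 - r i)]. Over a period the last factor has mean
    [rho - 1] times the mean of [r]. *)
Lemma dconv_stieltjes P Q (F G : nat -> R) (s : R -> R) (r : nat -> R)
    n (rho delta mu C : R) :
  slow_seq P -> slow_seq Q -> (0 < n)%N -> 0 < rho ->
  (forall j, r (j + n)%N = r j) ->
  (forall x, `|s x| <= C) -> (forall i, `|r i| <= C) ->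
  (forall e : R, 0 < e -> exists N, forall u,
     `|(\sum_(k < N.+1) s (u - k%:R * (n%:R * delta))) / N.+1%:R - mu| <= e) ->
  F i / rho ^+ i / P i - s (i%:R * delta) @[i --> \oo] --> (0 : R) ->
  G i / rho ^+ i / Q i - r i @[i --> \oo] --> (0 : R) ->
  (\sum_(i < m.+1) F (m - i)%N * (G i.+1 - G i)) / rho ^+ m / dconv P Q m
    @[m --> \oo] --> mu * ((rho - 1) * (\sum_(i < n) r i) / n%:R).
Proof.
move=> Ps Qs n0 rho0 rn sC rC smu Fs Gr.
have P0 : forall i, 0 < P i by case: Ps.
have Q0 : forall i, 0 < Q i by case: Qs.
have Q1 : Q i.+1 / Q i @[i --> \oo] --> (1 : R) by case: Qs.
have C0 : 0 <= C by apply: le_trans (sC 0).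
have X0 i : rho ^+ i != 0 by rewrite expf_neq0// gt_eqF.
pose b i := rho * r i.+1 - r i.
pose v i := (G i.+1 - G i) / rho ^+ i / Q i.
have bC i : `|b i| <= rho * C + C.
  rewrite (le_trans (ler_normB _ _))// lerD// normrM (gtr0_norm rho0).
  by rewrite ler_pM2l.
have vb : v i - b i @[i --> \oo] --> (0 : R).
  have Gr1 : G i.+1 / rho ^+ i.+1 / Q i.+1 - r i.+1 @[i --> \oo] --> (0 : R).
    by rewrite (cvg_shiftS (fun i => G i / rho ^+ i / Q i - r i)).
  have q1 : Q i.+1 / Q i - 1 @[i --> \oo] --> (0 : R).
    by rewrite -(subrr 1); apply: cvgB => //; exact: cvg_cst.
  have rC1 i : `|r i.+1| <= C by [].
  apply: (near_eq_cvg_to (cvgB (cvgMl_tmp (a:=rho) (cvgD (cvgM Gr1 Q1)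
    (bounded_mul_cvg0 rC1 q1))) Gr)); first by rewrite mul0r addr0 mulr0 subr0.
  near=> i => /=; rewrite !fctE /= /v /b exprS; field.
  by rewrite ?gt_eqF// ?exprn_gt0.
have bn j : b (j + n)%N = b j by rewrite /b -addSn !rn.
have C' x : x <= C -> x <= Num.max C (rho * C + C) by move=> ?; rewrite le_max; apply/orP; left.
have C'' x : x <= rho * C + C -> x <= Num.max C (rho * C + C).
  by move=> ?; rewrite le_max; apply/orP; right.
have H1 := dconv_periodic_mean Ps Qs n0 bn (fun x => C' _ (sC x))
  (fun i => C'' _ (bC i)) smu.
have H2 := dconv_subst Ps Qs (fun i => C' _ (sC (i%:R * delta)))
  (fun i => C'' _ (bC i)) Fs vb.
apply: (near_eq_cvg_to (cvgD H2 H1)).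
  rewrite add0r; congr (_ * (_ / _)); rewrite /b sumrB -mulr_sumr.
  have -> : \sum_(i < n) r i.+1 = \sum_(i < n) r i.
    by rewrite -[RHS](sum_ord_periodic 1 rn).
  by rewrite mulrBl mul1r.
near=> m => /=. rewrite -mulrDl -big_split/=; congr (_ / _).
rewrite mulr_suml; apply: eq_bigr => i _; rewrite -mulrDl subrK /v.
have -> : rho ^+ m = rho ^+ (m - i)%N * rho ^+ i.
  by rewrite -exprD subnK// -ltnS.
by field; rewrite ?gt_eqF// ?exprn_gt0.
Unshelve. all: by end_near. Qed.

End PeriodicWeights.

(** * Uniform means of periodic functions along irrational translations *)

Section UniformMean.
Variable R : realType.
Implicit Types (s : R -> R) (T S : R).

(** Pigeonhole: [M.+1] fractional parts fall into [M] boxes of length [M%:R^-1 < d]. Irrationality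
    keeps the difference of two of them from vanishing, so it can serve as a step. *)
Lemma dirichlet_approx (x d : R) : 0 < d -> irrational x ->
  exists (q : nat) (r : int), [/\ (0 < q)%N, q%:R * x - r%:~R != 0 &
    `|q%:R * x - r%:~R| < d].
Proof.
move=> d0 xirr.
pose M := (Num.truncn d^-1).+1.
have MR : (0 : R) < M%:R by rewrite ltr0n.
have Md : M%:R^-1 < d.
  rewrite invf_plt// ?posrE//; exact: truncnS_gt.
pose fr (k : nat) := k%:R * x - (Num.floor (k%:R * x))%:~R.
have fr0 k : 0 <= fr k by rewrite subr_ge0 floor_le_tmp.
have fr1 k : fr k < 1 by rewrite ltrBlDl -[X in _ < _ + X]/(1%:~R) -intrD floorD1_gt.
pose g (k : nat) := Num.truncn (M%:R * fr k).
have gM k : (g k < M)%N.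
  rewrite truncn_lt_nat; last by rewrite mulr_ge0// ltW.
  by rewrite gtr_pMr.
pose h (k : 'I_M.+1) := Ordinal (gM k).
have /injectivePn[k1 [k2 k12 hk]] : ~~ injectiveb h.
  by apply/negP => /injectiveP /leq_card; rewrite !card_ord ltnn.
wlog lt12 : k1 k2 k12 hk / (k1 < k2)%N.
  move=> H; case: (ltngtP k1 k2) => [| |E].
  - exact: H.
  - by apply: H => //; rewrite eq_sym.
  - by move: k12; rewrite (ord_inj E) eqxx.
have gk : g k1 = g k2 by case: hk.
exists (k2 - k1)%N, (Num.floor (k2%:R * x) - Num.floor (k1%:R * x)).
have E : (k2 - k1)%N%:R * x - (Num.floor (k2%:R * x) - Num.floor (k1%:R * x))%:~R
    = fr k2 - fr k1.
  by rewrite /fr natrB; [rewrite rmorphB/=; ring|exact: ltnW].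
split; first by rewrite subn_gt0.
  apply/eqP => /eqP; rewrite subr_eq0 => /eqP qx; apply: xirr.
  apply/rationalP; exists (Num.floor (k2%:R * x) - Num.floor (k1%:R * x)), (k2 - k1)%N.
  by rewrite -qx mulrC mulKf// pnatr_eq0 subn_eq0 -ltnNge.
rewrite E; apply: lt_trans Md.
rewrite -(ltr_pM2l MR) divff ?gt_eqF// -[X in X * _](gtr0_norm MR) -normrM mulrBr.
have t1 k : (g k)%:R <= M%:R * fr k < (g k).+1%:R.
  by apply: truncn_itv; rewrite mulr_ge0// ltW.
have /andP[] := t1 k1; have /andP[] := t1 k2; rewrite gk -natr1 ltr_norml.
by move=> *; apply/andP; split; lra.
Qed.

Lemma periodic_intmul s T x (l : int) : periodic s T -> s (x + l%:~R * T) = s x.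
Proof.
move=> sT; have H (n : nat) y : s (y + n%:R * T) = s y by rewrite mulr_natl periodicn.
case: l => n; first exact: H.
by rewrite NegzE mulrNz mulNr -[LHS](H n.+1) subrK.
Qed.

(** Only [x] is confined to the compact segment in the covering argument; [y] is free, so one
    multiple of [T] moves both points and nothing goes wrong at the ends of the period. *)
Lemma uniform_continuity_periodic s T (e : R) : 0 < T -> continuous s ->
  periodic s T -> 0 < e ->
  exists2 d, 0 < d & forall x y, `|x - y| < d -> `|s x - s y| <= e.
Proof.
move=> T0 sc sT e0.
have sTz x l := periodic_intmul x l sT.
have cov : forall x : R, `[0, T]%classic x ->
    \forall x' \near x & d \near 0^'+, forall y, `|x' - y| < d -> `|s x' - s y| <= e.
  move=> x _; have := sc x => /cvgrPdist_le/(_ _ (divr_gt0 e0 (ltr0n R 2))).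
  move=> /nbhs_ballP[d /= d0 xd].
  have d2 : 0 < d / 2 by rewrite divr_gt0.
  exists (ball x (d / 2), [set r | 0 < r < d / 2]) => /=.
    split; first exact: nbhsx_ballx.
    by near=> r; apply/andP; split => //; near: r; exact: nbhs_right_lt.
  case=> x' r [/=]; rewrite -ball_normE/= => xx' /andP[r0 rd] y x'y.
  rewrite (_ : s x' - s y = (s x - s y) - (s x - s x')); last by ring.
  rewrite (le_trans (ler_normB _ _))// (splitr e) lerD//; apply: xd.
    rewrite -ball_normE/= (_ : x - y = (x - x') + (x' - y)); last by ring.
    by rewrite (le_lt_trans (ler_normD _ _))// (splitr d) ltrD// (lt_trans x'y).
  by rewrite -ball_normE/= (lt_le_trans xx')// ler_pdivrMr// ler_pMr// ler1n.
have /compact_near_coveringP/(_ R (0^'+)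
  (fun d x => forall y, `|x - y| < d -> `|s x - s y| <= e) _ cov) H :=
  @segment_compact R 0 T.
have [d [d0 Hd]] : exists d : R, 0 < d /\ forall x, `[0, T]%classic x ->
    forall y, `|x - y| < d -> `|s x - s y| <= e.
  have : \forall d \near 0^'+, 0 < d /\ forall x : R, `[0, T]%classic x ->
    forall y, `|x - y| < d -> `|s x - s y| <= e.
    by near=> d; split => //; near: d.
  by move=> /filter_ex[d]; exists d.
exists d => // x y xy.
have xl : `[0, T]%classic (x + (- Num.floor (x / T))%:~R * T).
  have := floor_le_tmp (x / T); have := floorD1_gt (x / T).
  rewrite ler_pdivlMr// ltr_pdivrMr// intrD mulrDl mul1r /= in_itv/= mulrNz.
  by move=> *; apply/andP; split; lra.
have := Hd _ xl (y + (- Num.floor (x / T))%:~R * T).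
by rewrite !sTz; apply; rewrite opprD addrACA subrr addr0.
Unshelve. all: by end_near. Qed.

(** The number [K] of translations depends on [d] alone. Modulo [T], [q] translations by [S] amount
    to a single nonzero step [eta] shorter than [d], and about [T / |eta|] such steps run through a
    whole period. *)
Lemma irrational_orbit_dense T S (d : R) : 0 < T -> irrational (S / T) -> 0 < d ->
  exists K : nat, forall u v : R, exists2 k : nat, (k <= K)%N &
    exists l : int, `|u - k%:R * S + l%:~R * T - v| < d.
Proof.
move=> T0 irr d0.
have [q [r [q0 qr0 qrd]]] := dirichlet_approx (divr_gt0 d0 T0) irr.
pose eta := q%:R * S - r%:~R * T.
have etaE : eta = (q%:R * (S / T) - r%:~R) * T by rewrite /eta; field; rewrite gt_eqF.
have eta0 : eta != 0 by rewrite etaE mulf_neq0// gt_eqF.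
have etad : `|eta| < d by rewrite etaE normrM (gtr0_norm T0) -ltr_pdivlMr.
have neta0 : 0 < `|eta| by rewrite normr_gt0.
exists (Num.truncn (T / `|eta|) * q)%N => u v.
(* The multiple of [T] is chosen so that the distance to cover has the sign of [eta] and length at
   most [T], whence the two cases. *)
have [l /andP[l0 lT]] : exists l : int, 0 <= (u - v + l%:~R * T) / eta <= T / `|eta|.
  have := floor_le_tmp ((u - v) / T); have := floorD1_gt ((u - v) / T).
  rewrite ler_pdivlMr// ltr_pdivrMr// intrD mulrDl mul1r.
  set f := _%:~R * T => f1 f2.
  case: (ltrgt0P eta) => [ep|en|e0]; last by rewrite e0 eqxx in eta0.
    exists (- Num.floor ((u - v) / T)); rewrite mulrNz mulNr -/f.
    by apply/andP; split; [apply: divr_ge0; lra|rewrite ler_pM2r ?invr_gt0//; lra].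
  exists (- Num.floor ((u - v) / T) - 1); rewrite intrB mulrBl mul1r mulrNz mulNr -/f.
  have -> : (u - v + (- f - T)) / eta = (T + f - (u - v)) / - eta by field.
  have nen : 0 < - eta by rewrite oppr_gt0.
  by apply/andP; split; [apply: divr_ge0; lra|rewrite ler_pM2r ?invr_gt0//; lra].
set z := (_ / _) in l0 lT.
exists (Num.truncn z * q)%N.
  by rewrite leq_mul2r; apply/orP; right; exact: le_truncn.
exists (l + (Num.truncn z)%:Z * r).
have -> : u - (Num.truncn z * q)%:R * S + (l + (Num.truncn z)%:Z * r)%:~R * T - v
    = (z - (Num.truncn z)%:R) * eta.
  by rewrite mulrBl /z divfK// natrM intrD intrM -pmulrn /eta; ring.
rewrite normrM; apply: le_lt_trans etad; rewrite ler_piMl//.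
have /andP[z1 z2] := truncn_itv l0.
by rewrite ger0_norm ?subr_ge0// lerBlDl natr1 ltW.
Qed.

(** Equidistribution without Fourier series: the means lose their dependence on the starting point
    by density of the orbits, and then converge because a long mean is an average of short ones. The
    lower bound on [mu] serves to make the final constant positive. *)
Lemma uniform_mean s T S : 0 < T -> continuous s -> periodic s T ->
  irrational (S / T) ->
  exists mu : R, (forall m, (forall x, m <= s x) -> m <= mu) /\
    forall e : R, 0 < e -> exists N, forall u,
     `|(\sum_(k < N.+1) s (u - k%:R * S)) / N.+1%:R - mu| <= e.
Proof.
move=> T0 sc sT irr.
have sTz x l := periodic_intmul x l sT.
(* Every point lies within [d], modulo [T], of one of the [K.+1] orbit points [0 - k%:R * S], where
   [s] takes finitely many values. *)
have [C sC] : exists C : R, forall x, `|s x| <= C.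
  have [d d0 sd] := uniform_continuity_periodic T0 sc sT ltr01.
  have [K HK] := irrational_orbit_dense T0 irr d0.
  exists (1 + \sum_(k < K.+1) `|s (0 - k%:R * S)|) => x.
  have [k kK [l kl]] := HK 0 x.
  have := sd _ _ kl; rewrite sTz => sk.
  rewrite (_ : s x = s (0 - k%:R * S) - (s (0 - k%:R * S) - s x)); last by ring.
  rewrite (le_trans (ler_normB _ _))// addrC lerD//.
  rewrite (bigD1 (Ordinal (kK : (k < K.+1)%N)))//= lerDl.
  by apply: sumr_ge0.
have C0 : 0 <= C by apply: le_trans (sC 0).
pose A N (u : R) := (\sum_(k < N.+1) s (u - k%:R * S)) / N.+1%:R.
(* Any orbit point can be moved close to any other by boundedly many translations by [S],
   and each such translation changes the mean by O(1/N). *)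
have osc (e : R) : 0 < e -> \forall N \near \oo, forall u v, `|A N u - A N v| <= e.
  move=> e0; have e2 : 0 < e / 2 by rewrite divr_gt0.
  have [d d0 sd] := uniform_continuity_periodic T0 sc sT e2.
  have [K HK] := irrational_orbit_dense T0 irr d0.
  near=> N => u v; have N0 : (0 : R) < N.+1%:R by [].
  have [k kK [l kl]] := HK u v.
  have A1 w : `|A N (w - S) - A N w| <= 2 * C / N.+1%:R.
    rewrite /A -mulrBl normrM (gtr0_norm (x:=_^-1)) ?invr_gt0// ler_pM2r ?invr_gt0//.
    rewrite big_ord_recr/= (big_ord_recl N (fun k : 'I_N.+1 => s (w - k%:R * S)))/=.
    have -> : \sum_(i < N) s (w - (bump 0 i)%:R * S) = \sum_(i < N) s (w - S - i%:R * S).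
      by apply: eq_bigr => i _; congr s; rewrite /bump/= add1n -natr1; ring.
    rewrite [X in `|X|](_ : _ = s (w - S - N%:R * S) - s (w - 0%:R * S)); last by ring.
    by apply: (le_trans (ler_normB _ _)); rewrite (_ : 2 * C = C + C); [exact: lerD|ring].
  have Ak j w : `|A N (w - j%:R * S) - A N w| <= j%:R * (2 * C / N.+1%:R).
    elim: j => [|j IH]; first by rewrite !mul0r subr0 subrr normr0.
    have -> : w - j.+1%:R * S = w - j%:R * S - S by rewrite -natr1; ring.
    rewrite [X in `|X|](_ : _ = (A N (w - j%:R * S - S) - A N (w - j%:R * S)) +
      (A N (w - j%:R * S) - A N w)); last by ring.
    by rewrite (le_trans (ler_normD _ _))// -natr1 mulrDl mul1r addrC lerD.
  have Av : `|A N (u - k%:R * S) - A N v| <= e / 2.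
    rewrite /A -mulrBl normrM (gtr0_norm (x:=_^-1)) ?invr_gt0// ler_pdivrMr//.
    rewrite -sumrB (le_trans (ler_norm_sum _ _ _))//.
    apply: (@le_trans _ _ (\sum_(i < N.+1) e / 2)); last first.
      by rewrite sumr_const card_ord mulr_natr.
    apply: ler_sum => i _; rewrite -(sTz (u - k%:R * S - i%:R * S) l); apply: sd.
    by rewrite [X in `|X|](_ : _ = u - k%:R * S + l%:~R * T - v)//; ring.
  rewrite [X in `|X|](_ : _ = (A N (u - k%:R * S) - A N v) - (A N (u - k%:R * S) - A N u)).
    rewrite (le_trans (ler_normB _ _))// (splitr e) lerD//.
    rewrite (le_trans (Ak _ _))//.
    apply: (@le_trans _ _ (K%:R * (2 * C / N.+1%:R))).
      by rewrite ler_wpM2r ?ler_nat// divr_ge0// mulr_ge0.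
    rewrite mulrA ler_pdivrMr// -ler_pdivrMl//.
    apply: (@le_trans _ _ N%:R); last by rewrite ler_nat.
    by near: N; exact: nbhs_infty_ger.
  by ring.
(* The mean over [N.+1 * M.+1] points is the average of [M.+1] translates of the mean over [N.+1]
   points. Means of two lengths are compared below through the product of the lengths. *)
have block (e : R) N M : (forall u v, `|A N u - A N v| <= e) ->
    `|A (N.+1 * M.+1).-1 0 - A N 0| <= e.
  move=> HN; rewrite /A prednK ?muln_gt0//.
  have M0 : (0 : R) < M.+1%:R by [].
  rewrite (@sum_ord_mul _ N.+1 M.+1 (fun k => s (0 - k%:R * S))).
  rewrite (_ : _ / _ = (\sum_(k < M.+1) A N (- (k * N.+1)%:R * S)) / M.+1%:R); last first.
    rewrite natrM invfM mulrA; congr (_ / _).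
    rewrite mulr_suml; apply: eq_bigr => k _; congr (_ / _); apply: eq_bigr => r _.
    by congr s; rewrite natrD; ring.
  rewrite -/(A N 0) (_ : A N 0 = (\sum_(k < M.+1) A N 0) / M.+1%:R); last first.
    by rewrite sumr_const card_ord -(mulr_natr (A N 0)) mulfK// gt_eqF.
  rewrite -mulrBl -sumrB normrM (gtr0_norm (x:=_^-1)) ?invr_gt0// ler_pdivrMr//.
  rewrite (le_trans (ler_norm_sum _ _ _))//.
  apply: (@le_trans _ _ (\sum_(i < M.+1) e)); last first.
    by rewrite sumr_const card_ord mulr_natr.
  by apply: ler_sum.
have [mu Amu] : exists mu : R, A N 0 @[N --> \oo] --> mu.
  apply: cvg_near_eps => e e0; have e2 : 0 < e / 2 by rewrite divr_gt0.
  have [N0 _ HN0] := osc _ e2.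
  exists (A N0 0); exists N0 => // N /= N0N.
  have b1 := block _ N N0 (HN0 N N0N).
  have b2 := block _ N0 N (HN0 N0 (leqnn _)).
  rewrite [X in `|X|](_ : _ = (A (N0.+1 * N.+1).-1 0 - A N0 0) -
    (A (N.+1 * N0.+1).-1 0 - A N 0)); last by rewrite mulnC; ring.
  by rewrite (le_trans (ler_normB _ _))// (splitr e) lerD.
exists mu; split.
  move=> m sm; apply: (cvgr_to_ge Amu); near=> N.
  rewrite /A ler_pdivlMr//.
  apply: (@le_trans _ _ (\sum_(i < N.+1) m)); last exact: ler_sum.
  by rewrite sumr_const card_ord mulr_natr.
move=> e e0; have e2 : 0 < e / 2 by rewrite divr_gt0.
near \oo => N; exists N => u.
rewrite -/(A N u) (_ : _ - _ = (A N u - A N 0) - (mu - A N 0)); last by ring.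
rewrite (le_trans (ler_normB _ _))// (splitr e) lerD//.
  by move: u (0 : R); near: N; exact: osc.
by near: N; move/cvgrPdist_le : Amu; exact.
Unshelve. all: by end_near. Qed.

End UniformMean.

(** * Mellin convolutions as discrete convolutions *)

Section Cells.
Variable R : realType.
Implicit Types (E : R) (phi f : R -> R).

Lemma cvg_expr_pinfty E : 1 < E -> E ^+ i @[i --> \oo] --> +oo.
Proof.
move=> E1; apply/cvgryPge => A.
have E0 : 0 < E - 1 by rewrite subr_gt0.
near=> i; apply: (@le_trans _ _ (1 + (E - 1) *+ i)).
  rewrite -mulr_natr; apply: (@le_trans _ _ ((E - 1) * (A / (E - 1)))).
    by rewrite mulrC divfK// gt_eqF.
  rewrite ler_wpDl// ler_pM2l//; near: i; exact: nbhs_infty_ger.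
elim: (i : nat) => [|j IH]; first by rewrite mulr0n addr0 expr0.
have Ej : 1 <= E ^+ j by rewrite exprn_ege1// ltW.
have := IH; rewrite mulrSr exprS => H.
have : (E - 1) * 1 <= (E - 1) * E ^+ j by rewrite ler_pM2l.
lra.
Unshelve. all: by end_near. Qed.

Lemma C2_slow_continuous phi (y : R) : C2_slow phi -> 0 < y -> {for y, continuous phi}.
Proof.
move=> [dphi _ _ _ _] y0; apply: differentiable_continuous.
exact/derivable1_diffP/dphi.
Qed.

(** Mean value theorem for [ln phi], whose derivative is small against [1 / x]. The cell extends to
    both sides of [E ^+ i] because for [y] between [E ^+ i] and [E ^+ i.+1], and [x] between
    [E ^+ m] and [E ^+ m.+1], the quotient [x / y] may fall on either side of [E ^+ (m - i)]. *)
Lemma slow_cell_near phi E (e : R) : slowly_varying phi -> C2_slow phi -> 1 < E -> 0 < e ->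
  exists K, forall i y, (K <= i)%N -> E ^+ i / E <= y <= E ^+ i * E ->
    `|phi y - phi (E ^+ i)| <= e * phi (E ^+ i).
Proof.
move=> [phi0 _ _] C2 E1 e0; have [dphi _ _ lnphi _] := C2.
have E0 : 0 < E by lra.
have exp0 : expR (0 : R) = 1 by exact: expR0.
have [eta eta0 Heta] : exists2 eta : R, 0 < eta & forall d : R, `|d| <= eta -> `|expR d - 1| <= e.
  have := @continuous_expR R 0 => /cvgrPdist_le/(_ _ e0)/nbhs_ballP[r /= r0 Hr].
  exists (r / 2); first by rewrite divr_gt0.
  move=> d dr; have := Hr d; rewrite exp0 distrC; apply.
  by rewrite -ball_normE/= sub0r normrN (le_lt_trans dr)// ltr_pdivrMr// ltr_pMr// ltr1n.
(* [E * E] bounds [(b - a) / c] for points [a <= c <= b] of one cell, so [ln phi] varies by at most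
   [eta] there. *)
have E2 : 0 < eta / (E * E) by rewrite divr_gt0// mulr_gt0.
have [X [_ HX]] : exists X : R, X \is Num.real /\ forall x, X < x ->
    `|x * derive1 (@ln R \o phi) x| <= eta / (E * E).
  by have /cvgr0_norm_le/(_ _ E2) := lnphi.
have [K _ HK] : \forall i \near \oo, `|X| + 1 <= E ^+ i / E.
  have := cvg_expr_pinfty E1 => /cvgryPge/(_ ((`|X| + 1) * E)).
  by apply: filterS => i; rewrite ler_pdivlMr.
exists K => i y Ki /andP[y1 y2].
set z := E ^+ i in y1 y2 *.
have z0 : 0 < z by rewrite exprn_gt0.
have Xz : X < z / E.
  have := HK _ Ki; have := ler_norm X; rewrite -/z; lra.
have zE0 : 0 < z / E by rewrite divr_gt0.
have y0 : 0 < y by exact: lt_le_trans y1.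
have zz1 : z / E <= z by rewrite ler_pdivrMr// ler_peMr// ltW.
have zz2 : z <= z * E by rewrite ler_peMr// ltW.
have dln (x : R) : 0 < x -> is_derive x 1 (@ln R \o phi) (derive1 (@ln R \o phi) x).
  move=> x0; have [] := @is_derive1_comp R (@ln R) phi x _ _ (is_derive1_ln (phi0 _ x0))
    (derivableP (dphi _ x0)).
  by move=> der _; rewrite derive1E; exact: derivableP.
have key (a b : R) : z / E <= a -> a <= b -> b <= z * E ->
    `|ln (phi b) - ln (phi a)| <= eta.
  move=> za ab bz.
  have [c|c|c] := @MVT_segment R (@ln R \o phi) (derive1 (@ln R \o phi)) a b ab.
  - by rewrite in_itv/= => /andP[ac _]; apply: dln; lra.
  - apply: derivable_within_continuous => x; rewrite in_itv/= => /andP[ax _].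
    by have [] : is_derive x 1 (@ln R \o phi) (derive1 (@ln R \o phi) x) by apply: dln; lra.
  rewrite in_itv/= => /andP[ac cb] ->.
  have c0 : 0 < c by lra.
  have cX : X < c by lra.
  have := HX _ cX; rewrite normrM (gtr0_norm c0) => Hc.
  rewrite normrM (ger0_norm (x:=b - a)); last by lra.
  have ba : b - a <= c * (E * E).
    apply: (@le_trans _ _ (z * E)); first by lra.
    rewrite mulrA ler_pM2r// -ler_pdivrMr//; lra.
  have dc : `|derive1 (@ln R \o phi) c| <= eta / (E * E) / c.
    by rewrite ler_pdivlMr// mulrC.
  apply: (@le_trans _ _ (eta / (E * E) / c * (c * (E * E)))).
    by apply: ler_pM => //; lra.
  by rewrite le_eqVlt; apply/orP; left; apply/eqP; field; rewrite !gt_eqF.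
have kz : `|ln (phi y) - ln (phi z)| <= eta.
  case: (leP y z) => yz; first by rewrite distrC; exact: key.
  exact: (key z y zz1 (ltW yz) y2).
have phz := phi0 _ z0; have phy := phi0 _ y0.
have -> : phi y - phi z = (expR (ln (phi y) - ln (phi z)) - 1) * phi z.
  by rewrite expRB !lnK ?posrE//; field; rewrite gt_eqF.
by rewrite normrM (gtr0_norm phz) ler_pM2r//; exact: Heta.
Qed.

(** From cell [K] on, relative closeness [1 / 2] gives the constant 2; the earlier cells lie in one
    compact segment, where the ratio of the maximum to the minimum of [phi] serves. *)
Lemma slow_cell_bounded phi E : slowly_varying phi -> C2_slow phi -> 1 < E ->
  exists2 C, 1 <= C & forall i y, E ^+ i / E <= y <= E ^+ i * E ->
    phi y <= C * phi (E ^+ i) /\ phi (E ^+ i) <= C * phi y.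
Proof.
move=> sv C2 E1; have [phi0 _ _] := sv.
have E0 : 0 < E by lra.
have half0 : 0 < 2^-1 :> R by lra.
have [K HK] := slow_cell_near sv C2 E1 half0.
have EK : E^-1 <= E ^+ K * E.
  apply: (@le_trans _ _ 1); first by rewrite invf_le1// ltW.
  by rewrite mulr_ege1// ?exprn_ege1// ltW.
have cont : {within `[E^-1, E ^+ K * E], continuous phi}.
  apply: continuous_in_subspaceT => y /set_mem; rewrite /= in_itv/= => /andP[y1 _].
  by apply: C2_slow_continuous => //; apply: lt_le_trans y1; rewrite invr_gt0.
have [c + Hc] := EVT_max EK cont; rewrite in_itv/= => /andP[c1 c2].
have [d + Hd] := EVT_min EK cont; rewrite in_itv/= => /andP[d1 d2].
have c0 : 0 < c by apply: lt_le_trans c1; rewrite invr_gt0.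
have d0 : 0 < d by apply: lt_le_trans d1; rewrite invr_gt0.
exists (Num.max 2 (phi c / phi d)); first by rewrite le_max; apply/orP; left; lra.
move=> i y yi.
have z0 : 0 < E ^+ i by rewrite exprn_gt0.
have y0 : 0 < y by case/andP: yi => + _; apply: lt_le_trans; rewrite divr_gt0.
have pz := phi0 _ z0; have py := phi0 _ y0.
have up (x w : R) : x <= 2 * w \/ x <= phi c / phi d * w -> 0 < w ->
    x <= Num.max 2 (phi c / phi d) * w.
  move=> + w0; case=> /le_trans; apply; rewrite ler_pM2r// le_max lexx ?orbT//.
case: (leqP K i) => Ki.
  have := HK i y Ki yi; rewrite ler_norml => /andP[h1 h2].
  by split; apply: up => //; left; lra.
have inI x : E ^+ i / E <= x <= E ^+ i * E -> x \in `[E^-1, E ^+ K * E].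
  move=> /andP[x1 x2]; rewrite in_itv/=; apply/andP; split.
    by apply: le_trans x1; rewrite -[leLHS]mul1r ler_pM2r ?invr_gt0// exprn_ege1// ltW.
  apply: (le_trans x2); rewrite ler_pM2r// ler_weXn2l//; [exact: ltW|exact: ltnW].
have yI := inI _ yi.
have zI : E ^+ i \in `[E^-1, E ^+ K * E].
  by apply: inI; rewrite ler_pdivrMr// ler_peMr ?ltW//.
have pd := phi0 _ d0; have pc := phi0 _ c0.
by split; apply: up => //; right; (apply: (@le_trans _ _ (phi c)); first exact: Hc);
  rewrite mulrAC ler_pdivlMr// ler_pM2l//; exact: Hd.
Qed.

Lemma Rintegral_itv_bounds f (a b c1 c2 : R) : a <= b ->
  (forall y, a <= y -> {for y, continuous f}) ->
  (forall y, a <= y <= b -> c1 <= f y <= c2) ->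
  c1 * (b - a) <= \int[lebesgue_measure]_(y in `[a, b]) f y <= c2 * (b - a).
Proof.
move=> ab fc fb.
have fint : lebesgue_measure.-integrable `[a, b] (EFin \o f).
  apply: continuous_compact_integrable; first exact: segment_compact.
  apply: continuous_in_subspaceT => y /set_mem; rewrite /= in_itv/= => /andP[ay _].
  exact: fc.
have cint (c : R) : lebesgue_measure.-integrable `[a, b] (EFin \o (fun=> c)).
  apply: continuous_compact_integrable; first exact: segment_compact.
  by apply: continuous_in_subspaceT => y _; exact: cst_continuous.
have mab : fine (lebesgue_measure `[a, b]) = b - a.
  rewrite lebesgue_measure_itv/= lte_fin; case: ltP => //= ba.
  by apply/eqP; rewrite eq_sym subr_eq0; apply/eqP/le_anti; rewrite ba ab.
have cE (c : R) : c * (b - a) = \int[lebesgue_measure]_(y in `[a, b]) c.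
  by rewrite Rintegral_cst// mab.
rewrite !cE; apply/andP; split; apply: le_Rintegral => //.
  by move=> y; rewrite /= in_itv/= => /fb/andP[].
by move=> y; rewrite /= in_itv/= => /fb/andP[].
Qed.

Lemma Rintegral_itv_split f (a b c : R) : a <= b -> b <= c ->
  (forall y, a <= y -> {for y, continuous f}) ->
  \int[lebesgue_measure]_(y in `[a, c]) f y =
  \int[lebesgue_measure]_(y in `[a, b]) f y +
  \int[lebesgue_measure]_(y in `[b, c]) f y.
Proof.
move=> ab bc fc.
have fint (x y : R) : a <= x -> lebesgue_measure.-integrable `[x, y] (EFin \o f).
  move=> ax; apply: continuous_compact_integrable; first exact: segment_compact.
  apply: continuous_in_subspaceT => z /set_mem; rewrite /= in_itv/= => /andP[xz _].
  by apply: fc; exact: le_trans xz.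
apply/eqP; rewrite addrC -subr_eq; apply/eqP.
rewrite Rintegral_itvB// ?bnd_simp//; last exact: fint.
rewrite Rintegral_itv_obnd_cbnd//.
apply: integrableS (fint b c ab) => //.
by apply: subset_itvr; rewrite bnd_simp.
Qed.

Lemma Rintegral_cells f E m : 1 < E ->
  (forall y, 1 <= y -> {for y, continuous f}) ->
  \int[lebesgue_measure]_(y in `[1, E ^+ m]) f y =
  \sum_(i < m) \int[lebesgue_measure]_(y in `[E ^+ i, E ^+ i.+1]) f y.
Proof.
move=> E1 fc; elim: m => [|m IH].
  by rewrite big_ord0 expr0 set_itv1 Rintegral_set1.
rewrite big_ord_recr/= -IH (@Rintegral_itv_split f 1 (E ^+ m))//.
  by rewrite exprn_ege1// ltW.
by rewrite ler_weXn2l// ltW.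
Qed.

(** The cell from [E ^+ i] to [E ^+ i.+1] contributes at most [C * (E - 1) * phi (E ^+ i)] to the
    integral of [phi x / x], so bounded partial sums would make the integral finite by monotone
    convergence. *)
Lemma slow_seq_of_slowly_varying phi E : slowly_varying phi -> C2_slow phi -> 1 < E ->
  (\int[lebesgue_measure]_(x in `[1%R, +oo[) (phi x / x)%:E = +oo)%E ->
  slow_seq (fun i => phi (E ^+ i)).
Proof.
move=> sv C2 E1 dv; have [phi0 _ phi1] := sv.
have E0 : 0 < E by lra.
split.
- by move=> i; apply: phi0; rewrite exprn_gt0.
- have := phi1 _ E0 => /(cvg_comp _ _ (cvg_expr_pinfty E1)).
  by under eq_cvg do rewrite /= -exprS.
move=> B; apply/not_existsP => HB.
have {}HB m : \sum_(i < m) phi (E ^+ i) < B by rewrite ltNge; apply/negP/HB.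
have [C C1 HC] := slow_cell_bounded sv C2 E1.
pose f x := phi x / x.
have fc y : 1 <= y -> {for y, continuous f}.
  move=> y1; have y0 : 0 < y by lra.
  apply: cvgM; first exact: C2_slow_continuous.
  by apply: cvgV; [rewrite gt_eqF|exact: cvg_id].
have fint m : lebesgue_measure.-integrable `[1, E ^+ m] (EFin \o f).
  apply: continuous_compact_integrable; first exact: segment_compact.
  by apply: continuous_in_subspaceT => z /set_mem; rewrite /= in_itv/= => /andP[/fc].
have bnd m : \int[lebesgue_measure]_(y in `[1, E ^+ m]) f y <= C * (E - 1) * B.
  rewrite Rintegral_cells//.
  apply: (@le_trans _ _ (\sum_(i < m) C * (E - 1) * phi (E ^+ i))); last first.
    by rewrite -mulr_sumr ler_pM2l ?mulr_gt0//; [exact: ltW|lra|lra].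
  apply: ler_sum => i _; have z0 : 0 < E ^+ i by rewrite exprn_gt0.
  have zz : E ^+ i <= E ^+ i.+1 by rewrite ler_weXn2l// ltW.
  have z1 : 1 <= E ^+ i by rewrite exprn_ege1// ltW.
  have fb y : E ^+ i <= y <= E ^+ i.+1 -> 0 <= f y <= C * phi (E ^+ i) / E ^+ i.
    move=> /andP[y1 y2]; have y0 : 0 < y by lra.
    apply/andP; split; first by rewrite divr_ge0// ltW// phi0.
    apply: ler_pM.
    - by rewrite ltW// phi0.
    - by rewrite invr_ge0 ltW.
    - have [|//] := HC i y; rewrite -exprSr y2 andbT.
      by apply: le_trans y1; rewrite ler_pdivrMr// ler_peMr// ltW.
    - by rewrite lef_pV2.
  have /andP[_ /le_trans] := Rintegral_itv_bounds zz (fun y iy => fc y (le_trans z1 iy)) fb.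
  apply.
  by rewrite exprS le_eqVlt; apply/orP; left; apply/eqP; field; rewrite gt_eqF.
have cv := @ge0_nondecreasing_set_cvg_integral _ (measurableTypeR R) R
  (fun m => `[1, E ^+ m]%classic)
  (fun x => (f x)%:E) lebesgue_measure.
have U : \bigcup_m `[1, E ^+ m]%classic = `[1, +oo[%classic.
  apply/seteqP; split => [x [m _]|x]; rewrite /= !in_itv/=; first by case/andP => ->.
  rewrite andbT => x1; have := cvg_expr_pinfty E1 => /cvgryPge/(_ x)[m _ Hm].
  by exists m => //=; rewrite in_itv/= x1 Hm /=.
have {}cv : (\int[lebesgue_measure]_(x in `[1%R, (E ^+ m)%R]) (f x)%:E)%E @[m --> \oo] -->
    (\int[lebesgue_measure]_(x in `[1%R, +oo[) (f x)%:E)%E.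
  rewrite -U; apply: cv => //.
  - by move=> m n mn; apply/subsetPset; apply: subset_itvl; rewrite bnd_simp ler_weXn2l// ltW.
  - by move=> i; have /integrableP[] := fint i.
  - move=> i x; rewrite /= in_itv/= => /andP[x1 _]; rewrite lee_fin divr_ge0//; last lra.
    by rewrite ltW// phi0//; lra.
have : (\int[lebesgue_measure]_(x in `[1%R, +oo[) (f x)%:E <= (C * (E - 1) * B)%:E)%E.
  rewrite -(cvg_lim _ cv)//; apply: lime_le; first by apply/cvg_ex; eexists; exact: cv.
  near=> m; rewrite -[leLHS]fineK; first by rewrite lee_fin; exact: bnd.
  exact: integrable_fin_num (fint m).
by rewrite dv leye_eq.
Unshelve. all: by end_near. Qed.

End Cells.

Section MellinConvolution.
Variable R : realType.
Implicit Types (E : R) (phi f : R -> R).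

Lemma ends_dconv (P Q : nat -> R) K (e : R) : slow_seq P -> slow_seq Q -> 0 < e ->
  \forall m \near \oo, \sum_(i < m.+1)
    (if (K <= i)%N && (i + K <= m)%N then 0 else P (m - i)%N * Q i) <= e * dconv P Q m.
Proof.
move=> Ps Qs e0; have P0 : forall i, 0 < P i by case: Ps.
have Q0 : forall i, 0 < Q i by case: Qs.
have PQ0 m i : 0 < P (m - i)%N * Q i by exact: mulr_gt0.
apply: (@weighted_small R P Q (fun m i => if (K <= i)%N && (i + K <= m)%N then 0
  else P (m - i)%N * Q i) 1) => // [m i im|d d0].
  by rewrite mul1r; case: ifP => // _; exact: ltW.
by exists K => m i Ki im; rewrite Ki im/= mulr_ge0// ltW.
Qed.

(** The exact weight of a cell for [dy / y] is [ln E]. The cruder bounds [(E - 1) / E] and [E - 1]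
    suffice, since their ratio [E] tends to 1 with the mesh. *)
Lemma mellin_dconv phi1 phi2 E (e : R) :
  slowly_varying phi1 -> C2_slow phi1 -> slowly_varying phi2 -> C2_slow phi2 ->
  1 < E -> slow_seq (fun i => phi1 (E ^+ i)) -> slow_seq (fun i => phi2 (E ^+ i)) ->
  0 < e ->
  \forall m \near \oo, forall x, E ^+ m <= x <= E ^+ m.+1 ->
    (1 - e) * ((E - 1) / E) * dconv (fun i => phi2 (E ^+ i)) (fun i => phi1 (E ^+ i)) m
      <= mellin_conv phi1 phi2 x <=
    (1 + e) * (E - 1) * dconv (fun i => phi2 (E ^+ i)) (fun i => phi1 (E ^+ i)) m.
Proof.
move=> sv1 C21 sv2 C22 E1; set Q := fun i => phi1 (E ^+ i).
set P := fun i => phi2 (E ^+ i) => Qs Ps e0.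
have E0 : 0 < E by lra.
have [phi10 _ _] := sv1; have [phi20 _ _] := sv2.
have P0 i : 0 < P i by case: Ps => ->.
have Q0 i : 0 < Q i by case: Qs => ->.
have PQ0 m i : 0 < P (m - i)%N * Q i by exact: mulr_gt0.
have [C1 C11 HC1] := slow_cell_bounded sv1 C21 E1.
have [C2 C21' HC2] := slow_cell_bounded sv2 C22 E1.
pose C := C1 * C2.
have C0 : 1 <= C by rewrite mulr_ege1.
(* Chosen so that [(1 + d) ^+ 2 + C * d <= 1 + e], with [C * d] paying for the ends, and
   [(1 - d) ^+ 3 >= 1 - e]. *)
pose d := Num.min 1 (e / (3 + C)).
have d0 : 0 < d by rewrite lt_min ltr01 divr_gt0//; lra.
have d1 : d <= 1 by rewrite ge_min lexx.
have dC : (3 + C) * d <= e.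
  by rewrite mulrC -ler_pdivlMr; [rewrite ge_min lexx orbT|lra].
have [K1 HK1] := slow_cell_near sv1 C21 E1 d0.
have [K2 HK2] := slow_cell_near sv2 C22 E1 d0.
pose K := (maxn K1 K2).+1.
have := ends_dconv K Ps Qs d0; apply: filterS => m Hm x /andP[xm1 xm2].
have x0 : 0 < x by apply: lt_le_trans xm1; rewrite exprn_gt0.
have x1 : 1 <= x by apply: le_trans xm1; rewrite exprn_ege1// ltW.
pose f y := phi1 y * phi2 (x / y) / y.
have fc y : 1 <= y -> {for y, continuous f}.
  move=> y1; have y0 : 0 < y by lra.
  have yc : {for y, continuous (fun y : R => y^-1)}.
    by apply: cvgV; [rewrite gt_eqF|exact: cvg_id].
  apply: cvgM => //; apply: cvgM; first exact: C2_slow_continuous.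
  apply: (@continuous_comp _ _ _ (fun y : R => x / y) phi2).
    by apply: cvgM => //; exact: cvg_cst.
  by apply: C2_slow_continuous => //; rewrite divr_gt0.
have f0 y : 1 <= y -> 0 <= f y.
  move=> y1; have y0 : 0 < y by lra.
  by rewrite divr_ge0 ?mulr_ge0// ltW ?phi10 ?phi20 ?divr_gt0.
have I0 (a b : R) : 1 <= a -> a <= b -> 0 <= \int[lebesgue_measure]_(y in `[a, b]) f y.
  move=> a1 ab; apply: Rintegral_ge0 => y; rewrite /= in_itv/= => /andP[ay _].
  by apply: f0; lra.
have Em : 1 <= E ^+ m by rewrite exprn_ege1// ltW.
have hi : mellin_conv phi1 phi2 x <= \int[lebesgue_measure]_(y in `[1, E ^+ m.+1]) f y.
  rewrite (@Rintegral_itv_split R f 1 x)// lerDl; exact: I0.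
have lo : \int[lebesgue_measure]_(y in `[1, E ^+ m]) f y <= mellin_conv phi1 phi2 x.
  rewrite /mellin_conv -/f (@Rintegral_itv_split R f 1 (E ^+ m) x)// lerDl; exact: I0.
rewrite Rintegral_cells// in hi; rewrite Rintegral_cells// in lo.
have cell i (c1 c2 : R) : (i <= m)%N -> 0 <= c1 ->
    (forall y, E ^+ i <= y <= E ^+ i.+1 -> c1 <= phi1 y * phi2 (x / y) <= c2) ->
    c1 * ((E - 1) / E) <=
      \int[lebesgue_measure]_(y in `[E ^+ i, E ^+ i.+1]) f y <= c2 * (E - 1).
  move=> im c10 Hc; have z0 : 0 < E ^+ i by rewrite exprn_gt0.
  have zz : E ^+ i <= E ^+ i.+1 by rewrite ler_weXn2l// ltW.
  have z1 : 1 <= E ^+ i by rewrite exprn_ege1// ltW.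
  have w0 : 0 < E ^+ i.+1 by rewrite exprn_gt0.
  have fb y : E ^+ i <= y <= E ^+ i.+1 -> c1 / E ^+ i.+1 <= f y <= c2 / E ^+ i.
    move=> iy; have /andP[y1 y2] := iy; have y0 : 0 < y by lra.
    have /andP[h1 h2] := Hc y iy; have yi0 : 0 <= y^-1 by rewrite invr_ge0 ltW.
    apply/andP; split; apply: ler_pM => //.
    - by rewrite invr_ge0 ltW.
    - by rewrite lef_pV2.
    - exact: le_trans h1.
    - by rewrite lef_pV2.
  have := Rintegral_itv_bounds zz (fun y iy => fc y (le_trans z1 iy)) fb.
  rewrite exprS.
  rewrite (_ : c1 / _ * _ = c1 * ((E - 1) / E)); last by field; rewrite !gt_eqF.
  by rewrite (_ : c2 / _ * _ = c2 * (E - 1))//; field; rewrite gt_eqF.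
have xy i y : (i <= m)%N -> E ^+ i <= y <= E ^+ i.+1 ->
    E ^+ i / E <= y <= E ^+ i * E /\ E ^+ (m - i) / E <= x / y <= E ^+ (m - i) * E.
  move=> im /andP[y1 y2]; have z0 : 0 < E ^+ i by rewrite exprn_gt0.
  have y0 : 0 < y by lra.
  rewrite -exprSr y2 andbT; split.
    by apply: le_trans y1; rewrite ler_pdivrMr// ler_peMr// ltW.
  have mi : E ^+ m = E ^+ (m - i) * E ^+ i by rewrite -exprD subnK.
  have w0 : 0 < E ^+ (m - i) by rewrite exprn_gt0.
  rewrite ler_pdivlMr// ler_pdivrMr//; apply/andP; split.
    apply: le_trans xm1; rewrite mulrAC ler_pdivrMr// mi -mulrA ler_pM2l//.
    by rewrite -exprSr.
  apply: (le_trans xm2); rewrite exprSr mi mulrAC ler_pM2l// mulr_gt0//.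
have full i y : (i <= m)%N -> E ^+ i <= y <= E ^+ i.+1 ->
    0 <= phi1 y * phi2 (x / y) <= C * (P (m - i)%N * Q i).
  move=> im /(xy _ _ im)[yi xyi].
  have y0 : 0 < y.
    by case/andP: yi => + _; apply: lt_le_trans; rewrite divr_gt0// exprn_gt0.
  have p1 := phi10 _ y0; have p2 := phi20 _ (divr_gt0 x0 y0).
  apply/andP; split; first by rewrite ltW// mulr_gt0.
  have [h1 _] := HC1 i y yi; have [h2 _] := HC2 (m - i)%N (x / y) xyi.
  rewrite /C (_ : C1 * C2 * _ = (C1 * Q i) * (C2 * P (m - i)%N)); last by ring.
  by apply: ler_pM => //; exact: ltW.
have mid i y : (K <= i)%N -> (i + K <= m)%N -> E ^+ i <= y <= E ^+ i.+1 ->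
    (1 - d) ^+ 2 * (P (m - i)%N * Q i) <= phi1 y * phi2 (x / y) <=
    (1 + d) ^+ 2 * (P (m - i)%N * Q i).
  move=> Ki Kim iy; have im : (i <= m)%N by apply: leq_trans Kim; exact: leq_addr.
  have [yi xyi] := xy i y im iy.
  have y0 : 0 < y.
    by case/andP: yi => + _; apply: lt_le_trans; rewrite divr_gt0// exprn_gt0.
  have p1 := phi10 _ y0; have p2 := phi20 _ (divr_gt0 x0 y0).
  have K1i : (K1 <= i)%N by apply: leq_trans Ki; rewrite leqW// leq_maxl.
  have K2i : (K2 <= m - i)%N by rewrite leq_subRL// (leq_trans _ Kim)// leq_add2l leqW// leq_maxr.
  have := HK1 i y K1i yi; have := HK2 (m - i)%N (x / y) K2i xyi.
  rewrite -/(Q i) -/(P (m - i)%N) !ler_norml => /andP[h1 h2] /andP[h3 h4].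
  have Pm := P0 (m - i)%N; have Qi := Q0 i.
  have d10 : 0 <= 1 - d by rewrite subr_ge0.
  apply/andP; split.
    rewrite (_ : _ * _ = ((1 - d) * Q i) * ((1 - d) * P (m - i)%N)); last by ring.
    have le1 u v : - (d * u) <= v - u -> (1 - d) * u <= v.
      by rewrite mulrBl mul1r -[X in _ -> _ <= X](subrK u) (addrC (v - u)) lerD2l.
    by apply: ler_pM; [exact: mulr_ge0 d10 (ltW Qi)|exact: mulr_ge0 d10 (ltW Pm)|exact: le1|exact: le1].
  rewrite (_ : _ ^+ 2 * _ = ((1 + d) * Q i) * ((1 + d) * P (m - i)%N)); last by ring.
  have le2 u v : v - u <= d * u -> v <= (1 + d) * u by rewrite mulrDl mul1r lerBlDl.
  by apply: ler_pM; [exact: ltW|exact: ltW|exact: le2|exact: le2].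
have Hup : \sum_(i < m.+1) \int[lebesgue_measure]_(y in `[E ^+ i, E ^+ i.+1]) f y <=
    (1 + e) * (E - 1) * dconv P Q m.
  apply: (@le_trans _ _ (\sum_(i < m.+1) ((1 + d) ^+ 2 * (P (m - i)%N * Q i) + C *
    (if (K <= i)%N && (i + K <= m)%N then 0 else P (m - i)%N * Q i)) * (E - 1))).
    apply: ler_sum => i _; have im : (i <= m)%N by rewrite -ltnS.
    have PQi := PQ0 m i.
    have Hc y : E ^+ i <= y <= E ^+ i.+1 -> 0 <= phi1 y * phi2 (x / y) <=
       (1 + d) ^+ 2 * (P (m - i)%N * Q i) + C *
    (if (K <= i)%N && (i + K <= m)%N then 0 else P (m - i)%N * Q i).
      move=> iy; have /andP[-> h] := full i y im iy.
      case: ifP => [/andP[Ki Kim]|_].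
        by rewrite mulr0 addr0; have /andP[] := mid i y Ki Kim iy.
      by apply: (le_trans h); rewrite lerDr mulr_ge0 ?sqr_ge0// ltW.
    by have /andP[] := cell i _ _ im (lexx 0) Hc.
  rewrite -mulr_suml big_split/= -!mulr_sumr -/(dconv P Q m).
  rewrite [leRHS]mulrAC ler_pM2r ?subr_gt0//.
  have S0 := dconv_gt0 m Ps Qs.
  apply: (@le_trans _ _ ((1 + d) ^+ 2 * dconv P Q m + C * (d * dconv P Q m))).
    by rewrite lerD2l ler_pM2l//; lra.
  rewrite mulrA -mulrDl ler_pM2r//.
  have dd : d * d <= 1 * d by rewrite ler_pM2r.
  by rewrite expr2; lra.
have Hlo : (1 - e) * ((E - 1) / E) * dconv P Q m <=
    \sum_(i < m) \int[lebesgue_measure]_(y in `[E ^+ i, E ^+ i.+1]) f y.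
  apply: (@le_trans _ _ (\sum_(i < m.+1) ((1 - d) ^+ 2 * (P (m - i)%N * Q i -
    (if (K <= i)%N && (i + K <= m)%N then 0 else P (m - i)%N * Q i))) * ((E - 1) / E))).
    rewrite -mulr_suml -mulr_sumr sumrB -/(dconv P Q m).
    rewrite [leLHS]mulrAC ler_pM2r ?divr_gt0 ?subr_gt0//.
    have S0 := dconv_gt0 m Ps Qs.
    apply: (@le_trans _ _ ((1 - d) ^+ 2 * (dconv P Q m - d * dconv P Q m))); last first.
      by rewrite ler_wpM2l ?sqr_ge0//; lra.
    rewrite -{2}(mul1r (dconv P Q m)) -mulrBl mulrA ler_pM2r//.
    have d3 : 3 * d <= e.
      have : 0 <= C * d by rewrite mulr_ge0 ?(ltW d0)// (le_trans ler01).
      by move: dC; rewrite mulrDl; lra.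
    have dd : 0 <= (d * d) * (3 - d) by rewrite mulr_ge0 ?mulr_ge0 ?ltW//; lra.
    by rewrite expr2; lra.
  rewrite big_ord_recr/= subnn (_ : (if _ then _ else _) = P 0%N * Q m); last first.
    by rewrite (_ : (m + K <= m)%N = false) ?andbF// /K addnS ltnNge leq_addr.
  rewrite subrr mulr0 mul0r addr0; apply: ler_sum => i _.
  have im : (i <= m)%N by exact: ltnW.
  have PQi := PQ0 m i.
  case: ifP => [/andP[Ki Kim]|_]; last first.
    rewrite subrr mulr0 mul0r; apply: I0; first by rewrite exprn_ege1// ltW.
    by rewrite ler_weXn2l// ltW.
  have Hc y : E ^+ i <= y <= E ^+ i.+1 -> (1 - d) ^+ 2 * (P (m - i)%N * Q i - 0)
      <= phi1 y * phi2 (x / y) <= C * (P (m - i)%N * Q i).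
    move=> iy; have /andP[_ ->] := full i y im iy; rewrite subr0 andbT.
    by have /andP[] := mid i y Ki Kim iy.
  have c0 : 0 <= (1 - d) ^+ 2 * (P (m - i)%N * Q i - 0).
    by rewrite subr0 mulr_ge0 ?sqr_ge0// ltW.
  by have /andP[] := cell i _ _ im c0 Hc.
by rewrite (le_trans Hlo lo) (le_trans hi Hup).
Qed.

End MellinConvolution.

(** * Asymptotics of Stieltjes convolutions of counting functions *)

Section StieltjesSums.
Variable R : realType.
Implicit Types (N phi s : R -> R) (E c p T : R).

Lemma powR_exprn E (a : R) i : 0 < E -> (E ^+ i) `^ a = (E `^ a) ^+ i.
Proof.
move=> E0; elim: i => [|i IH]; first by rewrite !expr0 powR1.
by rewrite !exprS powRM ?IH// ltW// exprn_gt0.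
Qed.

(** Sampling at [t = c / E ^+ i]. The threshold [c] costs a constant power and a factor
    [phi (c^-1 * x) / phi x], which tends to 1; boundedness of [s] turns the relative error into an
    absolute one. *)
Lemma equiv_seq N phi s p c E (Cs : R) : 0 < c -> 1 < E ->
  slowly_varying phi -> (forall x, `|s x| <= Cs) ->
  N ~_(0^'+) (fun t => phi (1 / t) * s (ln (1 / t)) / t `^ (1 / p)) ->
  N (c / E ^+ i) / (E `^ (1 / p)) ^+ i / phi (E ^+ i) -
    s (ln (E ^+ i / c)) / c `^ (1 / p) @[i --> \oo] --> (0 : R).
Proof.
move=> c0 E1 [phi0 _ phi1] sC /eqaddoP Nh.
have E0 : 0 < E by lra.
set a := 1 / p in Nh *; set rho := E `^ a.
have rho0 : 0 < rho by rewrite powR_gt0.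
have ca0 : 0 < c `^ a by rewrite powR_gt0.
have Cs0 : 0 <= Cs by apply: le_trans (sC 0).
pose st i := s (ln (E ^+ i / c)) / c `^ a.
pose q i := phi (c^-1 * E ^+ i) / phi (E ^+ i).
have ci0 : 0 < c^-1 by rewrite invr_gt0.
have q1 : q i @[i --> \oo] --> (1 : R).
  exact: (cvg_comp (fun i => E ^+ i) (fun x => phi (c^-1 * x) / phi x)
    (cvg_expr_pinfty E1) (phi1 _ ci0)).
have stC i : `|st i| <= Cs / c `^ a.
  by rewrite normrM (gtr0_norm (x:=_^-1)) ?invr_gt0// ler_pM2r// invr_gt0.
have sq : st i * (q i - 1) @[i --> \oo] --> (0 : R).
  apply: (bounded_mul_cvg0 stC); rewrite -(subrr 1); apply: cvgB => //.
  exact: cvg_cst.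
have tpow i : (c / E ^+ i) `^ a = c `^ a / rho ^+ i.
  have Ei0 : 0 < E ^+ i by rewrite exprn_gt0.
  apply/(canRL (mulfK _)); first by rewrite gt_eqF// exprn_gt0.
  rewrite -powR_exprn// -powRM ?divfK ?gt_eqF//; last exact: ltW.
  by rewrite ltW// divr_gt0.
have Nst : N (c / E ^+ i) / rho ^+ i / phi (E ^+ i) - st i * q i @[i --> \oo] --> (0 : R).
  apply/cvgr0Pnorm_le => e e0.
  have D0 : 0 < 2 * (Cs / c `^ a) + 1.
    by rewrite ltr_wpDl// mulr_ge0// divr_ge0// ltW.
  have /nbhs_ballP[d /= d0 Hd] := Nh _ (divr_gt0 e0 D0).
  near=> i.
  have Ei0 : 0 < E ^+ i by rewrite exprn_gt0.
  have t0 : 0 < c / E ^+ i by rewrite divr_gt0.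
  have := Hd (c / E ^+ i); rewrite -ball_normE/= sub0r normrN (gtr0_norm t0).
  have td : c / E ^+ i < d.
    rewrite ltr_pdivrMr// mulrC -ltr_pdivrMr//.
    apply: (@lt_le_trans _ _ (c / d + 1)); first by rewrite ltrDl.
    by near: i; have /cvgryPge := cvg_expr_pinfty E1; exact.
  move=> /(_ td t0); rewrite !fctE tpow.
  have -> : 1 / (c / E ^+ i) = c^-1 * E ^+ i by rewrite div1r invf_div mulrC.
  rewrite (mulrC c^-1) -/(st i).
  have hE : phi (E ^+ i / c) * s (ln (E ^+ i / c)) / (c `^ a / rho ^+ i) =
      st i * q i * (rho ^+ i * phi (E ^+ i)).
    rewrite /st /q (mulrC c^-1); field.
    by rewrite !gt_eqF//= ?phi0// exprn_gt0.
  rewrite hE => H.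
  have rp : 0 < rho ^+ i * phi (E ^+ i) by rewrite mulr_gt0 ?exprn_gt0// phi0.
  have -> : N (c / E ^+ i) / rho ^+ i / phi (E ^+ i) - st i * q i =
      (N (c / E ^+ i) - st i * q i * (rho ^+ i * phi (E ^+ i))) / (rho ^+ i * phi (E ^+ i)).
    by field; rewrite !gt_eqF//= ?phi0// exprn_gt0.
  rewrite normrM (gtr0_norm (x:=_^-1)) ?invr_gt0// ler_pdivrMr//.
  apply: (le_trans H); rewrite normrM (gtr0_norm rp) [leLHS]mulrA ler_pM2r//.
  rewrite mulrAC ler_pdivrMr// ler_pM2l// normrM mulrC.
  apply: (@le_trans _ _ (2 * (Cs / c `^ a))); last by rewrite lerDl.
  apply: ler_pM => //.
  rewrite -[q i](subrK 1) (le_trans (ler_normD _ _))// normr1 -lerBrDr.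
  rewrite (_ : 2 - 1 = 1); last by ring.
  by near: i; have /cvgrPdist_le := q1 => /(_ 1 ltr01); apply: filterS => i; rewrite distrC.
apply: (near_eq_cvg_to (cvgD Nst sq)); first by rewrite addr0.
by near=> i; rewrite /= /st; ring.
Unshelve. all: by end_near. Qed.

(* With [N1] and [N2] counting eigenvalues above a threshold, the second factor counts those
   between [c / E ^+ i.+1] and [c / E ^+ i]; for each of them the number of eigenvalues of the
   tensor product lies between consecutive values of [N2] on the grid. *)
Definition stieltjes_sum N1 N2 c E (m : nat) : R :=
  \sum_(i < m.+1) N2 (c / E ^+ (m - i)) * (N1 (c / E ^+ i.+1) - N1 (c / E ^+ i)).

Lemma stieltjes_sum_cvg N1 N2 phi1 phi2 s1 s2 p T1 T2 (B n : nat) :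
  0 < p -> slowly_varying phi1 -> C2_slow phi1 -> slowly_varying phi2 -> C2_slow phi2 ->
  periodic_factor p T1 s1 -> periodic_factor p T2 s2 ->
  N1 ~_(0^'+) (fun t => phi1 (1 / t) * s1 (ln (1 / t)) / t `^ (1 / p)) ->
  N2 ~_(0^'+) (fun t => phi2 (1 / t) * s2 (ln (1 / t)) / t `^ (1 / p)) ->
  (\int[lebesgue_measure]_(x in `[1%R, +oo[) (phi1 x / x)%:E = +oo)%E ->
  (\int[lebesgue_measure]_(x in `[1%R, +oo[) (phi2 x / x)%:E = +oo)%E ->
  irrational (T1 / T2) -> (0 < n)%N ->
  let E := expR (T1 / n%:R) in let c := expR (B%:R * T1) in
  exists2 A : R, 0 < A & stieltjes_sum N1 N2 c E m / (E `^ (1 / p)) ^+ m /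
    dconv (fun i => phi2 (E ^+ i)) (fun i => phi1 (E ^+ i)) m @[m --> \oo] --> A.
Proof.
move=> p0 sv1 C21 sv2 C22 [T10 cs1 ps1 [m1 [M1 [m10 sM1]]] _]
  [T20 cs2 ps2 [m2 [M2 [m20 sM2]]] _] N1h N2h dv1 dv2 irr n0 E c.
have n0R : (0 : R) < n%:R by rewrite ltr0n.
have d0 : 0 < T1 / n%:R by rewrite divr_gt0.
have E1 : 1 < E by rewrite expR_gt1.
have c0 : 0 < c by exact: expR_gt0.
have lnE (i : nat) : ln (E ^+ i / c) = i%:R * (T1 / n%:R) - B%:R * T1.
  by rewrite -expRM_natl -expRB expRK.
have a0 : 0 < 1 / p by rewrite divr_gt0.
have rho1 : 1 < E `^ (1 / p) by rewrite /powR gt_eqF ?expR_gt0// expR_gt1 expRK mulr_gt0.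
clearbody E c; set a := 1 / p in a0 rho1 *.
have ca0 : 0 < c `^ a by rewrite powR_gt0.
have [b b0 bE] : exists2 b, 0 < b & b = (c `^ a)^-1 by eexists; [|reflexivity]; rewrite invr_gt0.
pose r (i : nat) := s1 (ln (E ^+ i / c)) * b.
(* Shift and scaling absorb the threshold [c]: [ln (E ^+ i / c)] is
   [i%:R * (T1 / n%:R) - B%:R * T1], and [b] is the constant power of [c] left by the sampling. *)
pose s x := s2 (x - B%:R * T1) * b.
have bd (f : R -> R) (m M : R) : 0 < m -> (forall x, setT x -> m <= f x <= M) ->
    forall x, `|f x| <= M.
  move=> m0 fM x; have /andP[fm fMx] := fM x I.
  by rewrite ger0_norm//; lra.
have s1M := bd _ _ _ m10 sM1; have s2M := bd _ _ _ m20 sM2.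
have M10 : 0 <= M1 by apply: le_trans (s1M 0).
have M20 : 0 <= M2 by apply: le_trans (s2M 0).
have cs : continuous s.
  move=> x; apply: cvgM; last exact: cvg_cst.
  apply: (@continuous_comp _ _ _ (fun x : R => x - B%:R * T1) s2); last exact: cs2.
  by apply: cvgB; [exact: cvg_id|exact: cvg_cst].
have ps : periodic s T2 by move=> x; rewrite /s addrAC ps2.
have [mu [mum Hmu]] := uniform_mean T20 cs ps irr.
have mu0 : 0 < mu.
  apply: (@lt_le_trans _ _ (m2 * b)); first by rewrite mulr_gt0.
  by apply: mum => x; rewrite ler_pM2r//; have /andP[] := sM2 (x - B%:R * T1) I.
have Ps := slow_seq_of_slowly_varying sv2 C22 E1 dv2.
have Qs := slow_seq_of_slowly_varying sv1 C21 E1 dv1.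
have rn j : r (j + n)%N = r j.
  rewrite /r !lnE natrD mulrDl [n%:R * _]mulrC divfK ?gt_eqF//.
  by rewrite addrAC ps1.
pose C := Num.max M1 M2 * b.
have sC x : `|s x| <= C.
  rewrite normrM (gtr0_norm b0) ler_pM2r//.
  by rewrite le_max s2M orbT.
have rC i : `|r i| <= C.
  rewrite normrM (gtr0_norm b0) ler_pM2r//.
  by rewrite le_max s1M.
(* A full period of [n] grid steps translates by exactly [T1], which is irrational relative to the
   period [T2] of [s]. *)
have smu (e : R) : 0 < e -> exists M, forall u,
    `|(\sum_(k < M.+1) s (u - k%:R * (n%:R * (T1 / n%:R)))) / M.+1%:R - mu| <= e.
  move=> e0; have [M HM] := Hmu e e0; exists M => u.
  by rewrite (_ : n%:R * (T1 / n%:R) = T1)//; field; rewrite gt_eqF.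
have Fs : N2 (c / E ^+ i) / (E `^ a) ^+ i / phi2 (E ^+ i) - s (i%:R * (T1 / n%:R))
    @[i --> \oo] --> (0 : R).
  apply: (near_eq_cvg_to (equiv_seq c0 E1 sv2 s2M N2h)) => //.
  by near=> i; rewrite /= lnE /s bE.
have Gr : N1 (c / E ^+ i) / (E `^ a) ^+ i / phi1 (E ^+ i) - r i @[i --> \oo] --> (0 : R).
  by rewrite /r bE; exact: (equiv_seq c0 E1 sv1 s1M N1h).
have rho0 : 0 < E `^ a by lra.
exists (mu * ((E `^ a - 1) * (\sum_(i < n) r i) / n%:R)); last first.
  exact: (@dconv_stieltjes R _ _ (fun i => N2 (c / E ^+ i)) (fun i => N1 (c / E ^+ i))
    s r n (E `^ a) (T1 / n%:R) mu C Ps Qs n0 rho0 rn sC rC smu Fs Gr).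
rewrite mulr_gt0// divr_gt0// mulr_gt0 ?subr_gt0//.
apply: (@lt_le_trans _ _ (\sum_(i < n) m1 * b)).
  by rewrite sumr_const card_ord mulrn_wgt0// mulr_gt0.
apply: ler_sum => i _; rewrite ler_pM2r//.
by have /andP[] := sM1 (ln (E ^+ i / c)) I.
Unshelve. all: by end_near. Qed.

End StieltjesSums.

(** * From the grid to all small [t] *)

Section Bracketing.
Variable R : realType.
Implicit Types (N phi s : R -> R) (E c p T : R).

Lemma slow_seq_dconv (P Q : nat -> R) : slow_seq P -> slow_seq Q -> slow_seq (dconv P Q).
Proof.
move=> Ps Qs; split; [by move=> m; exact: dconv_gt0|exact: dconv_ratio|move=> B].
have P0 : forall i, 0 < P i by case: Ps.
have [Q0 _ Qdiv] := Qs.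
have [m Hm] := Qdiv (B / P 0%N); exists m.
apply: (@le_trans _ _ (P 0%N * \sum_(i < m) Q i)).
  by rewrite -ler_pdivrMl// mulrC.
rewrite mulr_sumr; apply: ler_sum => i _; rewrite /dconv big_ord_recr/= subnn.
by rewrite lerDr; apply: sumr_ge0 => j _; rewrite mulr_ge0// ltW.
Qed.

Lemma expr_bracket E x L : 1 < E -> E ^+ L <= x ->
  exists2 l, (L <= l)%N & E ^+ l <= x <= E ^+ l.+1.
Proof.
move=> E1 Lx; have E0 : 0 < E by lra.
have ex : exists l, x < E ^+ l.+1.
  have := cvg_expr_pinfty E1 => /cvgryPge/(_ (x + 1)) [l _ /(_ l.+1 (leqnSn l)) H].
  by exists l; rewrite (lt_le_trans _ H)// ltrDl.
case: (ex_minnP ex) => l xl lmin; exists l.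
  by have := le_lt_trans Lx xl; rewrite ltr_eXn2l.
rewrite (ltW xl) andbT; case: l xl lmin => [|l] xl lmin.
  by apply: le_trans Lx; rewrite expr0 exprn_ege1// ltW.
by rewrite leNgt; apply/negP => /lmin; rewrite ltnn.
Qed.

(** With [c = E ^+ h] the thresholds [c ^+ 2 / E ^+ m] are themselves powers of [E], and
    [rho ^+ (2 * h)] in the witness [M] compensates [c ^+ 2]. The lower loss [rho ^+ 2] comes from
    one grid step in [N12] and one in the power of [t]; the upper loss is a [rho] from [N12] and the
    [E] between the two bounds on [Phi]. *)
Lemma stieltjes_bracket N1 N2 N12 (Phi : R -> R) (S : nat -> R) E (A a : R) h :
  1 < E -> 0 < A -> 0 < a -> slow_seq S ->
  (forall t u, 0 < t -> t <= u -> N12 u <= N12 t) ->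
  (forall e : R, 0 < e -> \forall m \near \oo, forall x, E ^+ m <= x <= E ^+ m.+1 ->
    (1 - e) * ((E - 1) / E) * S m <= Phi x <= (1 + e) * (E - 1) * S m) ->
  (0 < h)%N ->
  (forall m, stieltjes_sum N1 N2 (E ^+ h) E m <= N12 (E ^+ h ^+ 2 / E ^+ m.+1) /\
    N12 (E ^+ h ^+ 2 / E ^+ m) <= stieltjes_sum N1 N2 (E ^+ h) E m) ->
  stieltjes_sum N1 N2 (E ^+ h) E m / (E `^ a) ^+ m / S m @[m --> \oo] --> A ->
  exists2 M : R, 0 < M & forall e : R, 0 < e -> e <= 1 ->
    \forall t \near 0^'+, (1 - e) * M / (E `^ a) ^+ 2 <= N12 t * t `^ a / Phi (1 / t) <=
      (1 + e) * M * (E `^ a * E).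
Proof.
move=> E1 A0 a0 Ss N12mono PhiS h0 sandwich.
set rho := E `^ a; set U := stieltjes_sum _ _ _ _ => UA.
have E0 : 0 < E by lra.
have rho0 : 0 < rho by rewrite powR_gt0.
have S0 m : 0 < S m by case: Ss => ->.
have W k : U (l + k)%N / rho ^+ (l + k) / S l @[l --> \oo] --> A.
  have UAk : U (l + k)%N / rho ^+ (l + k) / S (l + k)%N @[l --> \oo] --> A.
    by rewrite (cvg_shiftn k (fun m => U m / rho ^+ m / S m)).
  apply: (near_eq_cvg_to (cvgM UAk (slow_seq_shift k Ss))); first by rewrite mulr1.
  near=> l; rewrite /=; field; rewrite ?gt_eqF//= ?exprn_gt0//.
exists (A * rho ^+ (2 * h) / (E - 1)).
  by rewrite divr_gt0 ?mulr_gt0 ?exprn_gt0// subr_gt0.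
(* Two relative errors [d] meet, one in the convolution and one in [Phi]; a quarter of [e] suffices
   for their quotient. *)
move=> e e0 e1; pose d := e / 4.
have d0 : 0 < d by rewrite divr_gt0.
have eE : e = 4 * d by rewrite /d; field.
have d4 : d <= 4^-1 by rewrite /d; lra.
have d1 : 0 < 1 - d by lra.
have dd : d * d <= 4^-1 * d by rewrite ler_pM2r.
have dd0 : 0 <= d * d by rewrite mulr_ge0 ?(ltW d0).
have arith_lo : (1 - e) * (1 + d) <= 1 - d by rewrite eE; lra.
have arith_hi : 1 + d <= (1 + e) * (1 - d) by rewrite eE; lra.
have dA0 : 0 < d * A by rewrite mulr_gt0.
have [L _ HL] : \forall l \near \oo,
    [/\ `|A - U (l + (2 * h).+1)%N / rho ^+ (l + (2 * h).+1) / S l| <= d * A,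
        `|A - U (l + (2 * h).-1)%N / rho ^+ (l + (2 * h).-1) / S l| <= d * A &
        forall x, E ^+ l <= x <= E ^+ l.+1 ->
    (1 - d) * ((E - 1) / E) * S l <= Phi x <= (1 + d) * (E - 1) * S l].
  near=> l; split; last by near: l; exact: PhiS.
    by near: l; have /cvgrPdist_le := W (2 * h).+1; exact.
  by near: l; have /cvgrPdist_le := W (2 * h).-1; exact.
have EL0 : 0 < (E ^+ L)^-1 by rewrite invr_gt0 exprn_gt0.
near=> t.
have t0 : 0 < t by near: t; exact: nbhs_right_gt.
have tL : E ^+ L <= 1 / t.
  by rewrite div1r -[leLHS]invrK lef_pV2 ?posrE// ltW//.
have [l Ll /[dup] lt /andP[lt1 lt2]] := expr_bracket E1 tL.
have [/ler_normlP[H1 _] /ler_normlP[_ H2] /(_ _ lt)/andP[Phi1 Phi2]] := HL l Ll.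
have El0 k : 0 < E ^+ k by rewrite exprn_gt0.
have rl0 k : 0 < rho ^+ k by rewrite exprn_gt0.
have E10 : 0 < E - 1 by rewrite subr_gt0.
have t1 : (E ^+ l.+1)^-1 <= t.
  by move: lt2; rewrite div1r => lt2; rewrite -[leRHS]invrK lef_pV2 ?posrE// invr_gt0.
have t2 : t <= (E ^+ l)^-1.
  by move: lt1; rewrite div1r => lt1; rewrite -[leLHS]invrK lef_pV2 ?posrE// invr_gt0.
have hE : E ^+ h ^+ 2 = E ^+ (2 * h) by rewrite -exprM mulnC.
have invpow k : ((E ^+ k)^-1) `^ a = (rho ^+ k)^-1.
  apply: (mulIf (lt0r_neq0 (rl0 k))); rewrite mulVf ?gt_eqF//.
  by rewrite -powR_exprn// -powRM ?mulVf ?powR1 ?gt_eqF// ?invr_ge0 ltW.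
have ta1 : (rho ^+ l.+1)^-1 <= t `^ a.
  by rewrite -invpow ge0_ler_powR// ?nnegrE ?ltW// invr_gt0.
have ta2 : t `^ a <= (rho ^+ l)^-1.
  by rewrite -invpow ge0_ler_powR// ?nnegrE ?ltW// invr_gt0.
(* For [1 / t] between [E ^+ l] and [E ^+ l.+1], the upper half of the sandwich is used at the
   threshold [E ^+ l.+1] inverted, the lower half at [E ^+ l] inverted. The latter is indexed by a
   successor, hence [(2 * h).-1] and the hypothesis [0 < h]. *)
have up : N12 t <= U (l + (2 * h).+1)%N.
  have [_ H] := sandwich (l + (2 * h).+1)%N; apply: le_trans H.
  apply: N12mono; first by rewrite divr_gt0// exprn_gt0.
  apply: le_trans t1; rewrite hE addnS -addSn addnC exprD invfM mulrA divff ?gt_eqF//.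
  by rewrite mul1r.
have lo : U (l + (2 * h).-1)%N <= N12 t.
  have [H _] := sandwich (l + (2 * h).-1)%N; apply: (le_trans H).
  apply: N12mono => //; apply: (le_trans t2).
  rewrite hE -addnS prednK ?muln_gt0// addnC exprD invfM mulrA divff ?gt_eqF//.
  by rewrite mul1r.
have Sl := S0 l.
have Phil : 0 < (1 - d) * ((E - 1) / E) * S l by rewrite !mulr_gt0// invr_gt0.
have Phi0 : 0 < Phi (1 / t) by exact: lt_le_trans Phi1.
have upA : U (l + (2 * h).+1)%N <= (1 + d) * A * (rho ^+ (l + (2 * h).+1) * S l).
  have : U (l + (2 * h).+1)%N / rho ^+ (l + (2 * h).+1) / S l <= (1 + d) * A by lra.
  by rewrite ler_pdivrMr// ler_pdivrMr// -mulrA (mulrC (S l)).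
have loA : (1 - d) * A * (rho ^+ (l + (2 * h).-1) * S l) <= U (l + (2 * h).-1)%N.
  have : (1 - d) * A <= U (l + (2 * h).-1)%N / rho ^+ (l + (2 * h).-1) / S l by lra.
  by rewrite ler_pdivlMr// ler_pdivlMr// -mulrA (mulrC (S l)).
have loA0 : 0 <= (1 - d) * A * (rho ^+ (l + (2 * h).-1) * S l).
  by rewrite ltW// !mulr_gt0.
have N0 : 0 <= N12 t by apply: le_trans lo; exact: le_trans loA.
have M0 : 0 < A * rho ^+ (2 * h) / (E - 1) by rewrite divr_gt0// mulr_gt0.
apply/andP; split.
  rewrite ler_pdivlMr//.
  apply: (@le_trans _ _ ((1 - d) * A * (rho ^+ (l + (2 * h).-1) * S l) * (rho ^+ l.+1)^-1)).
    apply: (@le_trans _ _ ((1 - e) * (A * rho ^+ (2 * h) / (E - 1)) / rho ^+ 2 *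
        ((1 + d) * (E - 1) * S l))).
      apply: ler_wpM2l Phi2; rewrite divr_ge0//; last exact: ltW.
      by rewrite mulr_ge0 ?subr_ge0// ltW.
    have -> : (1 - d) * A * (rho ^+ (l + (2 * h).-1) * S l) / rho ^+ l.+1 =
        (1 - d) * (A * rho ^+ (2 * h) / rho ^+ 2 * S l).
      have -> : (2 * h = (2 * h).-1.+1)%N by rewrite prednK ?muln_gt0.
      by rewrite /= exprD !exprS expr0; field; rewrite !gt_eqF.
    have -> : (1 - e) * (A * rho ^+ (2 * h) / (E - 1)) / rho ^+ 2 *
        ((1 + d) * (E - 1) * S l) = (1 - e) * (1 + d) * (A * rho ^+ (2 * h) / rho ^+ 2 * S l).
      by field; rewrite !gt_eqF.
    by rewrite ler_pM2r// mulr_gt0// divr_gt0// mulr_gt0.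
  by apply: ler_pM => //; [rewrite invr_ge0 ltW|exact: le_trans lo].
rewrite ler_pdivrMr//.
apply: (@le_trans _ _ ((1 + d) * A * (rho ^+ (l + (2 * h).+1) * S l) / rho ^+ l)).
  by apply: ler_pM => //; [exact: powR_ge0|exact: le_trans upA].
apply: (@le_trans _ _ ((1 + e) * (A * rho ^+ (2 * h) / (E - 1)) * (rho * E) *
    ((1 - d) * ((E - 1) / E) * S l))); last first.
  apply: ler_wpM2l Phi1.
  by apply: mulr_ge0; apply: mulr_ge0; [rewrite addr_ge0// ltW|exact: ltW|exact: ltW|exact: ltW].
have -> : (1 + d) * A * (rho ^+ (l + (2 * h).+1) * S l) / rho ^+ l =
    (1 + d) * (A * rho ^+ (2 * h) * rho * S l).
  by rewrite exprD exprS; field; rewrite !gt_eqF.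
have -> : (1 + e) * (A * rho ^+ (2 * h) / (E - 1)) * (rho * E) *
    ((1 - d) * ((E - 1) / E) * S l) = (1 + e) * (1 - d) * (A * rho ^+ (2 * h) * rho * S l).
  by field; rewrite !gt_eqF.
by rewrite ler_pM2r// !mulr_gt0.
Unshelve. all: by end_near. Qed.

End Bracketing.

(** * Refining the mesh *)

Section Limit.
Variable R : realType.
Implicit Types (N phi s : R -> R) (E c p T : R).

(** Each mesh confines the quotient near [0^'+] to a band around an unidentified [M]. The relative
    width of the band tends to 0 and its position stays bounded, so the quotient has a limit; the
    band for [n = 1] keeps this limit away from zero. *)
Lemma stieltjes_asymptotics N1 N2 N12 phi1 phi2 s1 s2 p T1 T2 (C0 : R) :
  0 < p -> slowly_varying phi1 -> C2_slow phi1 -> slowly_varying phi2 -> C2_slow phi2 ->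
  periodic_factor p T1 s1 -> periodic_factor p T2 s2 ->
  N1 ~_(0^'+) (fun t => phi1 (1 / t) * s1 (ln (1 / t)) / t `^ (1 / p)) ->
  N2 ~_(0^'+) (fun t => phi2 (1 / t) * s2 (ln (1 / t)) / t `^ (1 / p)) ->
  (\int[lebesgue_measure]_(x in `[1%R, +oo[) (phi1 x / x)%:E = +oo)%E ->
  (\int[lebesgue_measure]_(x in `[1%R, +oo[) (phi2 x / x)%:E = +oo)%E ->
  irrational (T1 / T2) ->
  (forall t u, 0 < t -> t <= u -> N12 u <= N12 t) ->
  (forall c E m, C0 <= c -> 1 < E ->
    stieltjes_sum N1 N2 c E m <= N12 (c ^+ 2 / E ^+ m.+1) /\
    N12 (c ^+ 2 / E ^+ m) <= stieltjes_sum N1 N2 c E m) ->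
  exists2 A : R, 0 < A &
    N12 t * t `^ (1 / p) / mellin_conv phi1 phi2 (1 / t) @[t --> 0^'+] --> A.
Proof.
move=> p0 sv1 C21 sv2 C22 ps1 ps2 N1h N2h dv1 dv2 irr N12mono sandwich.
have [T10 _ _ _ _] := ps1.
have a0 : 0 < 1 / p by rewrite divr_gt0.
pose Psi t := N12 t * t `^ (1 / p) / mellin_conv phi1 phi2 (1 / t).
(* The threshold must exceed [C0] and also be a power of every [expR (T1 / n%:R)]; the exponential
   of a multiple of [T1] does both, with exponent [B * n]. *)
pose B := (Num.truncn (C0 / T1)).+1.
have CB : C0 <= expR (B%:R * T1).
  apply: le_trans (expR_ge1Dx _); rewrite -lerBlDl.
  by apply: (@le_trans _ _ C0); [lra|rewrite -ler_pdivrMr// ltW// truncnS_gt].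
have bracket n : (0 < n)%N -> exists2 M : R, 0 < M & forall e : R, 0 < e -> e <= 1 ->
    \forall t \near 0^'+, (1 - e) * M / (expR (T1 / n%:R) `^ (1 / p)) ^+ 2 <= Psi t <=
      (1 + e) * M * (expR (T1 / n%:R) `^ (1 / p) * expR (T1 / n%:R)).
  move=> n0; have [A A0 UA] := stieltjes_sum_cvg B p0 sv1 C21 sv2 C22 ps1 ps2
    N1h N2h dv1 dv2 irr n0.
  have n0R : (0 : R) < n%:R by rewrite ltr0n.
  have E1 : 1 < expR (T1 / n%:R) by rewrite expR_gt1 divr_gt0.
  have cE : expR (B%:R * T1) = expR (T1 / n%:R) ^+ (B * n).
    by rewrite -expRM_natl natrM; congr expR; field; rewrite gt_eqF.
  move: CB UA; rewrite cE.
  move: (expR (T1 / n%:R)) E1 => E E1 CB UA.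
  have Qs := slow_seq_of_slowly_varying sv1 C21 E1 dv1.
  have Ps := slow_seq_of_slowly_varying sv2 C22 E1 dv2.
  have h0 : (0 < B * n)%N by rewrite muln_gt0.
  have mb (e : R) (e0 : 0 < e) := mellin_dconv sv1 C21 sv2 C22 E1 Qs Ps e0.
  exact: (stieltjes_bracket E1 A0 a0 (slow_seq_dconv Ps Qs) N12mono mb h0
    (fun m => sandwich _ E m CB E1) UA).
have [M1 M10 HM1] := bracket 1%N isT.
have one2 : (0 : R) < 2^-1 by rewrite invr_gt0.
have half1 : 2^-1 <= 1 :> R by rewrite invf_le1// ler1n.
have Hlo := HM1 _ one2 half1.
set b1 := expR (T1 / 1%:R) in Hlo; have b10 : 0 < b1 by exact: expR_gt0.
have rb10 : 0 < b1 `^ (1 / p) by rewrite powR_gt0.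
pose BB := (1 + 2^-1) * M1 * (b1 `^ (1 / p) * b1).
have BB0 : 0 < BB by rewrite !mulr_gt0// addr_gt0.
have [A PsiA] : exists A : R, Psi t @[t --> 0^'+] --> A.
  apply: cvg_near_eps => e0 e00.
  (* The quotient of the two bounds is [(1 + e) / (1 - e) * rho ^+ 3 * E], with [rho ^+ 3 * E]
     tending to 1 as the mesh [T1 / n] tends to 0. *)
  pose eta := e0 / BB; have eta0 : 0 < eta by rewrite divr_gt0.
  (* For [e <= 1 / 2] one has [(1 + e) / (1 - e) <= 1 + 4 * e] and
     [(1 + 4 * e) * (1 + e) <= 1 + 7 * e], hence the 7. *)
  pose e := Num.min 2^-1 (eta / 7).
  have e_gt0 : 0 < e by rewrite lt_min one2 divr_gt0.
  have e_half : e <= 2^-1 by rewrite ge_min lexx.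
  have e_eta : 7 * e <= eta by rewrite mulrC -ler_pdivlMr// ge_min lexx orbT.
  have e_le1 : e <= 1 by apply: le_trans e_half half1.
  have ln0 : 0 < ln (1 + e) by rewrite ln_gt0// ltrDl.
  (* With [E = expR (T1 / n%:R)] and [rho] its power [1 / p], [rho ^+ 3 * E] is
     [expR (k / n%:R)]. *)
  pose k := (3 * (1 / p) + 1) * T1.
  pose n := (Num.truncn (k / ln (1 + e))).+1.
  have n0R : (0 : R) < n%:R by rewrite ltr0n.
  have kn : expR (k / n%:R) <= 1 + e.
    rewrite -[leRHS]lnK ?posrE ?addr_gt0// ler_expR.
    by rewrite ler_pdivrMr// mulrC -ler_pdivrMr// ltW// truncnS_gt.
  have [M M0 /(_ e e_gt0 e_le1) HM] := bracket n isT.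
  have rE : (expR (T1 / n%:R) `^ (1 / p)) ^+ 3 * expR (T1 / n%:R) <= 1 + e.
    apply: le_trans kn; rewrite /powR gt_eqF ?expR_gt0// expRK -expRM_natl -expRD.
    by rewrite le_eqVlt; apply/orP; left; apply/eqP; congr expR; rewrite /k; ring.
  move: (expR (T1 / n%:R)) (expR_gt0 (T1 / n%:R)) HM rE => E E0.
  move: (E `^ (1 / p)) (powR_gt0 (1 / p) E0) => rho rho0 HM rE.
  pose lo := (1 - e) * M / rho ^+ 2.
  (* Both bounds hold for the same small [t], so every lower bound lies below the upper bound of the
     mesh [n = 1]. This uniform bound turns the relative width [eta] into the absolute width
     [e0]. *)
  have loBB : lo <= BB.
    have : \forall t \near (0 : R)^'+, lo <= BB.
      by apply: filterS2 HM Hlo => t /andP[t1 _] /andP[_]; exact: le_trans.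
    by move=> /filter_ex[].
  have e1 : 0 < 1 - e by rewrite subr_gt0 (le_lt_trans e_half)// invf_lt1// ltr1n.
  have lo0 : 0 < lo by rewrite divr_gt0 ?mulr_gt0// exprn_gt0.
  exists lo; apply: filterS HM => t /andP[t1 t2].
  rewrite ger0_norm ?subr_ge0//.
  apply: (@le_trans _ _ (lo * eta)); last first.
    by rewrite /eta mulrA ler_pdivrMr// mulrC ler_pM2l.
  rewrite lerBlDl; apply: (le_trans t2).
  have -> : (1 + e) * M * (rho * E) = lo * ((1 + e) / (1 - e) * (rho ^+ 3 * E)).
    by rewrite /lo; field; rewrite !gt_eqF.
  rewrite -{2}(mulr1 lo) -mulrDr ler_pM2l//.
  apply: (@le_trans _ _ ((1 + 4 * e) * (1 + e))); last first.
    have : e * e <= 2^-1 * e by rewrite ler_pM2r.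
    lra.
  apply: ler_pM => //.
  - by rewrite divr_ge0 ?ltW// addr_gt0.
  - by rewrite mulr_ge0 ?exprn_ge0 ?ltW.
  - rewrite ler_pdivrMr//; have : e * e <= 2^-1 * e by rewrite ler_pM2r.
    lra.
exists A => //.
apply: (@lt_le_trans _ _ ((1 - 2^-1) * M1 / b1 `^ (1 / p) ^+ 2)).
  by rewrite divr_gt0 ?exprn_gt0// mulr_gt0//; lra.
by apply: (cvgr_to_ge PsiA); apply: filterS Hlo => t /andP[].
Qed.

End Limit.

(** * Counting functions *)

Section Counting.
Variable R : realType.

(** Any index type is allowed, so that the products of two families are counted over pairs without
    being sorted. *)
Definition value_count (I : choiceType) (lam : I -> R) (t : R) : nat :=
  #|` fset_set [set i | t < lam i]|.

Lemma card_fset_set_count (I : choiceType) (p : pred I) (s : seq I) : uniq s ->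
  (forall i, p i -> i \in s) -> #|` fset_set [set i | p i]| = count p s.
Proof.
move=> us ps.
have -> : [set i | p i] = [set` [fset i in seq.filter p s]%fset].
  apply/seteqP; split => i /=; rewrite inE mem_filter; last by case/andP.
  by move=> pi; rewrite pi ps.
by rewrite set_fsetK card_fseq undup_id ?size_filter// filter_uniq.
Qed.

Lemma value_count_sum (I : choiceType) (lam : I -> R) (t : R) (s : seq I) : uniq s ->
  (forall i, t < lam i -> i \in s) -> (value_count lam t)%:R = \sum_(i <- s) (t < lam i)%R%:R :> R.
Proof.
move=> us ps; rewrite /value_count (card_fset_set_count us ps) -sum1_count big_mkcond/=.
by rewrite natr_sum; apply: eq_bigr => i _; case: ifP.
Qed.

Lemma value_count_mono (I : choiceType) (lam : I -> R) (s t : R) : s <= t ->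
  finite_set [set i | s < lam i] -> (value_count lam t <= value_count lam s)%N.
Proof.
move=> st fin; have sub : [set i | t < lam i] `<=` [set i | s < lam i].
  by move=> i /=; exact: le_lt_trans.
by apply: fsubset_leq_card; rewrite -fset_set_sub//; exact: sub_finite_set fin.
Qed.

(** The contribution of one pair of eigenvalues. As [x <= c], some grid interval
    [c / E ^+ k.+1 < x <= c / E ^+ k] contains [x], and then a product above [c ^+ 2 / E ^+ m]
    forces [y] above [c / E ^+ (m - k)]. *)
Lemma stieltjes_sum_indicator_ge (c E x y : R) m : 0 < c -> 1 < E ->
  0 <= x <= c -> 0 <= y <= c ->
  (c ^+ 2 / E ^+ m < x * y)%R%:R <= \sum_(k < m.+1) (c / E ^+ (m - k) < y)%R%:R *
    ((c / E ^+ k.+1 < x)%R%:R - (c / E ^+ k < x)%R%:R) :> R.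
Proof.
move=> c0 E1 /andP[x0 xc] /andP[y0 yc]; have E0 : 0 < E by lra.
have El0 k : 0 < E ^+ k by rewrite exprn_gt0.
have d0 k : 0 <= (c / E ^+ k.+1 < x)%R%:R - (c / E ^+ k < x)%R%:R :> R.
  rewrite subr_ge0 ler_nat; case: (ltP (c / E ^+ k) x) => // h.
  rewrite (_ : _ < _ = true)//; apply: le_lt_trans h; rewrite ler_pM2l//.
  by rewrite lef_pV2 ?posrE// ler_weXn2l ?ltW.
have t0 (k : 'I_m.+1) : 0 <= (c / E ^+ (m - k) < y)%R%:R *
    ((c / E ^+ k.+1 < x)%R%:R - (c / E ^+ k < x)%R%:R) :> R by rewrite mulr_ge0.
have [h|_] := ltP (c ^+ 2 / E ^+ m) (x * y); last exact: sumr_ge0.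
have xgt : c / E ^+ m < x.
  rewrite -(ltr_pM2l c0) mulrA -expr2; apply: (lt_le_trans h).
  by rewrite mulrC ler_wpM2r.
have x_gt0 : 0 < x by apply: lt_trans xgt; rewrite divr_gt0.
have [k /and3P[km xk1 xk2]] : exists k : nat,
    [&& (k < m)%N, x <= c / E ^+ k & c / E ^+ k.+1 < x].
  have ex : exists k, c / E ^+ k.+1 < x.
    exists m; apply: le_lt_trans xgt; rewrite ler_pM2l// lef_pV2 ?posrE//.
    by rewrite ler_weXn2l ?ltW.
  case: (ex_minnP ex) => k xk kmin; exists k; rewrite xk andbT.
  case: m {t0 h} xgt => [|m] xgt.
    by move: xgt; rewrite expr0 divr1 ltNge xc.
  rewrite ltnS kmin//=; case: k xk kmin => [|k] xk kmin; first by rewrite expr0 divr1.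
  by rewrite leNgt; apply/negP => /kmin; rewrite ltnn.
have km1 : (k < m.+1)%N by exact: ltnW.
rewrite (bigD1 (Ordinal km1))//= -[leLHS]addr0 lerD//; last by apply: sumr_ge0.
rewrite xk2 (ltNge _ x) xk1 subr0 mulr1 ler_nat lt0b.
rewrite -(ltr_pM2r x_gt0) mulrC (mulrC y); apply: le_lt_trans h.
apply: (@le_trans _ _ (c / E ^+ k * (c / E ^+ (m - k)))).
  by rewrite ler_pM2r// divr_gt0.
rewrite (_ : E ^+ m = E ^+ k * E ^+ (m - k)); last by rewrite -exprD subnKC// ltnW.
by rewrite le_eqVlt; apply/orP; left; apply/eqP; field; rewrite !gt_eqF.
Qed.

(** The increments telescope to at most 1. A nonzero term has [x] above [c / E ^+ k.+1] and [y]
    above [c / E ^+ (m - k)]; the exponents add up to [m.+1], which is the loss of one grid step. *)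
Lemma stieltjes_sum_indicator_le (c E x y : R) m : 0 < c -> 1 < E ->
  0 <= x <= c -> 0 <= y <= c ->
  \sum_(k < m.+1) (c / E ^+ (m - k) < y)%R%:R *
    ((c / E ^+ k.+1 < x)%R%:R - (c / E ^+ k < x)%R%:R) <= (c ^+ 2 / E ^+ m.+1 < x * y)%R%:R :> R.
Proof.
move=> c0 E1 /andP[x0 xc] /andP[y0 yc]; have E0 : 0 < E by lra.
have El0 k : 0 < E ^+ k by rewrite exprn_gt0.
have d0 k : 0 <= (c / E ^+ k.+1 < x)%R%:R - (c / E ^+ k < x)%R%:R :> R.
  rewrite subr_ge0 ler_nat; case: (ltP (c / E ^+ k) x) => // h.
  rewrite (_ : _ < _ = true)//; apply: le_lt_trans h; rewrite ler_pM2l//.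
  by rewrite lef_pV2 ?posrE// ler_weXn2l ?ltW.
have [h|h] := ltP (c ^+ 2 / E ^+ m.+1) (x * y).
  apply: (@le_trans _ _ (\sum_(k < m.+1)
      ((c / E ^+ k.+1 < x)%R%:R - (c / E ^+ k < x)%R%:R))).
    by apply: ler_sum => k _; rewrite ler_piMl//; case: (_ < y).
  rewrite -(big_mkord xpredT (fun k => (c / E ^+ k.+1 < x)%R%:R - (c / E ^+ k < x)%R%:R)).
  rewrite telescope_sumr// lerBlDr.
  by case: (_ < x) => /=; rewrite ?mulr1n ?mulr0n ?lerDl ?addr_ge0.
rewrite big1// => k _; apply/eqP; rewrite mulf_eq0; apply/orP.
have [yk|] := ltP (c / E ^+ (m - k)) y; last by left.
right; have [xk|xk] := ltP (c / E ^+ k.+1) x; last first.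
  rewrite [X in _ - X](_ : _ = 0) ?subr0//.
  rewrite ltNge (le_trans xk)//= ler_pM2l// lef_pV2 ?posrE//.
  by rewrite ler_weXn2l ?ltW.
exfalso; move: h; apply/negP; rewrite -ltNge.
apply: (@le_lt_trans _ _ (c / E ^+ k.+1 * (c / E ^+ (m - k)))).
  rewrite (_ : E ^+ m.+1 = E ^+ k.+1 * E ^+ (m - k)); last first.
    by rewrite -exprD addSn subnKC// -ltnS.
  by rewrite le_eqVlt; apply/orP; left; apply/eqP; field; rewrite !gt_eqF.
by apply: ltr_pM => //; rewrite ltW// divr_gt0.
Qed.

Lemma value_count_mul_sandwich (I J : choiceType) (lam : I -> R) (mu : J -> R) (c E : R) m :
  0 < c -> 1 < E -> (forall i, 0 <= lam i <= c) -> (forall j, 0 <= mu j <= c) ->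
  (forall t, 0 < t -> finite_set [set i | t < lam i]) ->
  (forall t, 0 < t -> finite_set [set j | t < mu j]) ->
  let N1 t := (value_count lam t)%:R : R in
  let N2 t := (value_count mu t)%:R : R in
  let N12 t := (value_count (fun x : I * J => lam x.1 * mu x.2) t)%:R : R in
  stieltjes_sum N1 N2 c E m <= N12 (c ^+ 2 / E ^+ m.+1) /\
    N12 (c ^+ 2 / E ^+ m) <= stieltjes_sum N1 N2 c E m.
Proof.
move=> c0 E1 lamc muc lamfin mufin N1 N2 N12; have E0 : 0 < E by lra.
have El0 k : 0 < E ^+ k by rewrite exprn_gt0.
have cE0 : 0 < c / E ^+ m.+1 by rewrite divr_gt0.
(* These finite lists contain all indices that matter: since both families are bounded by [c], a
   product above [c ^+ 2 / E ^+ k] has both factors above [c / E ^+ k]. *)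
pose s1 : seq I := fset_set [set i | c / E ^+ m.+1 < lam i].
pose s2 : seq J := fset_set [set j | c / E ^+ m.+1 < mu j].
have mono k : (k <= m.+1)%N -> c / E ^+ m.+1 <= c / E ^+ k.
  by move=> km; rewrite ler_pM2l// lef_pV2 ?posrE// ler_weXn2l ?ltW.
have s1P i t : c / E ^+ m.+1 <= t -> t < lam i -> i \in s1.
  move=> ct ti; rewrite /s1 in_fset_set; last exact: lamfin.
  by apply: mem_set; exact: le_lt_trans ti.
have s2P i t : c / E ^+ m.+1 <= t -> t < mu i -> i \in s2.
  move=> ct ti; rewrite /s2 in_fset_set; last exact: mufin.
  by apply: mem_set; exact: le_lt_trans ti.
have N1E k : (k <= m.+1)%N -> N1 (c / E ^+ k) = \sum_(i <- s1) (c / E ^+ k < lam i)%R%:R.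
  move=> km; apply: value_count_sum; first exact: fset_uniq.
  by move=> i; apply: s1P; exact: mono.
have N2E k : (k <= m.+1)%N -> N2 (c / E ^+ k) = \sum_(i <- s2) (c / E ^+ k < mu i)%R%:R.
  move=> km; apply: value_count_sum; first exact: fset_uniq.
  by move=> i; apply: s2P; exact: mono.
pose s12 := [seq (i, j) | i <- s1, j <- s2].
have us12 : uniq s12.
  by apply: allpairs_uniq; [exact: fset_uniq|exact: fset_uniq|move=> [? ?] [? ?]].
have N12E k : (k <= m.+1)%N -> N12 (c ^+ 2 / E ^+ k) =
    \sum_(i <- s1) \sum_(j <- s2) (c ^+ 2 / E ^+ k < lam i * mu j)%R%:R.
  move=> km; rewrite /N12 (@value_count_sum _ _ _ s12)// ?big_allpairs//.
  move=> [i j] /= h; have /andP[l0 lc] := lamc i; have /andP[m0 mc] := muc j.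
  apply/allpairsP; exists (i, j); split => //=.
    apply: (s1P _ (c / E ^+ k)); first exact: mono.
    rewrite -(ltr_pM2l c0) mulrA -expr2; apply: (lt_le_trans h).
    by rewrite mulrC ler_wpM2r.
  apply: (s2P _ (c / E ^+ k)); first exact: mono.
  rewrite -(ltr_pM2l c0) mulrA -expr2; apply: (lt_le_trans h).
  by rewrite ler_wpM2r.
have SE : stieltjes_sum N1 N2 c E m = \sum_(i <- s1) \sum_(j <- s2)
    \sum_(k < m.+1) (c / E ^+ (m - k) < mu j)%R%:R *
    ((c / E ^+ k.+1 < lam i)%R%:R - (c / E ^+ k < lam i)%R%:R).
  under eq_bigr do rewrite exchange_big/=.
  rewrite exchange_big/=; apply: eq_bigr => k _.
  have km : (k <= m)%N by rewrite -ltnS.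
  rewrite N2E ?N1E ?(leqW km)//; last by rewrite (leq_trans (leq_subr _ _)).
  rewrite -sumrB mulr_sumr; apply: eq_bigr => i _.
  by rewrite mulr_suml.
split.
  rewrite SE N12E//; apply: ler_sum => i _; apply: ler_sum => j _.
  exact: stieltjes_sum_indicator_le.
rewrite SE N12E//; apply: ler_sum => i _; apply: ler_sum => j _.
exact: stieltjes_sum_indicator_ge.
Qed.

End Counting.

(** * Nonincreasing rearrangement of a family *)

Section Sorting.
Local Open Scope card_scope.
Variable R : realType.

(** The right-hand side is a model that depends on the multiplicities alone, so families with equal
    multiplicities have equipotent superlevel sets. *)
Lemma card_superlevel (I : Type) (lam : I -> R) (n : R -> nat) (t : R) : 0 <= t ->
  (forall mu, 0 < mu -> [set i | lam i = mu] #= `I_(n mu)) ->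
  [set i | t < lam i] #= [set x : R * nat | t < x.1 /\ (x.2 < n x.1)%N].
Proof.
move=> t0 fib.
have [g gP] : exists g : R -> I -> nat, forall mu, 0 < mu ->
    set_bij [set i | lam i = mu] `I_(n mu) (g mu).
  have H mu : exists g : I -> nat, 0 < mu -> set_bij [set i | lam i = mu] `I_(n mu) g.
    have [mu0|_] := ltP 0 mu; last by exists (fun=> 0%N).
    by have /pcard_eqP/bijPex[g gP] := fib _ mu0; exists g.
  by have [g gP] := choice H; exists g.
apply/pcard_eqP/bijPex; exists (fun i => (lam i, g (lam i) i)); split.
- move=> i /= ti; split=> //; have [gf _ _] := gP _ (le_lt_trans t0 ti).
  exact: (gf i).
- move=> i j /set_mem/= ti _ [lij gij].
  have [_ ginj _] := gP _ (le_lt_trans t0 ti).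
  apply: ginj; rewrite ?inE//; first exact: mem_set; first exact: mem_set.
  by rewrite gij lij.
- move=> [mu k] /= [tmu kn]; have [_ _ gsurj] := gP _ (le_lt_trans t0 tmu).
  have [i /= li gi] := gsurj k kn.
  by exists i => /=; rewrite li ?gi.
Qed.

Lemma value_count_eq (I J : choiceType) (lam : I -> R) (mu : J -> R) (n : R -> nat) (t : R) :
  0 <= t -> finite_set [set i | t < lam i] ->
  (forall x, 0 < x -> [set i | lam i = x] #= `I_(n x)) ->
  (forall x, 0 < x -> [set j | mu j = x] #= `I_(n x)) ->
  value_count mu t = value_count lam t.
Proof.
move=> t0 fin lamn mun.
have eq_ml : [set j | t < mu j] #= [set i | t < lam i].
  apply: card_eq_trans (card_superlevel t0 mun) _.
  by rewrite card_eq_sym; exact: card_superlevel.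
have fin' : finite_set [set j | t < mu j].
  by have [m lm] := fin; exists m; exact: card_eq_trans lm.
exact/(fcard_eq fin' fin).
Qed.

(** Right continuity of the counting function: by finiteness it is constant just above [t]. *)
Lemma value_gap_right (I : choiceType) (lam : I -> R) (t : R) :
  finite_set [set i | t < lam i] ->
  exists2 s, t < s & forall i, t < lam i -> s < lam i.
Proof.
move=> fin; pose F : seq I := fset_set [set i | t < lam i].
pose s0 := \big[Order.min/(t + 1)]_(i <- F) lam i.
have ts0 : t < s0.
  rewrite /s0 big_seq; elim/big_ind: _ => [|x y tx ty|i]; first by rewrite ltrDl.
    by rewrite lt_min tx ty.
  by rewrite in_fset_set// => /set_mem.
exists ((t + s0) / 2); first by lra.
move=> i ti; have : s0 <= lam i.
  have : i \in F by rewrite in_fset_set//; exact: mem_set.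
  rewrite /s0; elim: (F) => // j F' IH; rewrite inE big_cons ge_min => /orP[/eqP ->|/IH ->].
    by rewrite lexx.
  by rewrite orbT.
by lra.
Qed.

Lemma value_gap_left (I : choiceType) (lam : I -> R) (mu : R) : 0 < mu ->
  (forall t, 0 < t -> finite_set [set i | t < lam i]) ->
  exists s, 0 < s < mu /\ forall i, s < lam i -> mu <= lam i.
Proof.
move=> mu0 fin; have mu2 : 0 < mu / 2 by rewrite divr_gt0.
pose F : seq I := fset_set [set i | mu / 2 < lam i].
pose s0 := \big[Order.max/(mu / 2)]_(i <- F | lam i < mu) lam i.
have s0mu : s0 < mu.
  rewrite /s0; elim/big_ind: _ => [|x y tx ty|//]; first by lra.
  by rewrite gt_max tx ty.
have s02 : mu / 2 <= s0.
  rewrite /s0; elim: (F) => [|j F' IH]; first by rewrite big_nil.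
  by rewrite big_cons; case: ifP => // _; rewrite le_max IH orbT.
exists s0; split; first by rewrite s0mu andbT; lra.
move=> i si; rewrite leNgt; apply/negP => imu.
have iF : i \in F.
  by rewrite in_fset_set; [apply: mem_set => /=; lra|exact: fin].
move: si; rewrite ltNge => /negP; apply; move: iF.
rewrite /s0; elim: (F) => // j F' IH; rewrite inE big_cons => /orP[/eqP <-|/IH h].
  by rewrite imu le_max lexx.
by case: ifP => // _; rewrite le_max h orbT.
Qed.

Lemma card_itv_nat (a n : nat) : [set j | (a <= j < a + n)%N] #= `I_n.
Proof.
apply/pcard_eqP/bijPex; exists (fun j => j - a)%N; split.
- by move=> j /= /andP[aj jn]; rewrite ltn_subLR.
- move=> i j /set_mem/= /andP[ai _] /set_mem/= /andP[aj _] ij.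
  by rewrite -(subnK ai) -(subnK aj) ij.
- move=> k /= kn; exists (a + k)%N => /=; first by rewrite leq_addr ltn_add2l.
  by rewrite addKn.
Qed.

(** The sequence is the generalized inverse of the counting function [N], characterized for [t > 0]
    by [t < l j] if and only if [j < N t]. Adjoining 0 to [X j] supplies the trailing zeros of a
    finite family. *)
Lemma sorting (I : choiceType) (lam : I -> R) :
  (forall t, 0 < t -> finite_set [set i | t < lam i]) ->
  exists l : nat -> R,
    [/\ {homo l : m n / (m <= n)%N >-> n <= m}, (forall n, 0 <= l n) &
        forall mu, 0 < mu -> [set j | l j = mu] #= `I_#|` fset_set [set i | lam i = mu]|].
Proof.
move=> fin; pose N := value_count lam.
have Nmono s t : 0 < s -> s <= t -> (N t <= N s)%N.
  by move=> s0 st; apply: value_count_mono => //; exact: fin.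
pose X j := [set t | t = 0 \/ (0 < t /\ (j < N t)%N)].
have X0 j : X j 0 by left.
have [B HB] : exists B, forall i, lam i <= B.
  have [s s1 Hs] : exists2 s : R, 1 < s & forall i, lam i <= s.
    pose F : seq I := fset_set [set i | 1 < lam i].
    exists (\big[Order.max/2]_(i <- F) lam i).
      elim: (F) => [|j F' IH]; first by rewrite big_nil ltr1n.
      by rewrite big_cons lt_max IH orbT.
    move=> i; have [i1|i1] := ltP 1 (lam i); last first.
      apply: (le_trans i1); elim: (F) => [|j F' IH]; first by rewrite big_nil ler1n.
      by rewrite big_cons le_max IH orbT.
    have : i \in F by rewrite in_fset_set; [exact: mem_set|exact: fin].
    elim: (F) => // j F' IH; rewrite inE big_cons le_max => /orP[/eqP ->|/IH ->].
      by rewrite lexx.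
    by rewrite orbT.
  by exists s.
have Xub j : has_ubound (X j).
  exists (Num.max 0 B) => t [->|[t0 jt]]; first by rewrite le_max lexx.
  rewrite le_max; apply/orP; right.
  rewrite leNgt; apply/negP => Bt; move: jt.
  rewrite /N /value_count (_ : [set i | t < lam i] = set0) ?fset_set0 ?cardfs0//.
  by apply/seteqP; split => i //= ti; have := HB i; lra.
have Xsup j : has_sup (X j) by split; [exists 0|].
pose l j := sup (X j).
have lP t j : 0 < t -> (t < l j) = (j < N t)%N.
  move=> t0; apply/idP/idP.
    move=> /(@sup_gt _ (X j)); case; first by exists 0.
    move=> s [->|[s0 js]]; first by move=> /(lt_trans t0); rewrite ltxx.
    by move=> ts; apply: leq_trans js _; apply: Nmono => //; exact: ltW.
  move=> jt; have [s ts Hs] := value_gap_right (fin _ t0).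
  apply: (lt_le_trans ts); apply: ub_le_sup => //; right; split; first exact: lt_trans ts.
  apply: leq_trans jt _; apply: fsubset_leq_card; rewrite -fset_set_sub.
  - by move=> i /= /Hs.
  - exact: fin.
  - by apply: fin; exact: lt_trans ts.
have l0 n : 0 <= l n by apply: ub_le_sup.
exists l; split => // [m n mn|mu mu0].
  rewrite leNgt; apply/negP => lmn.
  have [m0|m0] := leP (l m) 0.
    have h0 : 0 < (l m + l n) / 2 by have := l0 m; lra.
    have := lP _ n h0; have := lP _ m h0.
    rewrite (_ : _ < l m = false); last by apply/negbTE; rewrite -leNgt; lra.
    rewrite (_ : _ < l n = true); last by lra.
    move=> /esym/negbT; rewrite -leqNgt => h1 /esym h2.
    by move: (leq_ltn_trans mn h2); rewrite ltnNge h1.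
  have := lP _ n m0; rewrite lmn => /esym nN.
  have := lP _ m m0; rewrite ltxx => /esym/negP; apply.
  exact: leq_ltn_trans nN.
have [s [/andP[s0 smu] Hs]] := value_gap_left mu0 fin.
have finmu : finite_set [set i | lam i = mu].
  apply: sub_finite_set (fin _ s0) => i /= ->.
  exact: smu.
have Ns : N s = (N mu + #|` fset_set [set i | lam i = mu]|)%N.
  rewrite /N /value_count (_ : [set i | s < lam i] = [set i | mu < lam i] `|` [set i | lam i = mu]).
    rewrite fset_setU//; last exact: fin.
    rewrite cardfsU -[RHS]subn0; congr (_ - _)%N.
    apply/eqP; rewrite cardfs_eq0 -fset_setI//; last exact: fin.
    rewrite (_ : _ `&` _ = set0) ?fset_set0//.
    by apply/seteqP; split => i //= [+ e]; rewrite e ltxx.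
  apply/seteqP; split => i /=.
    by move=> /Hs; rewrite le_eqVlt => /orP[/eqP ->|]; [right|left].
  by case=> [|->//]; exact: lt_trans.
(* No value lies strictly between [s] and [mu], so the jump of [N] there is the multiplicity of
   [mu], and the indices with [l j = mu] fill the interval of that length starting at [N mu]. *)
rewrite (_ : [set j | l j = mu] =
    [set j | (N mu <= j < N mu + #|` fset_set [set i | lam i = mu]|)%N]).
  exact: card_itv_nat.
rewrite -Ns; apply/seteqP; split => j /=.
  by move=> lj; rewrite leqNgt -!lP// lj ltxx smu.
rewrite leqNgt -lP// => /andP[jmu js].
apply/eqP; rewrite eq_le; apply/andP; split; first by rewrite leNgt.
rewrite leNgt; apply/negP => ljmu.
(* A point above [s] and [l j] but below [mu]: the gap gives [j < N s <= N u], hence [u < l j], a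
   contradiction. *)
pose u := (Num.max s (l j) + mu) / 2.
have mx1 : s <= Num.max s (l j) by rewrite le_max lexx.
have mx2 : l j <= Num.max s (l j) by rewrite le_max lexx orbT.
have mx3 : Num.max s (l j) < mu by rewrite gt_max smu.
have u0 : 0 < u by rewrite /u; lra.
have : (j < N u)%N.
  apply: leq_trans js _; apply: fsubset_leq_card; rewrite -fset_set_sub.
  - by move=> i /= /Hs; apply: lt_le_trans; rewrite /u; lra.
  - exact: fin.
  - exact: fin.
by rewrite -lP//; apply/negP; rewrite -leNgt /u; lra.
Qed.

End Sorting.

(** * Diagonalization of compact operators and of their tensor products *)

Section HilbertBasics.
Variables (R : realType) (K : numFieldType) (k : realOrComplex R K).
Implicit Types (H : hilbertSpace k) (a b : R).
Local Notation "''[' x , y ]" := (inner _ x y).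

Lemma ofreal_lt a b : (ofreal k a < ofreal k b) = (a < b).
Proof. by rewrite !lt_neqAle ofreal_le (fmorph_eq (ofreal k)). Qed.

Lemma ofreal_ge0 a : (0 <= ofreal k a) = (0 <= a).
Proof. by rewrite -(rmorph0 (ofreal k)) ofreal_le. Qed.

Lemma ofreal_gt0 a : (0 < ofreal k a) = (0 < a).
Proof. by rewrite -(rmorph0 (ofreal k)) ofreal_lt. Qed.

Lemma normr_ofreal a : `|ofreal k a| = ofreal k `|a|.
Proof.
have [a0|a0] := leP 0 a; first by rewrite !ger0_norm// ofreal_ge0.
by rewrite !ltr0_norm// ?rmorphN// -(rmorph0 (ofreal k)) ofreal_lt.
Qed.

Lemma innerC H (x y : H) : '[x, y] = conj k '[y, x].
Proof. by rewrite hermC expr0 mul1r. Qed.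

Lemma innerDl H (x y z : H) : '[x + y, z] = '[x, z] + '[y, z].
Proof. exact: linearDl. Qed.
Lemma innerBl H (x y z : H) : '[x - y, z] = '[x, z] - '[y, z].
Proof. exact: linearBl. Qed.
Lemma innerZl H c (x y : H) : '[c *: x, y] = c * '[x, y].
Proof. exact: linearZl_LR. Qed.
Lemma innerDr H (x y z : H) : '[z, x + y] = '[z, x] + '[z, y].
Proof. exact: linearDr. Qed.
Lemma innerBr H (x y z : H) : '[z, x - y] = '[z, x] - '[z, y].
Proof. exact: linearBr. Qed.
Lemma innerZr H c (x y : H) : '[y, c *: x] = conj k c * '[y, x].
Proof. exact: linearZr_LR. Qed.
Lemma inner0l H (x : H) : '[0, x] = 0.
Proof. exact: linear0l. Qed.
Lemma inner0r H (x : H) : '[x, 0] = 0.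
Proof. exact: linear0r. Qed.
Lemma inner_suml H (I : Type) (r : seq I) (P : pred I) (f : I -> H) (x : H) :
  '[\sum_(i <- r | P i) f i, x] = \sum_(i <- r | P i) '[f i, x].
Proof. exact: linear_sumlz. Qed.

Lemma conj_real (z : K) : z \is Num.real -> conj k z = z.
Proof.
have [->|z0] := eqVneq z 0; first by rewrite rmorph0.
move=> zr; apply: (mulfI z0); rewrite mul_conj.
by rewrite real_normK// expr2.
Qed.

Lemma conj_ofreal a : conj k (ofreal k a) = ofreal k a.
Proof.
apply: conj_real; rewrite realE; have [a0|a0] := leP 0 a.
  by rewrite ofreal_ge0 a0.
by apply/orP; right; rewrite -(rmorph0 (ofreal k)) ofreal_le ltW.
Qed.

Lemma real_norm_ex (V : normedZmodType K) (x : V) : exists a : R, ofreal k a = `|x|.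
Proof. by apply: ofreal_surj; exact: normr_real. Qed.

(* The norm of [V] takes values in [K]; [rnorm] is the same number in [R]. *)
Definition rnorm (V : normedZmodType K) (x : V) : R := sval (cid (real_norm_ex x)).

Lemma rnormE (V : normedZmodType K) (x : V) : ofreal k (rnorm x) = `|x|.
Proof. by rewrite /rnorm; case: cid. Qed.

Lemma ofreal_inj : injective (ofreal k).
Proof. exact: fmorph_inj. Qed.

Lemma rnorm_ge0 (V : normedZmodType K) (x : V) : 0 <= rnorm x.
Proof. by rewrite -ofreal_ge0 rnormE. Qed.

Lemma rnorm_eq0 (V : normedZmodType K) (x : V) : (rnorm x == 0) = (x == 0).
Proof. by rewrite -(fmorph_eq0 (ofreal k)) rnormE normr_eq0. Qed.

Lemma rnormD (V : normedZmodType K) (x y : V) : rnorm (x + y) <= rnorm x + rnorm y.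
Proof. by rewrite -(ofreal_le k) rmorphD/= !rnormE ler_normD. Qed.

Lemma rnormN (V : normedZmodType K) (x : V) : rnorm (- x) = rnorm x.
Proof. by apply: ofreal_inj; rewrite !rnormE normrN. Qed.

Lemma rnormB (V : normedZmodType K) (x y : V) : rnorm (x - y) <= rnorm x + rnorm y.
Proof. by rewrite -(rnormN y) rnormD. Qed.

Lemma rnormZ (V : normedModType K) c (x : V) : rnorm (c *: x) = rnorm c * rnorm x.
Proof. by apply: ofreal_inj; rewrite rmorphM/= !rnormE normrZ. Qed.

Lemma rnorm_ofreal a : rnorm (ofreal k a : K) = `|a|.
Proof. by apply: ofreal_inj; rewrite rnormE normr_ofreal. Qed.

Lemma rnorm_sqr H (x : H) : ofreal k (rnorm x ^+ 2) = '[x, x].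
Proof. by rewrite rmorphXn/= rnormE normr_inner. Qed.

Lemma inner_eq0 H (x : H) : ('[x, x] == 0) = (x == 0).
Proof. by rewrite -normr_inner expf_eq0/= normr_eq0. Qed.

(** [z] is ['[y, y]] times the component of [x] orthogonal to [y]; clearing the denominator avoids
    division in [K]. *)
Lemma cauchy_schwarz H (x y : H) : rnorm '[x, y] <= rnorm x * rnorm y.
Proof.
have [->|y0] := eqVneq y 0.
  rewrite inner0r (eqP (_ : rnorm (0 : K) == 0)) ?rnorm_eq0//.
  by rewrite mulr_ge0 ?rnorm_ge0.
pose z := '[y, y] *: x - '[x, y] *: y.
have zy : '[z, y] = 0 by rewrite innerBl !innerZl mulrC subrr.
have zz : '[z, z] = '[y, y] * ('[y, y] * '[x, x] - `|'[x, y]| ^+ 2).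
  rewrite {2}/z innerBr !innerZr zy mulr0 subr0 -innerC; congr (_ * _).
  by rewrite /z innerBl !innerZl (innerC y x) mul_conj.
have ny : 0 < rnorm y by rewrite lt_def rnorm_eq0 y0 rnorm_ge0.
have : 0 <= rnorm y ^+ 2 * (rnorm y ^+ 2 * rnorm x ^+ 2 - rnorm '[x, y] ^+ 2).
  rewrite -ofreal_ge0 (_ : ofreal k _ = '[z, z]); first by rewrite -normr_inner exprn_ge0.
  by rewrite zz -!rnorm_sqr -rnormE -!(rmorphXn (ofreal k)) -!rmorphM -!rmorphB -!rmorphM.
rewrite pmulr_rge0 ?exprn_gt0// subr_ge0 -exprMn ler_sqr ?nnegrE ?mulr_ge0 ?rnorm_ge0//.
by rewrite mulrC.
Qed.

Lemma rnormD_sqr H (x y : H) : '[x, y] = 0 ->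
  rnorm (x + y) ^+ 2 = rnorm x ^+ 2 + rnorm y ^+ 2.
Proof.
move=> xy; apply: ofreal_inj; rewrite rmorphD/= !rnorm_sqr innerDl !innerDr xy.
by rewrite (innerC y x) xy rmorph0 addr0 add0r.
Qed.

Lemma nbhs_rnorm (V : normedModType K) (x : V) (e : R) : 0 < e ->
  nbhs x [set y | rnorm (x - y) < e].
Proof.
move=> e0; apply/nbhs_ballP; exists (ofreal k e) => /=; first by rewrite ofreal_gt0.
by move=> y; rewrite -ball_normE/= -rnormE ofreal_lt.
Qed.

End HilbertBasics.

(** * Eigenvectors of compact nonnegative operators *)

Section CompactOperators.
Variables (R : realType) (K : numFieldType) (k : realOrComplex R K).
Variables (H : hilbertSpace k) (A : {linear H -> H}).
Local Notation "''[' x , y ]" := (inner H x y).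
Local Notation "`[| x |]" := (rnorm k x).
Implicit Types (x y : H).

Lemma rnorm_small_eq0 (V : normedZmodType K) (x : V) (C : R) :
  (forall d : R, 0 < d -> rnorm k x <= C * d) -> x = 0.
Proof.
move=> xC; apply/eqP; rewrite -(rnorm_eq0 k) eq_le rnorm_ge0 andbT.
apply/ler_addgt0Pr => e e0; rewrite add0r.
have C0 : 0 < `|C| + 1 by rewrite ltr_wpDl.
apply: (le_trans (xC _ (divr_gt0 e0 C0))).
rewrite mulrCA ler_piMr ?(ltW e0)// ler_pdivrMr// mul1r.
by rewrite (le_trans (ler_norm C))// lerDl.
Qed.

(** Replaces the extraction of a convergent subsequence: the images of the sets [P e] generate a
    filter as [e] decreases to 0, and compactness gives it a cluster point. *)
Lemma compact_extract (P : R -> set H) : compact_operator A ->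
  (forall d e, d <= e -> P d `<=` P e) ->
  (forall e, 0 < e -> exists x, rnorm k x <= 1 /\ P e x) ->
  exists y, forall e, 0 < e -> exists x, [/\ rnorm k x <= 1, P e x & rnorm k (y - A x) < e].
Proof.
rewrite /compact_operator precompactE => cA Pmono Pex.
pose B (e : R) := A @` [set x | rnorm k x <= 1 /\ P e x].
have FF : ProperFilter (filter_from [set e : R | 0 < e] B).
  apply: filter_from_proper; last by move=> e /Pex[x xP]; exists (A x), x.
  apply: filter_from_filter; first by exists 1 => /=.
  move=> d e /= d0 e0; exists (Num.min d e); first by rewrite /= lt_min d0.
  move=> _ [x [x1 Px] <-]; split; exists x => //; split => //; apply: Pmono Px.
    by rewrite ge_min lexx.
  by rewrite ge_min lexx orbT.
have Fcl : filter_from [set e : R | 0 < e] B (closure (A @` [set x | `|x| <= 1])).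
  exists 1 => //= _ [x [x1 _] <-]; apply: subset_closure; exists x => //=.
  by rewrite -(rnormE k) -(rmorph1 (ofreal k)) ofreal_le.
have [y [_ yF]] := cA _ FF Fcl; exists y => e e0.
have Be : filter_from [set e : R | 0 < e] B (B e) by exists e.
have [_ [[x [x1 Px] <-] yx]] := yF _ _ Be (nbhs_rnorm k y e0).
by exists x.
Qed.

Lemma compact_operator_bounded : compact_operator A ->
  exists2 B, 0 < B & forall x, rnorm k (A x) <= B * rnorm k x.
Proof.
move=> cA; have [B HB] : exists B, forall x, rnorm k x <= 1 -> rnorm k (A x) <= B.
  apply/not_existsP => unb.
  have [d e de x /=|e e0|y Hy] :=
    @compact_extract (fun e => [set x | e^-1 <= rnorm k (A x) /\ 0 < e]) cA.
  - move=> [dx d0]; have e0 : 0 < e by exact: lt_le_trans de.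
    by split => //; apply: le_trans dx; rewrite lef_pV2.
  - have /existsNP[x] := unb e^-1.
    move=> /not_implyP[x1 /negP]; rewrite -ltNge => ex.
    by exists x; split => //; split => //; exact: ltW.
  have y2 : 0 < rnorm k y + 2 by rewrite ltr_wpDl ?rnorm_ge0.
  (* The image [A x] has norm at least [rnorm k y + 2] by the choice of [P], yet lies within
     distance 1 of [y]. *)
  have [x [_ [+ _] yx]] := Hy (rnorm k y + 2)^-1 ltac:(by rewrite invr_gt0).
  rewrite invrK; apply/negP; rewrite -ltNge.
  have := rnormB k y (y - A x); rewrite subKr => /le_lt_trans; apply.
  rewrite ltrD2l; apply: (lt_trans yx); apply: (@lt_trans _ _ 1); last by lra.
  by rewrite invf_lt1//; have := rnorm_ge0 k y; lra.
exists (`|B| + 1); first by rewrite ltr_wpDl.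
move=> x; have [->|x0] := eqVneq x 0.
  by rewrite linear0 (eqP (_ : rnorm k (0 : H) == 0)) ?rnorm_eq0// mulr0.
have nx : 0 < rnorm k x by rewrite lt_def rnorm_eq0 x0 rnorm_ge0.
have /HB : rnorm k ((ofreal k (rnorm k x))^-1 *: x) <= 1.
  by rewrite rnormZ -fmorphV rnorm_ofreal gtr0_norm ?invr_gt0// mulVf ?gt_eqF.
rewrite linearZ/= rnormZ -fmorphV rnorm_ofreal gtr0_norm ?invr_gt0// mulrC.
rewrite ler_pdivrMr// => /le_trans; apply; rewrite ler_pM2r//.
by rewrite (le_trans (ler_norm B))// lerDl.
Qed.

(* If [M] is the norm of [A] on the orthogonal complement of [S], a cluster point [y] of [A x]
   along maximizing [x] satisfies [A (A y) = M ^+ 2 *: y]; then [A y + M *: y] is the wanted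
   eigenvector, which is nonzero because [A] is nonnegative. *)
Lemma top_eigenvector (S : set H) (t : R) (x0 : H) :
  compact_operator A -> self_adjoint A -> nonnegative_operator A ->
  (forall s, S s -> exists mu : R, A s = ofreal k mu *: s) ->
  0 <= t -> (forall s, S s -> '[x0, s] = 0) -> t * rnorm k x0 < rnorm k (A x0) ->
  exists w mu, [/\ t < mu, w != 0, A w = ofreal k mu *: w & forall s, S s -> '[w, s] = 0].
Proof.
move=> cA sa nonneg Seig t0 x0S tx0.
have [B B0 HB] := compact_operator_bounded cA.
pose V := [set x | forall s, S s -> '[x, s] = 0].
have VA x : V x -> V (A x).
  move=> xV s Ss; have [mu smu] := Seig s Ss.
  by rewrite sa smu innerZr xV// mulr0.
pose X := [set r | exists x, [/\ V x, rnorm k x <= 1 & r = rnorm k (A x)]].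
have nx0 : 0 < rnorm k x0.
  rewrite lt_def rnorm_ge0 andbT; apply/eqP => x00; move: tx0.
  have /eqP -> : x0 == 0 by rewrite -(rnorm_eq0 k) x00.
  by rewrite linear0 (eqP (_ : rnorm k (0 : H) == 0)) ?rnorm_eq0// mulr0 ltxx.
have VZ c x : V x -> V (c *: x) by move=> xV s Ss; rewrite innerZl xV// mulr0.
have VD x y : V x -> V y -> V (x + y).
  by move=> xV yV s Ss; rewrite innerDl xV// yV// addr0.
have scale x : V x -> 0 < rnorm k x -> X (rnorm k (A x) / rnorm k x).
  move=> xV nx; exists ((ofreal k (rnorm k x))^-1 *: x); split; first exact: VZ.
    by rewrite rnormZ -fmorphV rnorm_ofreal gtr0_norm ?invr_gt0// mulVf ?gt_eqF.
  by rewrite linearZ/= rnormZ -fmorphV rnorm_ofreal gtr0_norm ?invr_gt0// mulrC.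
have Xub : has_ubound X.
  exists B => _ [x [_ x1 ->]]; apply: (le_trans (HB x)).
  by rewrite ler_piMr// ltW.
have Xsup : has_sup X by split=> //; eexists; exact: (scale x0).
pose M := sup X.
have tM : t < M.
  apply: (@lt_le_trans _ _ (rnorm k (A x0) / rnorm k x0)); first by rewrite ltr_pdivlMr.
  by apply: ub_le_sup => //; exact: scale.
have M0 : 0 < M by exact: le_lt_trans tM.
have VM x : V x -> rnorm k (A x) <= M * rnorm k x.
  move=> xV; have [nx|nx] := ltP 0 (rnorm k x).
    by rewrite -ler_pdivrMr//; apply: ub_le_sup => //; exact: scale.
  have /eqP -> : x == 0 by rewrite -(rnorm_eq0 k) eq_le nx rnorm_ge0.
  by rewrite linear0 (eqP (_ : rnorm k (0 : H) == 0)) ?rnorm_eq0// mulr0.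
have [d e de x [xV dx]|e e0|y Hy] :=
    @compact_extract (fun e => [set x | V x /\ M - e <= rnorm k (A x)]) cA.
- by split => //; apply: le_trans dx; rewrite lerD2l lerN2.
- have [r [x [xV x1 ->]] rM] := sup_adherent e0 Xsup.
  by exists x; split => //; split => //; exact: ltW.
(* Expanding the square, with ['[A (A x), x]] equal to the squared norm of [A x], shows that
   near-maximizers of the norm of [A x] are near-eigenvectors of [A] squared. *)
have AAx x : V x -> rnorm k x <= 1 ->
    rnorm k (A (A x) - ofreal k (M ^+ 2) *: x) ^+ 2 <= M ^+ 2 * (M ^+ 2 - rnorm k (A x) ^+ 2).
  move=> xV x1; rewrite -(ofreal_le k) rnorm_sqr.
  have e1 : '[A (A x), x] = ofreal k (rnorm k (A x) ^+ 2) by rewrite sa rnorm_sqr.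
  have -> : '[A (A x) - ofreal k (M ^+ 2) *: x, A (A x) - ofreal k (M ^+ 2) *: x] =
      ofreal k (rnorm k (A (A x)) ^+ 2 - 2 * M ^+ 2 * rnorm k (A x) ^+ 2
        + M ^+ 2 * M ^+ 2 * rnorm k x ^+ 2).
    rewrite innerBr !innerBl !innerZr !innerZl (innerC x (A (A x))) e1 !conj_ofreal.
    rewrite -!rnorm_sqr -!rmorphM -!rmorphB. congr (ofreal k _); ring.
  rewrite ofreal_le.
  have h1 : rnorm k (A (A x)) ^+ 2 <= M ^+ 2 * rnorm k (A x) ^+ 2.
    rewrite -exprMn ler_sqr ?nnegrE ?mulr_ge0 ?rnorm_ge0 ?(ltW M0)//.
    exact: VM (VA _ xV).
  have h2 : M ^+ 2 * M ^+ 2 * rnorm k x ^+ 2 <= M ^+ 2 * M ^+ 2.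
    apply: ler_piMr; first by rewrite mulr_ge0 ?sqr_ge0.
    by rewrite -(expr1n R 2) ler_sqr ?nnegrE ?rnorm_ge0.
  lra.
have yV : V y.
  move=> s Ss; apply: (@rnorm_small_eq0 _ _ (rnorm k s)) => d d0.
  have [x [_ [xV _] yx]] := Hy d d0.
  rewrite (_ : '[y, s] = '[y - A x, s]); last by rewrite innerBl VA// subr0.
  apply: (le_trans (cauchy_schwarz _ _)); rewrite mulrC ler_wpM2l ?rnorm_ge0//.
  exact: ltW.
have ny : M <= rnorm k y.
  apply/ler_addgt0Pr => e e0; have e2 : 0 < e / 2 by rewrite divr_gt0.
  have [x [_ [_ Mx] yx]] := Hy _ e2.
  have := rnormB k y (y - A x); rewrite subKr.
  by lra.
have AAy : A (A y) = ofreal k (M ^+ 2) *: y.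
  apply/eqP; rewrite -subr_eq0; apply/eqP.
  apply: (@rnorm_small_eq0 _ _ (B * B + M ^+ 2 + B)) => d d0.
  have M3 : 0 < 2 * M ^+ 3 by rewrite mulr_gt0 ?exprn_gt0.
  (* [e <= d] controls [y - A x], [e <= M] permits squaring [M - e], and the last bound gives [M ^+
     2 * (M ^+ 2 - (M - e) ^+ 2) <= 2 * M ^+ 3 * e <= d ^+ 2]. *)
  pose e := Num.min d (Num.min M (d ^+ 2 / (2 * M ^+ 3))).
  have e0 : 0 < e by rewrite !lt_min d0 M0 divr_gt0 ?exprn_gt0.
  have ed : e <= d by rewrite ge_min lexx.
  have eM : e <= M by rewrite !ge_min lexx orbT.
  have ed2 : e * (2 * M ^+ 3) <= d ^+ 2.
    by rewrite -ler_pdivlMr// !ge_min lexx !orbT.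
  have [x [x1 [xV Mx] yx]] := Hy _ e0.
  have -> : A (A y) - ofreal k (M ^+ 2) *: y = A (A (y - A x)) -
      ofreal k (M ^+ 2) *: (y - A x) + A (A (A x) - ofreal k (M ^+ 2) *: x).
    rewrite scalerBr !(linearB A)/= (linearZ_LR A)/=.
    by rewrite opprB addrACA subrK [X in _ = _ + X]addrAC subrr add0r.
  have hA : rnorm k (A (A x) - ofreal k (M ^+ 2) *: x) <= d.
    rewrite -ler_sqr ?nnegrE ?rnorm_ge0 ?(ltW d0)//; apply: le_trans (AAx x xV x1) _.
    apply: le_trans ed2.
    have : (M - e) ^+ 2 <= rnorm k (A x) ^+ 2.
      by rewrite ler_sqr ?nnegrE ?rnorm_ge0// subr_ge0.
    rewrite sqrrB => hsq.
    apply: (@le_trans _ _ (M ^+ 2 * (2 * M * e))).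
      rewrite ler_pM2l ?exprn_gt0//.
      have : 0 <= e ^+ 2 by rewrite sqr_ge0.
      by rewrite -mulr_natl in hsq; lra.
    by rewrite le_eqVlt; apply/orP; left; apply/eqP; ring.
  apply: (le_trans (rnormD _ _ _)); rewrite mulrDl lerD//; last first.
    by apply: (le_trans (HB _)); rewrite ler_pM2l.
  apply: (le_trans (rnormB _ _ _)); rewrite mulrDl lerD//.
    apply: (le_trans (HB _)); rewrite -mulrA ler_pM2l//.
    apply: (le_trans (HB _)); rewrite ler_pM2l//.
    by apply: le_trans ed; exact: ltW.
  rewrite rnormZ rnorm_ofreal ger0_norm ?sqr_ge0// ler_pM2l ?exprn_gt0//.
  by apply: le_trans ed; exact: ltW.
exists (A y + ofreal k M *: y), M; split => //.
- apply/eqP => w0; have : 0 < '[A y + ofreal k M *: y, y].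
    rewrite innerDl innerZl -rnorm_sqr -rmorphM; apply: ltr_wpDl; first exact: nonneg.
    by rewrite ofreal_gt0 mulr_gt0// exprn_gt0// (lt_le_trans M0).
  by rewrite w0 inner0l ltxx.
- by rewrite linearD linearZ/= AAy scalerDr scalerA -rmorphM expr2 addrC.
- by move=> s Ss; apply: VD => //; [exact: VA|exact: VZ].
Qed.

End CompactOperators.

(** * Spectral theorem for compact nonnegative operators *)

Section Diagonalization.
Variables (R : realType) (K : numFieldType) (k : realOrComplex R K).
Implicit Types (H : hilbertSpace k).
Local Notation "''[' x , y ]" := (inner _ x y).

(* Vectors [e i] with [lam i = 0] are irrelevant, so that a set of eigenvectors in [H] can be
   indexed by the whole of [H]. *)
Record diagonalization H (A : H -> H) (I : choiceType) (lam : I -> R) (e : I -> H) := {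
  diag_ge0 : forall i, 0 <= lam i ;
  diag_finite : forall t, 0 < t -> finite_set [set i | t < lam i] ;
  diag_orthonormal : forall i j, 0 < lam i -> 0 < lam j -> '[e i, e j] = (i == j)%:R ;
  diag_eigen : forall i, 0 < lam i -> A (e i) = ofreal k (lam i) *: e i ;
  diag_adjoint : forall i x, 0 < lam i -> '[A x, e i] = ofreal k (lam i) * '[x, e i] ;
  diag_complete : forall x, (forall i, 0 < lam i -> '[x, e i] = 0) -> A x = 0
}.

Lemma inner_sum_orthonormal H (I : eqType) (s : seq I) (e : I -> H) (c : I -> K) j :
  uniq s -> j \in s -> (forall i, i \in s -> '[e i, e j] = (i == j)%:R) ->
  '[\sum_(i <- s) c i *: e i, e j] = c j.
Proof.
move=> us js ortho; rewrite inner_suml (bigD1_seq j)//= innerZl ortho// eqxx mulr1.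
rewrite big_seq_cond big1 ?addr0// => i /andP[si ij].
by rewrite innerZl ortho// (negbTE ij) mulr0.
Qed.

(* The second clause says that the range of [A] lies in the closed span of the eigenvectors
   with positive eigenvalues, without mentioning closed subspaces. *)
Lemma compact_diagonalization H (A : {linear H -> H}) :
  compact_operator A -> self_adjoint A -> nonnegative_operator A ->
  exists lam : H -> R, diagonalization A lam id /\
    forall (l : H -> K) (C : R), (forall c x y, l (c *: x + y) = c * l x + l y) ->
      (forall x, rnorm k (l x) <= C * rnorm k x) ->
      (forall x, 0 < lam x -> l x = 0) -> forall x, l (A x) = 0.
Proof.
move=> cA sa nonneg.
pose P (E : set H) :=
  (forall x, E x -> '[x, x] = 1 /\ exists2 mu : R, 0 < mu & A x = ofreal k mu *: x) /\
  (forall x y, E x -> E y -> x != y -> '[x, y] = 0).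
have [E [PE Emax]] : exists E, P E /\ forall B, E `<` B -> ~ P B.
  apply: Zorn_bigcup => F FP Ftot.
  split; [move=> x [X FX Xx]|move=> x y [X FX Xx] [Y FY Yy] xy].
    by have [+ _] := FP _ FX; exact.
  have [XY|YX] := Ftot _ _ FX FY.
    by have [_ +] := FP _ FY; apply => //; exact: XY.
  by have [_ +] := FP _ FX; apply => //; exact: YX.
have [E1 E2] := PE.
pose lam x := if pselect (E x) then rnorm k (A x) else 0.
have n1 x : E x -> rnorm k x = 1.
  move=> /E1[xx _]; apply/eqP; rewrite -[_ == _](eqrXn2 (isT : (0 < 2)%N)) ?rnorm_ge0//.
  by rewrite expr1n; apply/eqP/(ofreal_inj (k:=k)); rewrite rnorm_sqr xx rmorph1.
have lamE x : E x -> 0 < lam x /\ A x = ofreal k (lam x) *: x.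
  move=> Ex; rewrite /lam; case: pselect => //= _.
  have [xx [mu mu0 Ax]] := E1 x Ex.
  have -> : rnorm k (A x) = mu by rewrite Ax rnormZ rnorm_ofreal gtr0_norm// n1// mulr1.
  by [].
have lam_gt0 x : 0 < lam x -> E x.
  by rewrite /lam; case: pselect => //=; rewrite ltxx.
have lam_ge0 x : 0 <= lam x by rewrite /lam; case: pselect => //= _; exact: rnorm_ge0.
have ortho x y : E x -> E y -> '[x, y] = (x == y)%:R.
  move=> Ex Ey; have [<-|xy] := eqVneq x y; last exact: E2.
  by have [] := E1 x Ex.
(* Otherwise [top_eigenvector] gives an eigenvalue [mu > t]. Its eigenvector is orthogonal to the
   members of [E] with eigenvalue above [t] by construction and to the others because the
   eigenvalues differ, so it would enlarge [E]. *)
have small t x : 0 <= t -> (forall e, t < lam e -> '[x, e] = 0) ->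
    rnorm k (A x) <= t * rnorm k x.
  move=> t0 xS; rewrite leNgt; apply/negP => tx.
  have [|s Ss|w [mu [tmu w0 Aw wS]]] := @top_eigenvector _ _ k H A
    [set e | t < lam e] t x cA sa nonneg _ t0 _ tx.
  - move=> s /= ts; exists (lam s); have [|] := lamE s => //.
    by apply: lam_gt0; exact: le_lt_trans ts.
  - exact: xS.
  have mu0 : 0 < mu by exact: le_lt_trans tmu.
  have nw : 0 < rnorm k w by rewrite lt_def rnorm_eq0 w0 rnorm_ge0.
  pose w' := (ofreal k (rnorm k w))^-1 *: w.
  have nz : ofreal k (rnorm k w) != 0 by rewrite fmorph_eq0 gt_eqF.
  have w'0 : '[w', w'] = 1.
    rewrite innerZl innerZr fmorphV conj_ofreal -rnorm_sqr rmorphXn/=.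
    by field.
  have Aw' : A w' = ofreal k mu *: w'.
    by rewrite linearZ/= Aw !scalerA mulrC.
  have w'E e : E e -> '[w', e] = 0.
    move=> Ee; rewrite innerZl; have [le0 Ae] := lamE e Ee.
    have [te|te] := ltP t (lam e); first by rewrite wS// mulr0.
    have : '[A w, e] = '[w, A e] by exact: sa.
    rewrite Aw Ae innerZl innerZr conj_ofreal => /eqP.
    rewrite -subr_eq0 -mulrBl -rmorphB mulf_eq0 fmorph_eq0 subr_eq0.
    rewrite gt_eqF//=; last by lra.
    by move=> /eqP ->; rewrite mulr0.
  apply: (Emax (E `|` [set w'])).
    split; first exact: subsetUl.
    move=> /(_ w' (or_intror erefl)) Ew'.
    by have := w'E _ Ew'; rewrite w'0 => /eqP; rewrite oner_eq0.
  split=> [y [/E1//|->]|y z [Ey|->] [Ez|->]]; first by split=> //; exists mu.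
  - exact: E2.
  - by rewrite innerC w'E// rmorph0.
  - by rewrite w'E.
  - by rewrite eqxx.
(* Images of two distinct members of [E] with eigenvalues above [t] are more than [t] apart by
   Pythagoras, so infinitely many of them would contradict compactness. *)
have fin t : 0 < t -> finite_set [set i | t < lam i].
  move=> t0; apply: contrapT => /infiniteP/pcard_leP[f0].
  have [f fS finj] : exists2 f : nat -> H, forall n, t < lam (f n) & injective f.
    exists f0; first by move=> n; exact: (@funS _ _ _ _ f0 n I).
    by move=> m n mn; apply: (@inj _ _ _ f0) => //; exact: mem_set.
  have fE n : E (f n) by apply: lam_gt0; exact: lt_trans (fS n).
  (* The condition [1 <= n.+1%:R * e] forces the index to infinity as [e] tends to 0. A second
     choice of [e] below [n1'.+2%:R^-1] therefore yields an index different from [n1']. *)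
  have [d e de x [n dn ->]|e e0|y Hy] :=
      @compact_extract _ _ k H A
        (fun e => [set x | exists2 n : nat, 1 <= n.+1%:R * e & x = f n]) cA.
  - by exists n => //; apply: le_trans dn _; rewrite ler_pM2l.
  - exists (f (Num.truncn e^-1)); rewrite n1//; split=> //.
    by exists (Num.truncn e^-1) => //; rewrite -ler_pdivrMr// div1r ltW// truncnS_gt.
  have t2 : 0 < t / 2 by rewrite divr_gt0.
  have [_ [_ [n1' _ ->] yn1]] := Hy _ t2.
  have e2 : 0 < Num.min (t / 2) (n1'.+2%:R)^-1 by rewrite lt_min t2 invr_gt0 ltr0n.
  have [_ [_ [n2 n2e ->] yn2]] := Hy _ e2.
  have n12 : f n1' != f n2.
    apply/eqP => /finj n12; move: n2e; rewrite -n12; apply/negP; rewrite -ltNge.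
    apply: (@le_lt_trans _ _ (n1'.+1%:R * n1'.+2%:R^-1)).
      by rewrite ler_pM2l// ge_min lexx orbT.
    by rewrite ltr_pdivrMr// mul1r ltr_nat.
  have h1 : rnorm k (A (f n2) - A (f n1')) <= t.
    rewrite (_ : _ - _ = (y - A (f n1')) - (y - A (f n2))); last by rewrite opprB [RHS]addrC subrKA.
    apply: (le_trans (rnormB _ _ _)); rewrite (splitr t) lerD//; first exact: ltW.
    by apply: ltW; apply: (lt_le_trans yn2); rewrite ge_min lexx.
  have l1 := fS n1'; have l2 := fS n2.
  have : rnorm k (A (f n2) - A (f n1')) ^+ 2 = lam (f n2) ^+ 2 + lam (f n1') ^+ 2.
    have [_ ->] := lamE _ (fE n2); have [_ ->] := lamE _ (fE n1').
    rewrite rnormD_sqr.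
      by rewrite rnormN !rnormZ !rnorm_ofreal !(n1 _ (fE _)) !mulr1 !ger0_norm.
    by rewrite -scaleNr innerZl innerZr E2// ?mulr0// eq_sym.
  have : rnorm k (A (f n2) - A (f n1')) ^+ 2 <= t ^+ 2.
    by rewrite ler_sqr ?nnegrE ?rnorm_ge0 ?(ltW t0).
  have : t ^+ 2 < lam (f n2) ^+ 2 by rewrite ltr_sqr ?nnegrE// ltW.
  have : 0 <= lam (f n1') ^+ 2 by rewrite sqr_ge0.
  by move=> a1 a2 a3 a4; lra.
exists lam; split.
  split => //.
  - by move=> i j /lam_gt0 Ei /lam_gt0 Ej; exact: ortho.
  - by move=> i /lam_gt0 /lamE[].
  - move=> i x /lam_gt0 /lamE[_ Ai].
    by rewrite /= sa Ai innerZr conj_ofreal.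
  - move=> x xE; apply: (@rnorm_small_eq0 _ _ k _ _ (rnorm k x)) => d d0.
    by rewrite mulrC small// ?ltW// => e de; apply: xE; exact: lt_trans de.
move=> l C llin lC lE u.
have l0 : l 0 = 0.
  have := llin 1 0 0; rewrite scale1r addr0 mul1r => /eqP.
  by rewrite -subr_eq0 opprD addNKr oppr_eq0 => /eqP.
have lD x y : l (x + y) = l x + l y by rewrite -[x]scale1r llin mul1r scale1r.
have lZ c x : l (c *: x) = c * l x by rewrite -[c *: x]addr0 llin l0 addr0.
have C0 : 0 <= `|C| by [].
apply: (@rnorm_small_eq0 _ _ k _ _ (`|C| * rnorm k u)) => t t0.
pose F : seq H := fset_set [set e | t < lam e].
have FE e : e \in F -> t < lam e by rewrite in_fset_set; [move=> /set_mem|exact: fin].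
have FP e : t < lam e -> e \in F by move=> te; rewrite in_fset_set; [exact: mem_set|exact: fin].
have EF e : e \in F -> E e by move=> /FE te; apply: lam_gt0; exact: lt_trans te.
(* The finite part [z] is sent by [A] into the kernel of [l], and on the orthogonal remainder [A]
   has norm at most [t], with [t] arbitrary. *)
pose z := \sum_(e <- F) '[u, e] *: e.
have wz e : e \in F -> '[u - z, e] = 0.
  move=> eF; rewrite innerBl (inner_sum_orthonormal (e := id))// ?subrr// ?fset_uniq//.
  by move=> i iF; apply: ortho; exact: EF.
have wzz : '[u - z, z] = 0.
  rewrite innerC inner_suml big_seq big1 ?rmorph0// => e eF.
  by rewrite innerZl (innerC e) wz// rmorph0 mulr0.
have nw : rnorm k (u - z) <= rnorm k u.
  rewrite -ler_sqr ?nnegrE ?rnorm_ge0// -[in leRHS](subrK z u) (rnormD_sqr wzz).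
  by rewrite lerDl sqr_ge0.
have lAz : l (A z) = 0.
  rewrite /z; have : forall e, e \in F -> l (A e) = 0.
    move=> e eF; have [le0 ->] := lamE e (EF e eF).
    by rewrite lZ lE ?mulr0.
  elim: (F) => [|e F' IH] HF; first by rewrite big_nil linear0.
  rewrite big_cons linearD lD linearZ/= lZ HF ?mem_head// mulr0 add0r IH// => e' e'F.
  by apply: HF; rewrite inE e'F orbT.
rewrite -[u in A u](subrK z) linearD lD lAz addr0.
apply: (le_trans (lC _)).
apply: (@le_trans _ _ (`|C| * rnorm k (A (u - z)))).
  by rewrite ler_wpM2r ?rnorm_ge0// ler_norm.
rewrite -mulrA ler_wpM2l// (le_trans (small t (u - z) (ltW t0) _))//.
  by move=> e /FP; exact: wz.
by rewrite mulrC ler_wpM2r// ltW.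
Qed.

End Diagonalization.

(** * Counting eigenvalues through a diagonalization *)

Section EigenvalueCount.
Variables (R : realType) (K : numFieldType) (k : realOrComplex R K).
Implicit Types (H : hilbertSpace k).
Local Notation "''[' x , y ]" := (inner _ x y).

(** Writing each basis in the other gives matrices with product [1%:M] of size [n], whose rank
    cannot exceed the inner dimension [m]. *)
Lemma basis_leq H (E : set H) n m (v : 'I_n -> H) (w : 'I_m -> H) :
  is_basis E v -> is_basis E w -> (n <= m)%N.
Proof.
move=> [vfree vE] [wfree wE].
have vw i : exists c : 'I_m -> K, v i = \sum_j c j *: w j.
  have : E (v i).
    rewrite vE; exists (fun j => (j == i)%:R) => //.
    by rewrite (bigD1 i)//= eqxx scale1r big1 ?addr0// => j /negbTE ->; rewrite scale0r.
  by rewrite wE => -[c _ <-]; exists c.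
have wv j : exists c : 'I_n -> K, w j = \sum_i c i *: v i.
  have : E (w j).
    rewrite wE; exists (fun i => (i == j)%:R) => //.
    by rewrite (bigD1 j)//= eqxx scale1r big1 ?addr0// => i /negbTE ->; rewrite scale0r.
  by rewrite vE => -[c _ <-]; exists c.
have [M HM] := choice vw; have [N HN] := choice wv.
pose M' : 'M[K]_(n, m) := \matrix_(i, j) M i j.
pose N' : 'M[K]_(m, n) := \matrix_(j, i) N j i.
have MN : M' *m N' = 1%:M.
  apply/matrixP => i l; rewrite !mxE.
  pose c l := \sum_j M' i j * N' j l - (i == l)%:R.
  have c0 : \sum_l c l *: v l = 0.
    rewrite /c; under eq_bigr do rewrite scalerBl; rewrite sumrB.
    rewrite [X in _ - X](bigD1 i)//= eqxx scale1r [X in _ - (_ + X)]big1 ?addr0; last first.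
      by move=> j; rewrite eq_sym => /negbTE ->; rewrite scale0r.
    apply/eqP; rewrite subr_eq0 HM; apply/eqP.
    under eq_bigr do rewrite scaler_suml; rewrite exchange_big/=.
    apply: eq_bigr => j _; rewrite HN scaler_sumr; apply: eq_bigr => l' _.
    by rewrite !mxE scalerA.
  by apply/eqP; rewrite -subr_eq0; apply/eqP; exact: (vfree _ c0 l).
have := @mulmx1_min_rank K n m m 1%:M M' N'.
by rewrite mulmx1 => /(_ MN); rewrite mxrank1.
Qed.

Lemma multiplicity_uniq H (A : H -> H) mu n m :
  has_multiplicity A mu n -> has_multiplicity A mu m -> n = m.
Proof.
move=> [v vE] [w wE]; apply/eqP; rewrite eqn_leq.
by rewrite (basis_leq vE wE) (basis_leq wE vE).
Qed.

Lemma diag_bounded H (A : {linear H -> H}) (I : choiceType) (lam : I -> R) (e : I -> H) :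
  compact_operator A -> diagonalization A lam e -> exists2 B : R, 0 < B & forall i, lam i <= B.
Proof.
move=> cA d; have [B B0 HB] := compact_operator_bounded cA.
exists B => // i; have [li|li] := ltP 0 (lam i); last exact: le_trans li (ltW B0).
have := HB (e i); rewrite (diag_eigen d li) rnormZ rnorm_ofreal gtr0_norm// ler_pM2r//.
rewrite lt_def rnorm_ge0 andbT rnorm_eq0 -inner_eq0.
by rewrite (diag_orthonormal d li li) eqxx oner_eq0.
Qed.

Lemma diag_value_finite H (A : H -> H) (I : choiceType) (lam : I -> R) (e : I -> H) mu :
  diagonalization A lam e -> 0 < mu -> finite_set [set i | lam i = mu].
Proof.
move=> d mu0; have mu2 : 0 < mu / 2 by rewrite divr_gt0.
by apply: sub_finite_set (diag_finite d mu2) => i /= ->; lra.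
Qed.

(** For an eigenvector [x], the remainder [x - z] is orthogonal to the [e i] with [lam i = mu] by
    projection and to the others by the adjoint relation. Completeness gives [A (x - z) = 0], and
    [mu] is nonzero. *)
Lemma diag_multiplicity H (A : {linear H -> H}) (I : choiceType) (lam : I -> R)
    (e : I -> H) mu : diagonalization A lam e -> 0 < mu ->
  has_multiplicity A mu #|` fset_set [set i | lam i = mu]|.
Proof.
move=> d mu0; have fin := diag_value_finite d mu0.
set F := fset_set _; pose f (i : 'I_(#|` F|)) : I := tnth (in_tuple F) i.
have fF i : lam (f i) = mu.
  have : f i \in F by exact: mem_tnth.
  by rewrite in_fset_set// => /set_mem.
have finj i j : (f i == f j) = (i == j).
  apply/eqP/eqP => [|->//]; apply/tuple_uniqP; exact: fset_uniq.
have fsurj i : lam i = mu -> exists j, f j = i.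
  move=> li; have : i \in (in_tuple F) by rewrite in_fset_set//; exact: mem_set.
  by move=> /tnthP[j ->]; exists j.
pose v i := e (f i).
have vv i j : '[v i, v j] = (i == j)%:R.
  by rewrite /v (diag_orthonormal d) ?fF// finj.
have Av i : A (v i) = ofreal k mu *: v i by rewrite (diag_eigen d) fF.
have inner_v (c : 'I_(#|` F|) -> K) j : '[\sum_i c i *: v i, v j] = c j.
  by apply: inner_sum_orthonormal; rewrite ?index_enum_uniq ?mem_index_enum.
exists v; split=> [c c0 i|]; first by rewrite -(inner_v c i) c0 inner0l.
apply/seteqP; split => [x /= Ax|_ [c _ <-]]; last first.
  rewrite /eigen_space/= linear_sum scaler_sumr; apply: eq_bigr => i _.
  by rewrite linearZ/= Av !scalerA mulrC.
exists (fun i => '[x, v i]) => //; set z := \sum_i _.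
apply/eqP; rewrite eq_sym -subr_eq0; apply/eqP.
have Ay : A (x - z) = ofreal k mu *: (x - z).
  rewrite linearB scalerBr Ax; congr (_ - _).
  rewrite /z linear_sum scaler_sumr; apply: eq_bigr => i _.
  by rewrite linearZ/= Av !scalerA mulrC.
have : A (x - z) = 0.
  apply: (diag_complete d) => i li.
  have [lmu|lmu] := eqVneq (lam i) mu.
    have [j <-] := fsurj i lmu; rewrite -/(v j) innerBl inner_v.
    by rewrite subrr.
  have := diag_adjoint d (x - z) li; rewrite Ay innerZl => /eqP.
  rewrite -subr_eq0 -mulrBl -rmorphB mulf_eq0 fmorph_eq0 subr_eq0 eq_sym (negbTE lmu)/=.
  by move=> /eqP.
rewrite Ay => /eqP; rewrite scaler_eq0 fmorph_eq0 gt_eqF//=.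
by move=> /eqP.
Qed.

(** [eigenvalues] is obtained by choice, so some eigenvalue sequence must be exhibited first;
    [sorting] provides it. After that only the multiplicities matter. *)
Lemma eigen_count_diagonalization H (A : {linear H -> H}) (I : choiceType)
    (lam : I -> R) (e : I -> H) (t : R) :
  diagonalization A lam e -> 0 < t -> eigen_count A t = value_count lam t.
Proof.
move=> d t0; have [l [lmono l0 lfib]] := sorting (diag_finite d).
have lseq : eigenvalue_sequence A l.
  split=> // mu mu0; exists #|` fset_set [set i | lam i = mu]|; split.
    exact: diag_multiplicity d mu0.
  exact: lfib.
have [_ _ efib] : eigenvalue_sequence A (eigenvalues A).
  by rewrite /eigenvalues; case: xgetP => [l' _ //|/(_ l)].
pose n mu := #|` fset_set [set i | lam i = mu]|.
apply: (@value_count_eq R I nat lam (eigenvalues A) n t (ltW t0)).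
- exact: (diag_finite d t0).
- move=> mu mu0; have [m lm] := diag_value_finite d mu0.
  by rewrite /n (card_fset_set lm).
- move=> mu mu0; have [m [Am em]] := efib mu mu0.
  by rewrite /n (multiplicity_uniq (diag_multiplicity d mu0) Am).
Qed.

End EigenvalueCount.

(** * Diagonalization of the tensor product *)

Section TensorDiagonalization.
Variables (R : realType) (K : numFieldType) (k : realOrComplex R K).
Implicit Types (H : hilbertSpace k).
Local Notation "''[' x , y ]" := (inner _ x y).

Lemma inner_continuous H (w : H) : continuous (fun x : H => '[x, w] : K^o).
Proof.
move=> x; apply/cvgrPdist_lt => e e0.
have [r re] : exists r, ofreal k r = e by apply: ofreal_surj; exact: gtr0_real.
have r0 : 0 < r by rewrite -(ofreal_gt0 k) re.
have w0 : 0 < rnorm k w + 1 by rewrite ltr_wpDl ?rnorm_ge0.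
have := nbhs_rnorm k x (divr_gt0 r0 w0); apply: filterS => y /= xy.
rewrite -innerBl -re -(rnormE k) ofreal_lt.
apply: (le_lt_trans (cauchy_schwarz _ _)).
apply: (@le_lt_trans _ _ (rnorm k (x - y) * (rnorm k w + 1))).
  by rewrite ler_wpM2l ?rnorm_ge0// lerDl.
by rewrite -ltr_pdivlMr.
Qed.

Lemma dense_eq0 H (S : set H) (f : H -> K^o) : dense S -> continuous f ->
  (forall x, S x -> f x = 0) -> forall x, f x = 0.
Proof.
move=> dS cf fS x; apply: contrapT => /eqP fx.
have fx0 : 0 < `|f x| by rewrite normr_gt0.
have : nbhs x [set y | f y != 0].
  have /cvgrPdist_lt/(_ _ fx0) := cf x; apply: filterS => y /=.
  by apply: contraTneq => ->; rewrite subr0 ltxx.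
rewrite nbhsE => -[W [oW Wx] WU].
have [y [Wy Sy]] := dS W (ex_intro _ x Wx) oW.
by have := WU y Wy; rewrite /= fS// eqxx.
Qed.

Variables (H1 H2 : hilbertSpace k) (H12 : hilbertTensor H1 H2).

Lemma dense_tensor_eq0 (f : H12 -> K^o) : continuous f ->
  (forall x y, f (x + y) = f x + f y) -> (forall u v, f (tens H12 u v) = 0) ->
  forall x, f x = 0.
Proof.
move=> cf fD f0; apply: (dense_eq0 (@dense_tens _ _ _ _ _ H12) cf) => _ [n [x [y ->]]].
have f00 : f 0 = 0 by rewrite -(linear0r (tens H12) 0) f0.
elim: n x y => [|n IH] x y; first by rewrite big_ord0.
by rewrite big_ord_recr/= fD f0 addr0 IH.
Qed.

Lemma tens_inner_eq0 (x : H12) : (forall u v, '[tens H12 u v, x] = 0) -> x = 0.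
Proof.
move=> x0; apply/eqP; rewrite -inner_eq0; apply/eqP.
apply: (dense_tensor_eq0 (inner_continuous (w := x))) => // y z.
exact: innerDl.
Qed.

Lemma rnorm_tens u v : rnorm k (tens H12 u v) = rnorm k u * rnorm k v.
Proof.
apply/eqP; rewrite -[_ == _](eqrXn2 (isT : (0 < 2)%N)) ?mulr_ge0 ?rnorm_ge0//.
apply/eqP/(ofreal_inj (k:=k)).
by rewrite rnorm_sqr inner_tens -!rnorm_sqr -rmorphM exprMn.
Qed.

Variables (A1 : {linear H1 -> H1}) (A2 : {linear H2 -> H2}) (A12 : {linear H12 -> H12}).

(** For fixed [u] and [v] both sides are continuous and additive in [x] and agree on simple tensors,
    whose sums are dense. *)
Lemma tensor_adjoint : self_adjoint A1 -> self_adjoint A2 ->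
  is_tensor_operator A1 A2 A12 ->
  forall x u v, '[A12 x, tens H12 u v] = '[x, tens H12 (A1 u) (A2 v)].
Proof.
move=> sa1 sa2 [cA A12E] x u v; apply/eqP; rewrite -subr_eq0; apply/eqP; move: x.
apply: dense_tensor_eq0 => [x|x y|u' v'].
- apply: cvgB; last exact: inner_continuous.
  apply: (@continuous_comp _ _ _ A12 (fun z : H12 => '[z, tens H12 u v] : K^o)).
    exact: cA.
  exact: inner_continuous.
- by rewrite linearD !innerDl opprD addrACA.
- by rewrite A12E !inner_tens sa1 sa2 subrr.
Qed.

Lemma tensor_diagonalization : compact_operator A1 -> self_adjoint A1 ->
  nonnegative_operator A1 -> compact_operator A2 -> self_adjoint A2 ->
  nonnegative_operator A2 -> is_tensor_operator A1 A2 A12 ->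
  exists (lam1 : H1 -> R) (lam2 : H2 -> R), [/\ diagonalization A1 lam1 id,
    diagonalization A2 lam2 id &
    diagonalization A12 (fun x : H1 * H2 => lam1 x.1 * lam2 x.2)
      (fun x => tens H12 x.1 x.2)].
Proof.
move=> c1 sa1 n1 c2 sa2 n2 A12T; have [cA A12E] := A12T.
have [lam1 [d1 f1]] := compact_diagonalization c1 sa1 n1.
have [lam2 [d2 f2]] := compact_diagonalization c2 sa2 n2.
have p1 := diag_ge0 d1; have p2 := diag_ge0 d2.
have pos u v : 0 < lam1 u * lam2 v -> 0 < lam1 u /\ 0 < lam2 v.
  move=> x0; split; rewrite lt_def ?p1 ?p2 andbT; apply/eqP => l0.
    by move: x0; rewrite l0 mul0r ltxx.
  by move: x0; rewrite l0 mulr0 ltxx.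
have tensZ a b u v : tens H12 (a *: u) (b *: v) = (a * b) *: tens H12 u v.
  by rewrite linearZl_LR linearZr_LR /= scalerA.
have [B1 B10 HB1] := diag_bounded c1 d1; have [B2 B20 HB2] := diag_bounded c2 d2.
exists lam1, lam2; split=> //; split.
- by move=> i; rewrite mulr_ge0.
- move=> t t0; have t1 : 0 < t / B2 by rewrite divr_gt0.
  have t2 : 0 < t / B1 by rewrite divr_gt0.
  apply: sub_finite_set (finite_setX (diag_finite d1 t1) (diag_finite d2 t2)).
  move=> [u v] /= tuv; split => /=; rewrite ltr_pdivrMr//; apply: (lt_le_trans tuv).
    by rewrite ler_wpM2l.
  by rewrite mulrC ler_wpM2l.
- move=> [u v] [u' v'] /= /pos [u0 v0] /pos [u0' v0'].
  rewrite inner_tens (diag_orthonormal d1)// (diag_orthonormal d2)//.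
  by rewrite -natrM mulnb xpair_eqE.
- move=> [u v] /= /pos [u0 v0].
  rewrite A12E (diag_eigen d1 u0) (diag_eigen d2 v0).
  by rewrite tensZ rmorphM.
- move=> [u v] x /= /pos [u0 v0].
  rewrite (tensor_adjoint sa1 sa2 A12T) (diag_eigen d1 u0) (diag_eigen d2 v0)/=.
  by rewrite tensZ -rmorphM innerZr conj_ofreal.
(* It suffices that [x] be orthogonal to all [tens H12 (A1 u) (A2 v)]. The functional clause of
   [compact_diagonalization] is applied in the first variable with an eigenvector in the second, and
   then in the second variable with [A1 u] fixed. *)
move=> x xE; apply: tens_inner_eq0 => u v.
have stepl f : 0 < lam2 f -> forall y, '[tens H12 (A1 y) f, x] = 0.
  move=> f0; apply: (f1 (fun y => '[tens H12 y f, x]) (rnorm k f * rnorm k x)).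
  - by move=> c y z; rewrite linearPl innerDl innerZl.
  - move=> y; apply: (le_trans (cauchy_schwarz _ _)); rewrite rnorm_tens.
    by rewrite mulrAC mulrC mulrA mulrAC.
  - move=> y y0; rewrite innerC (xE (y, f)) ?rmorph0//=.
    exact: mulr_gt0.
have stepr y : '[tens H12 (A1 u) (A2 y), x] = 0.
  apply: (f2 (fun z => '[tens H12 (A1 u) z, x]) (rnorm k (A1 u) * rnorm k x)).
  - by move=> c z z'; rewrite linearPr innerDl innerZl.
  - move=> z; apply: (le_trans (cauchy_schwarz _ _)); rewrite rnorm_tens.
    by rewrite mulrAC.
  - by move=> z z0; exact: stepl.
by rewrite innerC (tensor_adjoint sa1 sa2 A12T) innerC stepr !rmorph0.
Qed.

End TensorDiagonalization.

Theorem theorem4 (R : realType) (K : numFieldType) (k : realOrComplex R K)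
    (H1 H2 : hilbertSpace k) (H12 : hilbertTensor H1 H2)
    (A1 : {linear H1 -> H1}) (A2 : {linear H2 -> H2})
    (A12 : {linear H12 -> H12})
    (p T1 T2 : R) (phi1 phi2 s1 s2 : R -> R) :
  compact_operator A1 -> self_adjoint A1 -> nonnegative_operator A1 ->
  compact_operator A2 -> self_adjoint A2 -> nonnegative_operator A2 ->
  is_tensor_operator A1 A2 A12 ->
  0 < p ->
  slowly_varying phi1 -> C2_slow phi1 ->
  slowly_varying phi2 -> C2_slow phi2 ->
  periodic_factor p T1 s1 ->
  periodic_factor p T2 s2 ->
  (fun t : R => (eigen_count A1 t)%:R : R) ~_(0^'+)
    (fun t => phi1 (1 / t) * s1 (ln (1 / t)) / t `^ (1 / p)) ->
  (fun t : R => (eigen_count A2 t)%:R : R) ~_(0^'+)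
    (fun t => phi2 (1 / t) * s2 (ln (1 / t)) / t `^ (1 / p)) ->
  (\int[lebesgue_measure]_(x in `[1%R, +oo[) (phi1 x / x)%:E = +oo)%E ->
  (\int[lebesgue_measure]_(x in `[1%R, +oo[) (phi2 x / x)%:E = +oo)%E ->
  irrational (T1 / T2) ->
  exists psi : R -> R,
    [/\ slowly_varying psi,
        bounded_separated `]0, +oo[ psi &
        (fun t : R => (eigen_count A12 t)%:R : R) ~_(0^'+)
          (fun t => psi (1 / t) * mellin_conv phi1 phi2 (1 / t) / t `^ (1 / p))].
Proof.
move=> c1 sa1 n1 c2 sa2 n2 A12T p0 sv1 C21 sv2 C22 ps1 ps2 N1h N2h dv1 dv2 irr.
have [lam1 [lam2 [d1 d2 d12]]] := tensor_diagonalization c1 sa1 n1 c2 sa2 n2 A12T.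
have [B1 B10 HB1] := diag_bounded c1 d1; have [B2 B20 HB2] := diag_bounded c2 d2.
pose N12 t : R := (eigen_count A12 t)%:R.
have mono t u : 0 < t -> t <= u -> N12 u <= N12 t.
  move=> t0 tu; rewrite ler_nat !(eigen_count_diagonalization d12)//; last exact: lt_le_trans tu.
  by apply: value_count_mono => //; exact: (diag_finite d12 t0).
have sandwich c E m : Num.max B1 B2 <= c -> 1 < E ->
    stieltjes_sum (fun t => (eigen_count A1 t)%:R) (fun t => (eigen_count A2 t)%:R) c E m
      <= N12 (c ^+ 2 / E ^+ m.+1) /\
    N12 (c ^+ 2 / E ^+ m) <=
      stieltjes_sum (fun t => (eigen_count A1 t)%:R) (fun t => (eigen_count A2 t)%:R) c E m.
  rewrite ge_max => /andP[B1c B2c] E1.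
  have c0 : 0 < c by exact: lt_le_trans B1c.
  have E0 : 0 < E by exact: lt_trans E1.
  have pos (x : R) j : 0 < x -> 0 < x / E ^+ j by move=> x0; rewrite divr_gt0// exprn_gt0.
  have l1 i : 0 <= lam1 i <= c by rewrite (diag_ge0 d1) (le_trans (HB1 i)).
  have l2 i : 0 <= lam2 i <= c by rewrite (diag_ge0 d2) (le_trans (HB2 i)).
  have := value_count_mul_sandwich m c0 E1 l1 l2 (diag_finite d1) (diag_finite d2).
  rewrite /N12 !(eigen_count_diagonalization d12) ?pos ?exprn_gt0//=.
  rewrite /stieltjes_sum; under [in X in _ -> X]eq_bigr => i _.
    rewrite (eigen_count_diagonalization d2 (pos _ _ c0)).
    rewrite !(eigen_count_diagonalization d1 (pos _ _ c0)).
    over.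
  exact.
have [A A0 NA] := stieltjes_asymptotics p0 sv1 C21 sv2 C22 ps1 ps2 N1h N2h dv1 dv2
  irr mono sandwich.
exists (fun=> A); split.
- split => // c c0; apply: cvg_near_cst.
  by near=> x; rewrite divff// gt_eqF.
- by exists A, A; split=> // x _; rewrite lexx.
apply/eqaddoP => e e0.
pose d := Num.min e 2^-1.
have d0 : 0 < d by rewrite lt_min e0 invr_gt0 ltr0n.
have /cvgrPdist_le/(_ _ (mulr_gt0 d0 A0)) := NA.
apply: filterS2 (nbhs_right_gt 0) => t t0; rewrite !fctE -/(N12 t).
set Phi := mellin_conv _ _ _; set ta := t `^ (1 / p).
have ta0 : 0 < ta by rewrite powR_gt0.
(* Division by 0 gives 0, so where [Phi] vanishes the quotient would be at distance [A] from its
   limit; the cap [2^-1] on [d] rules this out. *)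
have [->|Phi0] := eqVneq Phi 0.
  have d_half : d <= 2^-1 by rewrite ge_min lexx orbT.
  by rewrite invr0 mulr0 subr0 gtr0_norm// ler_pMl//; move: d_half; lra.
move=> H; have -> : N12 t - A * Phi / ta = - (A - N12 t * ta / Phi) * (Phi / ta).
  by field; rewrite Phi0 gt_eqF.
have -> : A * Phi / ta = A * (Phi / ta) by rewrite mulrA.
rewrite normrM normrN [X in _ <= e * X]normrM mulrA ler_wpM2r// (gtr0_norm A0).
by apply: (le_trans H); rewrite ler_pM2r// ge_min lexx.
Unshelve. all: by end_near. Qed.
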